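(* Let $A$ be a unital regular semi-simple commutative Banach algebra. Assume there is $C>0$ such that for every $p \in \mathbb{N}$ and all $f_1,\ldots,f_p \in A$, $\|f_1 \cdots f_p\|_A \leq C \sum_{j=1}^p \|f_j\|_A \,\big\| \prod_{k \neq j}\check{f_k}\big\|_{\check{A}}$, and assume that every point of $\partial A$ is a peak point for the algebra $\check{A}$. Let $U$ be an automorphism of $A$ with induced homeomorphism $\varphi$ such that the set of all $\varphi$-periodic points is of first category in $\partial A$ and $\sigma(U) = \mathbb{T}$. Let $w \in A^{-1}$ and $T = wU$. Then $\sigma(T) = \sigma(\check{T})$.
   Context: $A$ is a unital commutative semi-simple Banach algebra with maximal ideal space $\mathfrak{M}_A$ and Shilov boundary $\partial A$; regular means the Gelfand transforms separate points from closed sets in $\mathfrak{M}_A$. For $f\in A$, $\check f$ is the restriction of the Gelfand transform $\hat f$ to $\partial A$; $\check A$ is the closure of $\{\check f: f\in A\}$ in $C(\partial A)$ with the sup norm $\|\cdot\|_{\check A}$. The automorphism $U$ induces a homeomorphism $\varphi$ of $\mathfrak{M}_A$ by $\widehat{Uf}(m)=\hat f(\varphi(m))$, with $\varphi(\partial A)=\partial A$. $T=wU$ means $Tf=w\cdot Uf$; $\check T$ is the operator on $\check A$ given by $(\check Tg)(t)=\check w(t)g(\varphi(t))$. A point is $\varphi$-periodic if $\varphi^n(t)=t$ for some $n\in\mathbb{N}$. A point $t\in\partial A$ is a peak point for $\check A$ if there is $g\in\check A$ with $g(t)=1$ and $|g(s)|<1$ for all $s\in\partial A\setminus\{t\}$.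 $\mathbb{T}$ is the unit circle. *)

(* Defs.v *)
From mathcomp Require Import all_boot all_order all_algebra.
From mathcomp Require Import all_classical all_reals all_analysis.
From mathcomp Require Export complex.
Import Order.TTheory GRing.Theory Num.Theory numFieldNormedType.Exports.
Set Implicit Arguments.
Unset Strict Implicit.
Unset Printing Implicit Defensive.
Local Open Scope classical_set_scope.
Local Open Scope ring_scope.

(* the complex field C, as a numFieldType (so that it carries its norm topology) *)
Definition Cx (R : realType) : numFieldType := R[i].

Record is_comm_banach_alg (R : realType) (A : completeNormedModType (Cx R))
    (mul : A -> A -> A) (one : A) : Prop := {
  ba_mulA : associative mul;
  ba_mulC : commutative mul;
  ba_mul1 : left_id one mul;
  ba_mulDl : left_distributive mul +%R;
  ba_mulZl : forall (a : (Cx R)) (x y : A), mul (a *: x) y = a *: mul x y;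
  ba_one_neq0 : one != 0;
  ba_submult : forall x y : A, `|mul x y| <= `|x| * `|y| }.

Definition aprod (R : realType) (A : completeNormedModType (Cx R))
  (mul : A -> A -> A) (one : A) (p : nat) (f : 'I_p -> A) : A :=
  \big[mul/one]_(j < p) f j.

(* Characters (nonzero multiplicative linear functionals).  They live in the
   space A -> C with the pointwise (= weak-star, Gelfand) topology. *)
Definition is_character (R : realType) (A : completeNormedModType (Cx R))
  (mul : A -> A -> A) (one : A) (m : A -> (Cx R)) : Prop :=
  [/\ forall (a : (Cx R)) (x y : A), m (a *: x + y) = a * m x + m y,
      forall x y : A, m (mul x y) = m x * m y
    & m one = 1].

Definition max_ideal_space (R : realType) (A : completeNormedModType (Cx R))
  (mul : A -> A -> A) (one : A) : set {ptws A -> (Cx R)} :=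
  [set m | is_character mul one m].

Definition closed_in (X : topologicalType) (M F : set X) : Prop :=
  exists G : set X, closed G /\ F = G `&` M.

Definition is_boundary (R : realType) (A : completeNormedModType (Cx R))
  (mul : A -> A -> A) (one : A) (F : set {ptws A -> (Cx R)}) : Prop :=
  F `<=` max_ideal_space mul one /\
  forall f : A, exists2 m0, F m0 &
    forall m, max_ideal_space mul one m -> `|m f| <= `|m0 f|.

Definition shilov_boundary (R : realType) (A : completeNormedModType (Cx R))
  (mul : A -> A -> A) (one : A) : set {ptws A -> (Cx R)} :=
  \bigcap_(F in [set F | closed_in (X := {ptws A -> (Cx R)}) (max_ideal_space mul one) F /\
                         is_boundary mul one F]) F.

Definition semisimple (R : realType) (A : completeNormedModType (Cx R))
  (mul : A -> A -> A) (one : A) : Prop :=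
  forall f : A, (forall m, max_ideal_space mul one m -> m f = 0) -> f = 0.

Definition regular (R : realType) (A : completeNormedModType (Cx R))
  (mul : A -> A -> A) (one : A) : Prop :=
  forall (F : set {ptws A -> (Cx R)}) (m : {ptws A -> (Cx R)}),
    closed_in (X := {ptws A -> (Cx R)}) (max_ideal_space mul one) F -> max_ideal_space mul one m ->
    ~ F m -> exists f : A, m f != 0 /\ (forall m', F m' -> m' f = 0).

Definition supnorm (R : realType) (X : Type) (K : set X) (g : X -> (Cx R)) : R :=
  sup [set complex.Re `|g t| | t in K].

(* The algebra A-check: the sup-norm closure in C(dA) of the restrictions of
   the Gelfand transforms to dA.  Functions are represented on the whole
   character space and normalised to vanish off dA, so that an element of
   C(dA) corresponds to exactly one representative. *)
Definition check_alg (R : realType) (A : completeNormedModType (Cx R))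
  (mul : A -> A -> A) (one : A) : set ({ptws A -> (Cx R)} -> (Cx R)) :=
  [set g | (forall t, ~ shilov_boundary mul one t -> g t = 0) /\
     forall e : R, 0 < e -> exists f : A,
       forall t, shilov_boundary mul one t -> complex.Re `|g t - t f| <= e].

Definition all_peak_points (R : realType) (A : completeNormedModType (Cx R))
  (mul : A -> A -> A) (one : A) : Prop :=
  forall t, shilov_boundary mul one t ->
    exists g, check_alg mul one g /\ g t = 1 /\
      forall s, shilov_boundary mul one s -> s <> t -> `|g s| < 1.

Definition is_automorphism (R : realType) (A : completeNormedModType (Cx R))
  (mul : A -> A -> A) (one : A) (U : A -> A) : Prop :=
  [/\ forall (a : (Cx R)) (x y : A), U (a *: x + y) = a *: U x + U y,
      forall x y : A, U (mul x y) = mul (U x) (U y),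
      U one = one
    & bijective U].

(* the map on M_A induced by U:  (Uf)^(m) = f^(phi m), i.e. phi m = m o U *)
Definition induced_map (R : realType) (A : completeNormedModType (Cx R))
  (U : A -> A) : {ptws A -> (Cx R)} -> {ptws A -> (Cx R)} :=
  fun m => (fun f => m (U f)).

Definition periodic_point (X : Type) (phi : X -> X) (t : X) : Prop :=
  exists n : nat, (0 < n)%N /\ iter n phi t = t.

Definition nowhere_dense (X : topologicalType) (N : set X) : Prop :=
  interior (closure N) = set0.

Definition first_category_in (X : topologicalType) (K P : set X) : Prop :=
  P `<=` K /\
  exists N : nat -> set (subspace K),
    (forall k, nowhere_dense (N k)) /\ P `<=` \bigcup_k N k.

Definition op_spectrum (R : realType) (V : normedModType (Cx R)) (T : V -> V)
  : set (Cx R) :=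
  [set l | ~ exists S : V -> V, continuous S /\
       (forall f, S (T f - l *: f) = f) /\ (forall f, T (S f) - l *: S f = f)].

Definition fun_op_spectrum (R : realType) (X : Type) (K : set X)
  (W : set (X -> (Cx R))) (T : (X -> (Cx R)) -> (X -> (Cx R))) : set (Cx R) :=
  [set l | ~ exists S : (X -> (Cx R)) -> (X -> (Cx R)),
       [/\ forall g, W g -> W (S g),
           exists M : R, forall g, W g -> supnorm K (S g) <= M * supnorm K g,
           forall g, W g -> S (fun t => T g t - l * g t) = g
         & forall g, W g -> (fun t => T (S g) t - l * S g t) = g]].

Definition check_op (R : realType) (A : completeNormedModType (Cx R))
  (mul : A -> A -> A) (one : A) (w : A) (U : A -> A)
  (g : {ptws A -> (Cx R)} -> (Cx R)) : {ptws A -> (Cx R)} -> (Cx R) :=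
  fun t => if `[< shilov_boundary mul one t >] then t w * g (induced_map U t)
           else 0.

(* Main.v *)
(** By regularity the Shilov boundary is the whole (compact) character space.
    After replacing [w] by [w / l] one compares the two spectra at the point [1];
    write [T = wU], [w_k] for the product of the [U^i w] with [i < k], so that
    [T^k g = w_k . U^k g], and [nu] for either the norm of [A] or the sup norm.

    Key step.  If [T - 1] is bounded below for [nu], then for some [N] every
    character [t] satisfies [|w_N(t)| <= 1/2] or [|w_N(phi^-N t)| >= 2].
    Otherwise there is a nonperiodic [s] along whose backward orbit the numbers
    [|w_k(phi^-k s)|] are nearly maximal at a prescribed index of a long window.
    Take a normalised [h] peaking near [s] and [f = p(T)(h^2)], where [p] is
    [(1 + X + ... + X^(n-1))^(m+2)] with its coefficients reweighted so that one of
    them dominates.  Since [(X - 1)^m p = (X^n - 1)^m g] with [g] of small l1 norm,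
    the lower bound makes [nu f] tiny compared to [sup |f|], and by the product
    inequality a high power of [f], translated back, is another normalised peaking
    function with at most half the [nu]-norm of [h].  Iterating contradicts
    [nu >= sup].

    From the norm of [A] to the sup norm: the dichotomy gives at once that [T - 1]
    is bounded below for the sup norm, and its range is dense.

    From the sup norm to the norm of [A]: the dichotomy holds with the same
    constants for all [zT] with [|z| = 1], so [T^(2^j) - 1] has dense range for
    every [j].  Approximate solutions [q] of [(T^(2^j) - 1) q = -1] are close to [1]
    where [w_N] contracts and to [0] where it expands, so these two sets form an
    invariant partition whose indicator is a uniform limit of elements [f] of [A].
    The upper half [P] of the binomial expansion of [(f + (1 - f))^(2n+1)] and
    [P' = 1 - P] are then such that [T^n P], [P T^n], [T^-n P'] and [P' T^-n] have
    small norm by the product inequality, so [P - T^-n P'] inverts [1 - T^n] up to a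
    small error. *)
Require Import Defs.
From mathcomp Require Import all_boot all_order all_algebra.
From mathcomp Require Import all_classical all_reals all_analysis.
From mathcomp Require Import complex ring lra zify.
Import Order.TTheory GRing.Theory Num.Theory numFieldNormedType.Exports.
Set Implicit Arguments.
Unset Strict Implicit.
Unset Printing Implicit Defensive.
Local Open Scope classical_set_scope.
Local Open Scope ring_scope.

(** The product inequality is the only bridge from sup norms back to the norm of [A]. It charges a
    factor linear in the number of factors and omits one factor at a time, so an exponential gain
    measured pointwise survives in norm. This dictates the shapes: [h^2] and not [h], because one
    copy must still localise when the other is omitted; explicit binomial sums as approximate
    idempotents, because each monomial is a product of about [3n] factors.

    In the key step the weights [r^2 - (k - K)^2], [r = (m + 2) n], favour the index [K] only by a
    relative amount [1 / r^2], so the power to be taken is polynomial in [m]. A quadratic weight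
    costs two Euler derivatives, whence the exponent [m + 2]. The lower bound gains [(2 / (c n))^m];
    powers of [U] and of its inverse cost [(1 + e)^(3 r)]. With [c n >= 8] and [(1 + e)^(3 n) <= 2]
    there remains a polynomial in [m] over [2^m].

    The dichotomy is taken at powers of two because square roots on the unit circle factor
    [T^(2 k) - z] as [(T^k - s)(T^k + s)]. *)

Definition md (R : realType) (z : Cx R) : R := complex.Re `|z|.
Definition nrm (R : realType) (A : completeNormedModType (Cx R)) (f : A) : R :=
  complex.Re `|f|.

(** * Real-valued modulus and norm *)

Section Modulus.
Variable R : realType.
Implicit Types z : Cx R.

Lemma mdE z : `|z| = (md z)%:C%C.
Proof. by rewrite /md (RRe_real (normr_real (z : R[i]))). Qed.

Lemma md_real (x : R) : md (x%:C%C : Cx R) = `|x|.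
Proof. by rewrite /md normc_def /= expr0n /= addr0 sqrtr_sqr. Qed.

Lemma md0 : md (0 : Cx R) = 0.
Proof. by rewrite /md normr0. Qed.

Lemma md1 : md (1 : Cx R) = 1.
Proof. by rewrite /md normr1. Qed.

Lemma md_ge0 z : 0 <= md z.
Proof. by have := normr_ge0 z; rewrite mdE ler0c. Qed.

Lemma mdM z1 z2 : md (z1 * z2) = md z1 * md z2.
Proof. by apply: complexI; rewrite rmorphM -!mdE normrM. Qed.

Lemma mdD z1 z2 : md (z1 + z2) <= md z1 + md z2.
Proof. by have := ler_normD z1 z2; rewrite !mdE -rmorphD lecR. Qed.

Lemma mdN z : md (- z) = md z.
Proof. by rewrite /md normrN. Qed.

Lemma mdB z1 z2 : md (z1 - z2) <= md z1 + md z2.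
Proof. by rewrite -(mdN z2) mdD. Qed.

Lemma mdC z1 z2 : md (z1 - z2) = md (z2 - z1).
Proof. by rewrite -mdN opprB. Qed.

Lemma md_eq0 z : (md z == 0) = (z == 0).
Proof.
apply/eqP/eqP => [h|->]; last exact: md0.
by apply/eqP; rewrite -normr_eq0 mdE h.
Qed.

Lemma md_gt0 z : (0 < md z) = (z != 0).
Proof. by rewrite lt_neqAle md_ge0 andbT eq_sym md_eq0. Qed.

Lemma mdV z : md (z^-1) = (md z)^-1.
Proof. by apply: complexI; rewrite fmorphV -!mdE normfV. Qed.

Lemma mdX z n : md (z ^+ n) = md z ^+ n.
Proof. by elim: n => [|n IH]; rewrite ?expr0 ?md1// !exprS mdM IH. Qed.

Lemma md_prod (I : Type) (r : seq I) (P : pred I) (F : I -> Cx R) :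
  md (\prod_(i <- r | P i) F i) = \prod_(i <- r | P i) md (F i).
Proof. exact: (big_morph (@md R) mdM md1). Qed.

Lemma md_sum (I : Type) (r : seq I) (P : pred I) (F : I -> Cx R) :
  md (\sum_(i <- r | P i) F i) <= \sum_(i <- r | P i) md (F i).
Proof.
elim/big_rec2: _ => [|i y x _ h]; first by rewrite md0.
by rewrite (le_trans (mdD _ _))// lerD2l.
Qed.

Lemma md_dist z1 z2 : md z1 - md z2 <= md (z1 - z2).
Proof. by have := mdD (z1 - z2) z2; rewrite subrK lerBlDr. Qed.

Lemma md_le_lt z (e : R) : (`|z| < e%:C%C) = (md z < e).
Proof. by rewrite mdE ltcR. Qed.

Lemma geometric_small (q k e : R) : 0 <= q -> q < 1 -> 0 < e ->
  exists N, forall n, (N <= n)%N -> k * q ^+ n <= e.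
Proof.
move=> q0 q1 e0.
have := @cvg_geometric R k q; rewrite ger0_norm// => /(_ q1)/cvgrPdist_le.
move=> /(_ _ e0) [N _ h]; exists N => n Nn.
by have := h n Nn; rewrite sub0r normrN; apply: le_trans; rewrite ler_norm.
Qed.

End Modulus.

Section Norm.
Variables (R : realType) (A : completeNormedModType (Cx R)).
Implicit Types f g : A.

Lemma nrmE f : `|f| = (nrm f)%:C%C.
Proof. by rewrite /nrm (RRe_real (ger0_real (normr_ge0 f))). Qed.

Lemma nrm_ge0 f : 0 <= nrm f.
Proof. by have := normr_ge0 f; rewrite nrmE ler0c. Qed.

Lemma nrmD f g : nrm (f + g) <= nrm f + nrm g.
Proof. by have := ler_normD f g; rewrite !nrmE -rmorphD lecR. Qed.

Lemma nrmN f : nrm (- f) = nrm f.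
Proof. by rewrite /nrm normrN. Qed.

Lemma nrmB f g : nrm (f - g) <= nrm f + nrm g.
Proof. by rewrite -(nrmN g) nrmD. Qed.

Lemma nrmC f g : nrm (f - g) = nrm (g - f).
Proof. by rewrite -nrmN opprB. Qed.

Lemma nrmZ (a : Cx R) f : nrm (a *: f) = md a * nrm f.
Proof. by have := normrZ a f; rewrite !nrmE mdE -rmorphM => /complexI. Qed.

Lemma nrm0 : nrm (0 : A) = 0.
Proof. by rewrite /nrm normr0. Qed.

Lemma nrm_eq0 f : (nrm f == 0) = (f == 0).
Proof.
apply/eqP/eqP => [h|->]; last exact: nrm0.
by apply/eqP; rewrite -normr_eq0 nrmE h.
Qed.

Lemma nrm_triangle f g h : nrm (f - h) <= nrm (f - g) + nrm (g - h).
Proof. by have := nrmD (f - g) (g - h); rewrite addrA subrK. Qed.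

Lemma nrm_sum (I : Type) (r : seq I) (P : pred I) (F : I -> A) :
  nrm (\sum_(i <- r | P i) F i) <= \sum_(i <- r | P i) nrm (F i).
Proof.
elim/big_rec2: _ => [|i y x _ h]; first by rewrite nrm0.
by rewrite (le_trans (nrmD _ _))// lerD2l.
Qed.

Lemma nrm_complete (u : nat -> A) :
  (forall e : R, 0 < e -> exists N, forall m, (N <= m)%N -> nrm (u m - u N) <= e) ->
  exists l, forall e : R, 0 < e -> exists N, forall n, (N <= n)%N -> nrm (u n - l) <= e.
Proof.
move=> cu.
have : cvg (u @ \oo).
  suff : cauchy (u @ \oo) by exact: cauchy_cvg.
  apply: cauchy_exP => e e0.
  have re : e = (complex.Re e)%:C%C.
    by rewrite (RRe_real (ger0_real (ltW e0))).
  have e0' : 0 < complex.Re e by move: e0; rewrite {1}re ltcR.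
  have /cu[N hN] : 0 < complex.Re e / 2 by rewrite divr_gt0.
  exists (u N), N => // m Nm /=.
  rewrite -ball_normE /= nrmE re ltcR nrmC.
  by rewrite (le_lt_trans (hN m Nm))// gtr_pMr// invf_lt1// ltr1n.
move=> /cvg_ex[l ul]; exists l => e e0.
have e0' : 0 < (e%:C%C : Cx R) by rewrite ltcR.
have /cvgrPdist_le/(_ _ e0')[N _ h] := ul.
by exists N => n Nn; have := h n Nn; rewrite nrmE lecR nrmC.
Qed.

Lemma nrm_small_eq0 f : (forall e : R, 0 < e -> nrm f <= e) -> f = 0.
Proof.
move=> h; apply/eqP; rewrite -nrm_eq0; apply/eqP/le_anti.
rewrite nrm_ge0 andbT; case: leP => // f0.
have /h : 0 < nrm f / 2 by rewrite divr_gt0.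
by move=> k; exfalso; lra.
Qed.

End Norm.

Ltac pos := repeat first
  [ done | exact: nrm_ge0 | exact: md_ge0 | apply: ltW; assumption
  | apply: mulr_gt0 | apply: mulr_ge0 | apply: addr_gt0 | apply: addr_ge0
  | rewrite invr_gt0 | rewrite invr_ge0 | apply: exprn_gt0 | apply: exprn_ge0 ].

(** * Linear maps, approximate solvability and the open mapping theorem *)

Definition lin (K : pzRingType) (A : lmodType K) (U : A -> A) :=
  forall (a : K) (x y : A), U (a *: x + y) = a *: U x + U y.

Section Lin.
Variables (K : pzRingType) (A : lmodType K) (U : A -> A).
Hypothesis linU : lin U.

Lemma lin_zero : U 0 = 0.
Proof. by have := linU (-1) 0 0; rewrite !scaleN1r oppr0 addr0 addNr. Qed.

Lemma lin_add x y : U (x + y) = U x + U y.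
Proof. by have := linU 1 x y; rewrite !scale1r. Qed.

Lemma lin_scale a x : U (a *: x) = a *: U x.
Proof. by have := linU a x 0; rewrite lin_zero !addr0. Qed.

Lemma lin_opp x : U (- x) = - U x.
Proof. by rewrite -scaleN1r lin_scale scaleN1r. Qed.

Lemma lin_sub x y : U (x - y) = U x - U y.
Proof. by rewrite lin_add lin_opp. Qed.

Lemma lin_sum (I : Type) (r : seq I) (P : pred I) (F : I -> A) :
  U (\sum_(i <- r | P i) F i) = \sum_(i <- r | P i) U (F i).
Proof. exact: (big_morph U lin_add lin_zero). Qed.

Lemma lin_iter n : lin (iter n U).
Proof. by elim: n => [|n IH] a x y //=; rewrite IH linU. Qed.

End Lin.

Lemma iter_sub_tele (K : pzRingType) (A : lmodType K) (U : A -> A) : lin U ->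
  forall k g, iter k U g - g = \sum_(i < k) iter i U (U g - g).
Proof.
move=> lU k g; elim: k => [|k IH]; first by rewrite big_ord0 subrr.
by rewrite big_ord_recr /= -IH (lin_sub (lin_iter lU k)) -iterSr addrC addrA subrK.
Qed.

Section Operators.
Variables (R : realType) (A : completeNormedModType (Cx R)).

Definition bdd (b : R) (U : A -> A) := forall f, nrm (U f) <= b * nrm f.

Lemma bdd_iter b (U : A -> A) n : 0 <= b -> bdd b U -> bdd (b ^+ n) (iter n U).
Proof.
move=> b0 hU; elim: n => [|n IH] f; first by rewrite expr0 mul1r.
rewrite iterS exprS -mulrA (le_trans (hU _))// ler_wpM2l//.
Qed.

(* Both the Neumann series and the open mapping theorem are instances. *)
Lemma approx_surj (V : A -> A) (b q k : R) : lin V -> 0 <= b -> bdd b V ->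
  0 <= q -> q < 1 -> 0 <= k ->
  (forall y, exists x, nrm (y - V x) <= q * nrm y /\ nrm x <= k * nrm y) ->
  forall y, exists x, V x = y /\ nrm x <= k / (1 - q) * nrm y.
Proof.
move=> linV b0 bV q0 q1 k0 /choice[g hg] y.
have q1' : 0 < 1 - q by rewrite subr_gt0.
pose r := fix r n := if n is n'.+1 then r n' - V (g (r n')) else y.
have rq n : nrm (r n) <= q ^+ n * nrm y.
  elim: n => [|n IH]; first by rewrite expr0 mul1r.
  rewrite /= exprS -mulrA (le_trans (hg _).1)// ler_wpM2l//.
pose x n := \sum_(i < n) g (r i).
have Vx n : V (x n) = y - r n.
  elim: n => [|n IH]; first by rewrite /x big_ord0 lin_zero// subrr.
  by rewrite /x big_ord_recr/= lin_add// -/(x n) IH opprB addrA addrAC.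
have geo m : \sum_(i < m) q ^+ i <= 1 / (1 - q).
  rewrite ler_pdivlMr// mulrC; have := subrX1 q m => h.
  have -> : (1 - q) * \sum_(i < m) q ^+ i = 1 - q ^+ m.
    by rewrite -opprB mulNr -h opprB.
  by rewrite lerBlDr lerDl exprn_ge0.
have xx n m : nrm (x (n + m)%N - x n) <= k / (1 - q) * nrm y * q ^+ n.
  rewrite /x big_split_ord/= addrAC subrr add0r.
  rewrite (le_trans (nrm_sum _ _ _))//.
  apply: (@le_trans _ _ (\sum_(i < m) (k * nrm y * q ^+ n) * q ^+ i)).
    apply: ler_sum => i _; rewrite (le_trans (hg _).2)//.
    by rewrite -!mulrA ler_wpM2l// -exprD mulrC.
  rewrite -mulr_sumr.
  have h0 : 0 <= k * nrm y * q ^+ n by rewrite !mulr_ge0 ?nrm_ge0 ?exprn_ge0.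
  apply: le_trans (ler_wpM2l h0 (geo m)) _.
  have -> : k * nrm y * q ^+ n * (1 / (1 - q)) = k / (1 - q) * nrm y * q ^+ n by ring.
  by [].
have [|l hl] := @nrm_complete _ _ x.
  move=> e e0.
  have [N hN] := geometric_small (k / (1 - q) * nrm y) q0 q1 e0.
  exists N => m Nm; rewrite -(subnKC Nm).
  exact: le_trans (xx _ _) (hN _ (leqnn _)).
exists l; split.
  apply/eqP; rewrite -subr_eq0; apply/eqP/nrm_small_eq0 => e e0.
  have [N1 h1] := hl (e / 2 / (b + 1)) ltac:(by rewrite !divr_gt0// ltr_wpDl).
  have [N2 h2] := geometric_small (nrm y) q0 q1 (divr_gt0 e0 (ltr0n _ 2)).
  pose n := (N1 + N2)%N.
  have -> : V l - y = - V (x n - l) - r n.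
    by rewrite lin_sub// Vx opprB addrAC; rewrite opprB addrA subrK.
  rewrite (le_trans (nrmB _ _))// nrmN [e]splitr lerD//.
    rewrite (le_trans (bV _))//.
    have := h1 n (leq_addr _ _).
    rewrite ler_pdivlMr ?ltr_wpDl// mulrC; apply: le_trans.
    by rewrite ler_wpM2r ?nrm_ge0// lerDl.
  by rewrite (le_trans (rq _))// mulrC h2// leq_addl.
apply/ler_addgt0Pr => e e0.
have [N hN] := hl e e0.
have := nrmB (x N) (x N - l); rewrite opprB addrC subrK => /le_trans; apply.
rewrite lerD ?hN//.
by have := xx 0%N N; rewrite add0n expr0 mulr1 {2}/x big_ord0 subr0.
Qed.

(** Baire's theorem in norm form: if no [B n] were dense in any ball, balls could be nested with the
    [n]-th one missing [B n], and the limit of the centres would lie in no [B n]. *)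
Lemma baire_cover (B : nat -> set A) : (forall x, exists n, B n x) ->
  exists n x, exists2 r : R, 0 < r &
    forall y, nrm (y - x) < r -> forall e : R, 0 < e -> exists2 b, B n b & nrm (y - b) < e.
Proof.
move=> cov; apply: contrapT => H.
have step (p : nat * (A * R)) : exists p' : A * R, 0 < p.2.2 ->
    [/\ 0 < p'.2, p'.2 <= p.2.2 / 2, nrm (p'.1 - p.2.1) + p'.2 <= p.2.2
      & forall b, B p.1 b -> p'.2 < nrm (p'.1 - b)].
  case: p => n [x r] /=; have [r0|r0] := boolP (0 < r); last by exists (x, r).
  have [y [yr [e [e0 he]]]] : exists y, nrm (y - x) < r /\
      exists e, 0 < e /\ forall b, B n b -> e <= nrm (y - b).
    apply: contrapT => H2; apply: H; exists n, x, r => // y yr e e0.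
    apply: contrapT => H3; apply: H2; exists y; split=> //; exists e; split=> // b Bb.
    by rewrite leNgt; apply/negP => H4; apply: H3; exists b.
  (* [e / 2] keeps the new ball off [B n], [r - nrm (y - x)] nests it in the old one, [r / 2] makes
     the centres Cauchy. *)
  pose d := Num.min (e / 2) (Num.min (r - nrm (y - x)) (r / 2)).
  exists (y, d) => /= _; split.
  - by rewrite !lt_min !divr_gt0// subr_gt0 yr.
  - by rewrite !ge_min lexx !orbT.
  - by rewrite addrC -lerBrDr !ge_min lexx orbT.
  - move=> b /he eb; apply: lt_le_trans eb.
    by rewrite gt_min ltr_pdivrMr// mulr_natr mulr2n ltrDl e0.
have [s hs] := choice step.
pose a := fix a n := if n is n'.+1 then s (n', a n') else (0 : A, 1 : R).
have a0 n : 0 < (a n).2.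
  by elim: n => [|n IH]; [rewrite /= ltr01|have [] := hs (n, a n) IH].
have a2 n : (a n).2 <= 2^-1 ^+ n.
  elim: n => [|n IH]; first by rewrite expr0.
  have [_ h _ _] := hs (n, a n) (a0 n); apply: le_trans h _.
  by rewrite exprSr ler_wpM2r// invr_ge0.
have nest n m : nrm ((a (n + m)%N).1 - (a n).1) + (a (n + m)%N).2 <= (a n).2.
  elim: m => [|m IH]; first by rewrite addn0 subrr nrm0 add0r.
  have [_ _ h _] := hs ((n + m)%N, a (n + m)%N) (a0 _).
  rewrite addnS; apply: le_trans IH.
  have := nrm_triangle (a (n + m).+1).1 (a (n + m)%N).1 (a n).1.
  move: h; rewrite /= => h1 h2; lra.
have half : 2^-1 < 1 :> R by rewrite invf_lt1 ?ltr1n.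
have half0 : 0 <= 2^-1 :> R by rewrite invr_ge0.
have [|l hl] := @nrm_complete _ _ (fun n => (a n).1).
  move=> e e0; have [N hN] := geometric_small 1 half0 half e0.
  exists N => m Nm; rewrite -(subnKC Nm).
  have := nest N (m - N)%N; have := a0 (N + (m - N))%N; have := a2 N.
  have := hN N (leqnn _); rewrite mul1r => *; lra.
have lin_ n : nrm ((a n).1 - l) <= (a n).2.
  apply/ler_addgt0Pr => e e0; have [N hN] := hl e e0.
  have := hN (n + N)%N (leq_addl _ _) => h.
  have := nest n N; have := a0 (n + N)%N.
  have := nrm_triangle (a n).1 (a (n + N)%N).1 l; rewrite (nrmC (a n).1 (a (n+N)%N).1) => *; lra.
have [n Bn] := cov l.
have [_ _ _ /(_ l Bn)] := hs (n, a n) (a0 n).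
by rewrite ltNge (lin_ n.+1).
Qed.

(** Open mapping theorem. Some sublevel set of [nrm (U f)] is dense in a ball; differences of its
    points are dense near 0, and scaling yields preimages with relative error 1/2, the input of
    [approx_surj]. The continuity of an automorphism will be drawn from that of its inverse in this
    way. *)
Lemma bounded_inverse (U V : A -> A) (b : R) : lin U -> lin V ->
  cancel U V -> cancel V U -> 0 <= b -> bdd b V -> exists2 k : R, 0 <= k & bdd k U.
Proof.
move=> linU linV UV VU b0 bV.
have [n [x [r r0 hr]]] := @baire_cover (fun n => [set f | nrm (U f) <= n%:R])
   (fun f => ex_intro _ (Num.truncn (nrm (U f))).+1 (ltW (truncnS_gt _))).
pose k := 4 * n%:R / r.
have k0 : 0 <= k by rewrite !mulr_ge0// invr_ge0 ltW.
have small y : nrm y < r -> forall e : R, 0 < e ->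
    exists c, nrm (U c) <= 2 * n%:R /\ nrm (y - c) <= e.
  move=> yr e e0.
  have e20 : 0 < e / 2 by rewrite divr_gt0.
  have [b1 B1 h1] := hr (y + x) ltac:(by rewrite addrK) _ e20.
  have [b2 B2 h2] := hr x ltac:(by rewrite subrr nrm0) _ e20.
  exists (b1 - b2); split.
    rewrite lin_sub// (le_trans (nrmB _ _))//; move: B1 B2 => /=; lra.
  have -> : y - (b1 - b2) = (y + x - b1) - (x - b2).
    by rewrite !opprB -!addrA; congr (_ + _); rewrite [RHS]addrC -!addrA addNr addr0 addrC.
  by rewrite (le_trans (nrmB _ _))// [e]splitr lerD// ltW.
have app y : exists z, nrm (y - V z) <= 2^-1 * nrm y /\ nrm z <= k * nrm y.
  have [->|y0] := eqVneq y 0.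
    by exists 0; rewrite lin_zero// subr0 nrm0 !mulr0.
  have ny0 : 0 < nrm y by rewrite lt_neqAle nrm_ge0 eq_sym nrm_eq0 y0.
  (* [t] brings [y] to norm [r / 2], inside the ball; undoing it gives [k = 4 n / r]. *)
  pose t : R := r / (2 * nrm y).
  have t0 : 0 < t by rewrite divr_gt0// mulr_gt0.
  have tC0 : (t%:C%C : Cx R) != 0 by rewrite -md_gt0 md_real gtr0_norm.
  have mdt : md (t%:C%C : Cx R) = t by rewrite md_real gtr0_norm.
  have e0 : 0 < 2^-1 * nrm y * t by rewrite mulr_gt0// mulr_gt0// invr_gt0.
  have ty : nrm ((t%:C%C : Cx R) *: y) < r.
    rewrite nrmZ mdt /t invfM mulrA -mulrA mulVf ?gt_eqF// mulr1.
    by rewrite ltr_pdivrMr// mulr_natr mulr2n ltrDl.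
  have [c [Uc yc]] := small _ ty _ e0.
  exists ((t%:C%C : Cx R)^-1 *: U c); split.
    rewrite lin_scale// UV -(@ler_pM2r _ t)//.
    apply: le_trans yc.
    have := nrmZ (t%:C%C : Cx R) (y - (t%:C%C : Cx R)^-1 *: c).
    by rewrite mdt scalerBr scalerA mulfV// scale1r mulrC => ->.
  rewrite nrmZ mdV mdt -ler_pdivlMl ?invr_gt0// invrK.
  apply: le_trans Uc _; rewrite /t /k.
  have -> : r / (2 * nrm y) * (4 * n%:R / r * nrm y) = 2 * n%:R.
    by field; rewrite !gt_eqF.
  by [].
have hi : 2^-1 < 1 :> R by rewrite invf_lt1 ?ltr1n.
have h0 : 0 <= 2^-1 :> R by rewrite invr_ge0.
exists (k / (1 - 2^-1)); first by rewrite divr_ge0// subr_ge0 ltW.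
move=> f; have [z [Vz nz]] := approx_surj linV b0 bV h0 hi k0 app f.
by rewrite -Vz VU Vz.
Qed.

End Operators.

(** * Compactness of discs and uniform bounds on annuli *)

Section Discs.
Variable R : realType.

Lemma nbhs_md (z : Cx R) (e : R) : 0 < e -> nbhs z [set y | md (y - z) < e].
Proof.
move=> e0; apply/nbhs_normP; exists (e%:C%C); first by rewrite /= ltcR.
by move=> y /=; rewrite md_le_lt mdC.
Qed.

Lemma complex_continuous : continuous (fun p : R * R => Complex p.1 p.2 : Cx R).
Proof.
move=> [a b]; apply/cvgrPdist_lt => e e0.
have re : e = (complex.Re e)%:C%C by rewrite (RRe_real (ger0_real (ltW e0))).
have e0' : 0 < complex.Re e / 2 by rewrite divr_gt0//; move: e0; rewrite {1}re ltcR.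
near=> p.
have -> : (Complex a b - Complex p.1 p.2 : Cx R) =
    (a - p.1)%:C%C + (0 +i* 1)%C * (b - p.2)%:C%C.
  by apply/eqP; rewrite eq_complex /= ?(mul0r, mul1r, mulr0, mulr1, subr0, addr0, add0r, oppr0) !eqxx.
rewrite re md_le_lt (le_lt_trans (mdD _ _))// mdM !md_real.
have -> : md ((0 +i* 1)%C : Cx R) = 1.
  by rewrite /md normc_def /= expr0n /= add0r expr1n sqrtr1.
rewrite mul1r [complex.Re e]splitr ltrD//.
  near: p; have : (p.1 @[p --> (a, b)] --> a) by apply: cvg_fst.
  by move/cvgrPdist_lt; apply.
near: p; have : (p.2 @[p --> (a, b)] --> b) by apply: cvg_snd.
by move/cvgrPdist_lt; apply.
Unshelve. all: by end_near. Qed.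

Lemma disc_compact (r : R) : compact [set z : Cx R | md z <= r].
Proof.
have cc : compact ((fun p : R * R => Complex p.1 p.2 : Cx R) @`
    (`[- r, r]%classic `*` `[- r, r]%classic)).
  apply: continuous_compact; first by apply: continuous_subspaceT; exact: complex_continuous.
  by apply: compact_setX; exact: segment_compact.
apply: subclosed_compact cc _.
  move=> z cz /=; rewrite leNgt; apply/negP => rz.
  have [y [/= yr yz]] := cz _ (nbhs_md z (ltac:(by rewrite subr_gt0) : 0 < md z - r)).
  by have := md_dist z y; rewrite mdC => h; lra.
move=> [a b] /=; rewrite /md normc_def /= => h.
have r0 : 0 <= r by rewrite (le_trans _ h)// sqrtr_ge0.
have h2 : a ^+ 2 + b ^+ 2 <= r ^+ 2.
  rewrite -[leLHS]sqr_sqrtr ?addr_ge0 ?sqr_ge0// lerXn2r ?nnegrE ?sqrtr_ge0//.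
by exists (a, b) => //; split => /=; rewrite in_itv /=; apply/andP; split; nra.
Qed.

(** [P l c] will mean that [W - l] is bounded below by [c]. If the constants degenerated along a
    sequence, a cluster point [p] would have its own constant [c], and half of it would serve all
    nearby points. *)
Lemma annulus_uniform (P : Cx R -> R -> Prop) (r1 r2 : R) :
  (forall l, r1 <= md l -> exists2 c, 0 < c & P l c) ->
  (forall l l' c, 0 < c -> P l c -> md (l' - l) <= c / 2 -> P l' (c / 2)) ->
  (forall l c c', P l c -> c' <= c -> P l c') ->
  exists2 c, 0 < c & forall l, r1 <= md l -> md l <= r2 -> P l c.
Proof.
move=> ex near mono; apply: contrapT => H.
have step (n : nat) : exists l, [/\ r1 <= md l, md l <= r2 & ~ P l n.+1%:R^-1].
  apply: contrapT => H2; apply: H; exists n.+1%:R^-1 => // l l1 l2.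
  by apply: contrapT => H3; apply: H2; exists l.
have [l hl] := choice step.
have [|p [_ cp]] := @disc_compact r2 (l @ \oo) _.
  by exists 0%N => // n _ /=; have [] := hl n.
have near_p (e : R) (N : nat) : 0 < e -> exists2 n, (N <= n)%N & md (l n - p) < e.
  move=> e0; have [|y [[n Nn <-] yp]] := cp (l @` [set n | (N <= n)%N]) _ _ (nbhs_md p e0).
    by exists N => // n Nn /=; exists n.
  by exists n.
have rp : r1 <= md p.
  apply/ler_addgt0Pr => e e0; have [n _ h] := near_p e 0%N e0.
  by have [h1 _ _] := hl n; have := md_dist (l n) p => h2; lra.
have [c c0 Pc] := ex p rp.
have [N hN] : exists N : nat, (c / 2)^-1 <= N%:R.
  by exists (Num.truncn (c / 2)^-1).+1; rewrite ltW// truncnS_gt.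
have [n Nn np] := near_p (c / 2) N ltac:(by rewrite divr_gt0).
have [_ _] := hl n; apply; apply: mono (near _ _ _ c0 Pc (ltW np)) _.
rewrite -[leRHS]invrK lef_pV2 ?posrE ?invr_gt0 ?divr_gt0//.
by rewrite (le_trans hN)// ler_nat ltnW.
Qed.

End Discs.

(** * Growth of powers of an operator with spectrum in the closed unit disc *)

Section SpectralRadius.
Variables (R : realType) (A : completeNormedModType (Cx R)) (W : A -> A) (b : R).
Hypotheses (linW : lin W) (b0 : 0 <= b) (bW : bdd b W).
Hypothesis resW : forall l : Cx R, 1 < md l ->
  (forall f, exists u, W u - l *: u = f) /\
  exists2 c : R, 0 < c & forall g, c * nrm g <= nrm (W g - l *: g).

(* [sol X c f u] says that [u] is the value at [f] of the resolvent [(1 - X / c)^-1]. *)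
Let sol (X : A -> A) (c : Cx R) f u := X u = c *: (u - f).
Let P2 i := iter (2 ^ i) W.

Let P2S i f : P2 i.+1 f = P2 i (P2 i f).
Proof. by rewrite /P2 expnS mul2n -addnn iterD. Qed.

Let linP i : lin (P2 i). Proof. exact: lin_iter. Qed.

Let sqroot (c : Cx R) : exists2 s : Cx R, s ^+ 2 = c & md s ^+ 2 = md c.
Proof.
exists (sqrtc (c : R[i])); first exact: sqr_sqrtc.
by rewrite -mdX; congr md; exact: sqr_sqrtc.
Qed.

Let inj_res i (c : Cx R) u : 1 < md c -> P2 i u = c *: u -> u = 0.
Proof.
elim: i c u => [|i IH] c u c1.
  rewrite /P2 expn0 /= => Wu; have [_ [k k0 /(_ u)]] := resW c1.
  rewrite Wu subrr nrm0 pmulr_rle0// => h.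
  by apply/eqP; rewrite -nrm_eq0 eq_le h nrm_ge0.
have [s sc ms] := sqroot c; subst c; rewrite P2S => Xu.
have s1 : 1 < md s.
  rewrite -(@ltr_pXn2r _ 2) ?nnegrE ?md_ge0// expr1n ms//.
have h1 : P2 i u + s *: u = 0.
  apply: (IH s) => //.
  by rewrite (lin_add (linP i)) (lin_scale (linP i)) Xu expr2 -scalerA scalerDr addrC.
apply: (IH (- s)); first by rewrite mdN.
by rewrite scaleNr; apply/eqP; rewrite -addr_eq0 h1.
Qed.

Let half2 (f : A) : (2^-1 : Cx R) *: (f + f) = f.
Proof. by rewrite -mulr2n -(scaler_nat 2 f) scalerA mulVf ?scale1r ?pnatr_eq0. Qed.

Let sol_sq (X : A -> A) (s : Cx R) f u1 u2 : lin X ->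
  sol X s f u1 -> sol X (- s) f u2 ->
  sol (fun g => X (X g)) (s ^+ 2) f (2^-1 *: (u1 + u2)).
Proof.
move=> linX h1 h2; rewrite /sol (lin_scale linX) (lin_add linX) h1 h2.
rewrite (lin_scale linX) (lin_add linX) !(lin_scale linX) !(lin_sub linX) h1 h2.
have -> : s *: (s *: (u1 - f) - X f) + - s *: (- s *: (u2 - f) - X f) =
    s ^+ 2 *: ((u1 - f) + (u2 - f)).
  rewrite !scalerBr !scalerA mulrNN -!expr2 !scaleNr opprK.
  by rewrite addrACA addNr addr0 -!scalerBr -scalerDr.
rewrite scalerA mulrC -scalerA; congr (_ *: _).
by rewrite addrACA -opprD scalerBr half2.
Qed.

(** Averaging does not increase distances, so closeness of the resolvents of [W] on the circles of
    radii [r] and [th r] passes with the same [d] to all powers [W^(2^i)]. *)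
Let res_pair (r th d : R) : 0 < r ->
  (forall l f, md l = r -> exists u u',
     [/\ sol W l f u, sol W (th%:C%C * l) f u' & nrm (u - u') <= d * nrm f]) ->
  forall i (c : Cx R) f, md c = r ^+ (2 ^ i) -> exists u u',
     [/\ sol (P2 i) c f u, sol (P2 i) ((th ^+ (2 ^ i))%:C%C * c) f u'
       & nrm (u - u') <= d * nrm f].
Proof.
move=> r0 base; elim=> [|i IH] c f.
  by rewrite expn0 !expr1 => /(base c f).
have [s <- ms] := sqroot c.
rewrite mdX expnS mulnC !exprM => /eqP.
rewrite eqrXn2 ?md_ge0 ?exprn_ge0 ?(ltW r0)// => /eqP mds.
have [u1 [u1' [h1 h1' d1]]] := IH s f mds.
have [u2 [u2' [h2 h2' d2]]] := IH (- s) f (etrans (mdN _) mds).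
exists (2^-1 *: (u1 + u2)), (2^-1 *: (u1' + u2')).
have PE : P2 i.+1 = fun g => P2 i (P2 i g) by apply/funext => g; rewrite P2S.
split; rewrite ?PE.
- exact: sol_sq.
- by rewrite rmorphXn -exprMn; apply: sol_sq => //; rewrite -mulrN.
- rewrite -scalerBr opprD addrACA nrmZ mdV.
  have -> : md (2 : Cx R) = 2.
    by have -> : (2 : Cx R) = (2 : R)%:C%C; rewrite ?md_real ?rmorph_nat// ger0_norm.
  have := nrmD (u1 - u1') (u2 - u2'); lra.
Qed.

(** A single power certifies that the spectral radius is below [r]. *)
Let Good (r : R) := exists i, forall g, nrm (P2 i g) <= 2^-1 * r ^+ (2 ^ i) * nrm g.

Let Good_mono r r' : 0 < r -> r <= r' -> Good r -> Good r'.
Proof.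
move=> r0 rr' [i hi]; exists i => g; apply: le_trans (hi g) _.
rewrite ler_wpM2r ?nrm_ge0// ler_wpM2l ?invr_ge0// lerXn2r ?nnegrE//; first exact: ltW.
exact: le_trans (ltW r0) rr'.
Qed.

Let Good_smaller r n : 0 < r -> Good r ->
  exists i, forall g, nrm (P2 i g) <= 2^-1 ^+ (2 ^ n) * r ^+ (2 ^ i) * nrm g.
Proof.
move=> r0 [i hi]; exists (i + n)%N; elim: n => [|n IH] g.
  by rewrite expn0 expr1 addn0.
rewrite addnS P2S; apply: le_trans (IH _) _.
have c0 : 0 <= 2^-1 ^+ (2 ^ n) * r ^+ (2 ^ (i + n)) :> R.
  by rewrite mulr_ge0// exprn_ge0 ?invr_ge0// ltW.
apply: le_trans (ler_wpM2l c0 (IH g)) _.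
rewrite mulrA ler_wpM2r ?nrm_ge0//.
by rewrite !(expnS 2) !(mulnC 2) !exprM -exprMn expr2.
Qed.

(** If [W^N] is small against [r^N], its resolvent at radius [r^N] is nearly the identity; by
    [res_pair] so is the one at radius [(th r)^N], which forces [W^N] to be small against
    [(th r)^N]. *)
Let Good_step (r th : R) : 0 < r -> 0 < th -> 1 < th * r ->
  (forall l f, md l = r -> exists u u',
     [/\ sol W l f u, sol W (th%:C%C * l) f u' & nrm (u - u') <= 8^-1 * nrm f]) ->
  Good r -> Good (th * r).
Proof.
move=> r0 th0 thr base Gr.
(* Two more squarings turn the factor 1/2 into 1/16. *)
have [i hi] := Good_smaller 2 r0 Gr.
exists i => g.
set N := (2 ^ i)%N in hi *.
pose c : Cx R := (r ^+ N)%:C%C.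
have mc : md c = r ^+ N by rewrite md_real ger0_norm// exprn_ge0// ltW.
pose c' : Cx R := (th ^+ N)%:C%C * c.
have mc' : md c' = (th * r) ^+ N.
  by rewrite mdM mc md_real ger0_norm ?exprMn// exprn_ge0// ltW.
have c'0 : c' != 0 by rewrite -md_gt0 mc' exprn_gt0// (lt_trans ltr01).
have c'1 : 1 < md c' by rewrite mc' exprn_egt1// -lt0n expn_gt0.
pose f := g - c'^-1 *: P2 i g.
have solg : sol (P2 i) c' f g.
  by rewrite /sol /f opprB addrC subrK scalerA mulfV// scale1r.
clearbody f.
have [u [u' [su su' duu']]] := res_pair r0 base f mc.
have u'g : u' = g.
  apply/eqP; rewrite -subr_eq0; apply/eqP/(inj_res c'1 (i := i)).
  have su2 : P2 i u' = c' *: (u' - f) := su'.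
  by rewrite (lin_sub (linP i)) su2 solg -scalerBr opprB addrA subrK.
have uf : 16 * nrm (u - f) <= nrm u.
  have := hi u; rewrite su nrmZ mc.
  have rN : 0 < r ^+ N by rewrite exprn_gt0.
  have -> : 2^-1 ^+ (2 ^ 2) * r ^+ N * nrm u = r ^+ N * (16^-1 * nrm u).
    by rewrite (_ : (2 ^ 2 = 4)%N)//; field.
  rewrite ler_pM2l//; lra.
have Pg : nrm (P2 i g) = (th * r) ^+ N * nrm (g - f) by rewrite solg nrmZ mc'.
rewrite Pg -(mulrC ((th * r) ^+ N)) -mulrA.
rewrite ler_wpM2l ?exprn_ge0 ?mulr_ge0 ?(ltW r0) ?(ltW th0)//.
rewrite u'g in duu'.
have h1 := nrm_triangle g u f; rewrite (nrmC g u) in h1.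
have h2 := nrmD (u - f) f; rewrite subrK in h2.
have h3 := nrmD (f - g) g; rewrite subrK nrmC in h3.
have := nrm_ge0 (g - f); have := nrm_ge0 (u - f); have := nrm_ge0 f; have := nrm_ge0 g; lra.
Qed.

(** The radius starts at [r2 >= 2 b], where [W] itself is a certificate, and is multiplied by a
    fixed [th < 1] until it reaches [1 + e]. The constant [G] absorbs exponents not divisible by the
    final [N]. *)
Lemma spectral_radius_growth (e : R) : 0 < e ->
  exists2 G : R, 1 <= G & forall k f, nrm (iter k W f) <= G * (1 + e) ^+ k * nrm f.
Proof.
move=> e0.
pose r1 := 1 + e / 2; pose r2 := 2 * b + 2 + e.
have [c c0 hc] : exists2 c : R, 0 < c & forall l : Cx R, r1 <= md l -> md l <= r2 ->
    forall g, c * nrm g <= nrm (W g - l *: g).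
  apply: annulus_uniform.
  - by move=> l l1; have [|_ [c c0 h]] := @resW l; [rewrite /r1 in l1; lra|exists c].
  - move=> l l' c c0 h ll g.
    have -> : W g - l' *: g = (W g - l *: g) - (l' - l) *: g.
      by rewrite scalerBl opprB addrA subrK.
    have := nrmB (W g - l *: g) ((l' - l) *: g).
    have := nrmD (W g - l *: g - (l' - l) *: g) ((l' - l) *: g).
    rewrite subrK nrmZ => h1 _; have := h g.
    have := ler_wpM2r (nrm_ge0 g) ll; lra.
  - by move=> l c c' h cc g; apply: le_trans (h g); rewrite ler_wpM2r ?nrm_ge0.
have b0' : (0 : R) <= b := b0.
have r20 : 0 < r2 by rewrite /r2; lra.
(* By the resolvent identity the solutions at [l] and [th l] differ by at most
   [(1 - th) L nrm f]. *)
pose L := c^-1 * r2 * (c^-1 * r2 + 1).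
have L0 : 0 < L by rewrite /L; pos.
(* The three terms give [th >= 1/2], resolvents within 1/8 of each other, and [th (1 + e) >= r1], so
   that [th l] stays in the annulus. *)
pose th := 1 - Num.min (1 / 2) (Num.min ((8 * L)^-1) (e / (2 * (1 + e)))).
have th1 : 1 - th <= 1 / 2 by rewrite /th opprB addrC subrK ge_min lexx.
have thL : (1 - th) * L <= 8^-1.
  rewrite -ler_pdivlMr//.
  have -> : 8^-1 / L = (8 * L)^-1 by field; rewrite gt_eqF.
  by rewrite /th opprB addrC subrK !ge_min lexx !orbT.
have the : r1 <= th * (1 + e).
  have h : 1 - th <= e / (2 * (1 + e)) by rewrite /th opprB addrC subrK !ge_min lexx !orbT.
  have := ler_wpM2r (ltW (ltr_wpDr (ltW e0) ltr01)) h.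
  have -> : e / (2 * (1 + e)) * (1 + e) = e / 2 by field; rewrite gt_eqF// ltr_wpDr// ltW.
  by rewrite /r1; lra.
have th1' : th < 1.
  rewrite /th ltrBlDr ltrDl !lt_min divr_gt0// invr_gt0 mulr_gt0//=.
  by rewrite divr_gt0// mulr_gt0// addr_gt0.
have th0 : 0 < th by lra.
have pair r : 1 + e <= r -> r <= r2 -> forall l f, md l = r -> exists u u',
   [/\ sol W l f u, sol W (th%:C%C * l) f u' & nrm (u - u') <= 8^-1 * nrm f].
  move=> re rr2 l f ml.
  pose l' : Cx R := th%:C%C * l.
  have ml' : md l' = th * r by rewrite mdM ml md_real gtr0_norm.
  have l'r : r1 <= md l' by rewrite ml' (le_trans the)// ler_pM2l.
  have lr : r1 <= md l by rewrite ml /r1; lra.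
  have l1 : 1 < md l by rewrite /r1 in lr; lra.
  have l1' : 1 < md l' by rewrite /r1 in l'r; lra.
  have [/(_ (- (l *: f)))[u hu] _] := resW l1.
  have [/(_ (- (l' *: f)))[u' hu'] _] := resW l1'.
  exists u, u'; split.
  - by rewrite /sol scalerBr -hu addrCA subrr addr0.
  - by rewrite /sol scalerBr -hu' addrCA subrr addr0.
  have l'r2 : md l' <= r2.
    by rewrite ml' (le_trans _ rr2)// ger_pMl ?ltW//; lra.
  have b1 := hc l lr (ltac:(by rewrite ml) : md l <= r2) u.
  have b2 := hc l' l'r l'r2 (u - u').
  have su : W u = l *: (u - f) by rewrite scalerBr -hu addrCA subrr addr0.
  have su' : W u' = l' *: (u' - f) by rewrite scalerBr -hu' addrCA subrr addr0.
  have E : W (u - u') - l' *: (u - u') = (l - l') *: (u - f).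
    rewrite lin_sub// su su' -addrA -opprD -scalerDr.
    by rewrite [u' - f + _]addrC addrA subrK scalerBl.
  have mll : md (l - l') = (1 - th) * r.
    have -> : l - l' = (1 - th)%:C%C * l by rewrite rmorphB rmorph1 mulrBl mul1r.
    by rewrite mdM ml md_real ger0_norm// subr_ge0 ltW.
  rewrite hu nrmN nrmZ ml in b1; rewrite E nrmZ mll in b2.
  have n1 : nrm u <= c^-1 * r2 * nrm f.
    rewrite -mulrA ler_pdivlMl// (le_trans b1)// ler_wpM2r ?nrm_ge0//.
  have n2 : nrm (u - u') <= c^-1 * ((1 - th) * r2 * (nrm u + nrm f)).
    rewrite ler_pdivlMl// (le_trans b2)//.
    have t0 : 0 <= 1 - th by rewrite subr_ge0 ltW.
    have r0 : 0 <= r by lra.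
    by rewrite ler_pM ?mulr_ge0 ?nrm_ge0// ?nrmB// ler_wpM2l.
  apply: le_trans n2 _.
  apply: (@le_trans _ _ ((1 - th) * L * nrm f)); last by rewrite ler_wpM2r ?nrm_ge0.
  have -> : (1 - th) * L * nrm f = c^-1 * ((1 - th) * r2 * (c^-1 * r2 * nrm f + nrm f)).
    by rewrite /L; ring.
  rewrite ler_wpM2l ?invr_ge0 ?(ltW c0)// ler_wpM2l ?lerD2r//.
  by rewrite mulr_ge0 ?subr_ge0 ?(ltW th1')// ltW.
have G2 : Good r2.
  exists 0%N => g; rewrite /P2 expn0 expr1 /=; apply: le_trans (bW g) _.
  by rewrite ler_wpM2r ?nrm_ge0// /r2; lra.
have Gk k : Good (Num.max (1 + e) (r2 * th ^+ k)).
  elim: k => [|k IH].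
    by apply: Good_mono G2 => //; rewrite expr0 mulr1 le_max lexx orbT.
  set r := Num.max _ _ in IH.
  have re : 1 + e <= r by rewrite le_max lexx.
  have rr2 : r <= r2.
    rewrite ge_max; apply/andP; split; first by rewrite /r2; lra.
    by rewrite ger_pMr// exprn_ile1// ltW.
  have thr : 1 < th * r.
    have := ler_wpM2l (ltW th0) re; rewrite /r1 in the; lra.
  have r0 : 0 < r by lra.
  apply: Good_mono (Good_step r0 th0 thr (pair r re rr2) IH); first by lra.
  rewrite /r maxr_pMr ?(ltW th0)// ge_max !le_max.
  apply/andP; split; apply/orP; [left|right].
    by rewrite ger_pMl ?ltW//; lra.
  by rewrite exprS mulrCA.
have [k hk] := geometric_small r2 (ltW th0) th1' (ltac:(lra) : 0 < 1 + e).
have := Gk k; rewrite (max_idPl (hk k (leqnn _))) => -[i hi].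
set N := (2 ^ i)%N in hi.
have N0 : (0 < N)%N by rewrite expn_gt0.
have e1 : 0 <= 1 + e by lra.
have hN : bdd ((1 + e) ^+ N) (iter N W).
  move=> g; apply: le_trans (hi g) _.
  rewrite ler_wpM2r ?nrm_ge0// ger_pMl ?exprn_gt0 ?invf_le1//; lra.
exists ((1 + b) ^+ N); first by rewrite exprn_ege1// lerDl.
move=> j f; rewrite {1 2}(divn_eq j N) addnC iterD.
have bW1 : bdd (1 + b) W by move=> g; rewrite (le_trans (bW g))// ler_wpM2r ?nrm_ge0//; lra.
have b10 : 0 <= 1 + b by lra.
apply: le_trans (bdd_iter _ b10 bW1 _) _.
rewrite iterM -mulrA; apply: ler_pM; rewrite ?exprn_ge0 ?nrm_ge0//.
  by rewrite ler_weXn2l ?lerDl// ltnW// ltn_pmod.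
apply: le_trans (bdd_iter _ _ hN _) _; first by rewrite exprn_ge0.
rewrite -exprM mulnC ler_wpM2r ?nrm_ge0// ler_weXn2l//; first by rewrite lerDl ltW.
by rewrite leq_addl.
Qed.

End SpectralRadius.

(** * Automatic continuity of characters *)

Section Characters.
Variables (R : realType) (A : completeNormedModType (Cx R)).
Variables (mul : A -> A -> A) (one : A).
Hypothesis ba : is_comm_banach_alg mul one.

Lemma nrm_mul f g : nrm (mul f g) <= nrm f * nrm g.
Proof. by have := ba_submult ba f g; rewrite !nrmE -rmorphM lecR. Qed.

Lemma lin_mul f : lin (mul f).
Proof.
move=> a x y; rewrite (ba_mulC ba) (ba_mulDl ba) (ba_mulZl ba).
by rewrite -!(ba_mulC ba f).
Qed.

(** If [m f] exceeded the norm of [f], then [1 - f / m f] would be invertible by the Neumann series,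
    although [m] vanishes on all its multiples. *)
Lemma char_le_nrm m f : is_character mul one m -> md (m f) <= nrm f.
Proof.
move=> [mlin mM m1]; rewrite leNgt; apply/negP => h.
have mf0 : m f != 0 by rewrite -md_gt0 (le_lt_trans _ h)// nrm_ge0.
have m0 : m 0 = 0.
  by have := mlin (-1) 0 0; rewrite scaler0 addr0 mulN1r addNr.
have mZ a x : m (a *: x) = a * m x by have := mlin a x 0; rewrite m0 !addr0.
pose g := (m f)^-1 *: f.
have mg : m g = 1 by rewrite mZ mulVf.
pose q := nrm g.
have q1 : q < 1 by rewrite /q nrmZ mdV mulrC ltr_pdivrMr ?mul1r ?md_gt0.
pose V x := x - mul g x.
have linV : lin V.
  by move=> a x y; rewrite /V lin_mul scalerBr opprD addrACA.
have bV : bdd (1 + q) V.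
  by move=> x; rewrite mulrDl mul1r (le_trans (nrmB _ _))// lerD2l nrm_mul.
have q0 : 0 <= q by exact: nrm_ge0.
have [||x [Vx _]] := @approx_surj _ _ V (1 + q) q 1 linV _ bV q0 q1 ler01 _ one.
- by rewrite addr_ge0.
- by move=> y; exists y; rewrite mul1r /V opprB addrC subrK nrm_mul.
have mV : m (V x) = 0.
  have -> : V x = (-1) *: mul g x + x by rewrite scaleN1r addrC.
  by rewrite mlin mM mg mul1r mulN1r addNr.
by move: mV; rewrite Vx m1 => /eqP; rewrite oner_eq0.
Qed.

End Characters.

(** * Baire category on compact sets *)

Lemma baire_compact (X : topologicalType) (K : set X) (N : nat -> set (subspace K)) :
  regular_space X -> compact K -> (forall k, nowhere_dense (N k)) ->
  forall (t : X) (O : set X), K t -> nbhs t O ->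
  exists s, [/\ K s, O s & forall k, ~ N k s].
Proof.
move=> regX cK ndN t O Kt nO.
(* Regularity shrinks a neighbourhood to one whose closure stays inside the old one and misses [N k]
   on [K]; compactness then yields a point common to all closures. *)
have step (p : nat * set X) : exists Q1 : set X, (exists2 x, K x & nbhs x p.2) ->
    [/\ exists2 y, K y & nbhs y Q1, closure Q1 `<=` p.2
      & forall z, K z -> closure Q1 z -> ~ N p.1 z].
  case: p => k P /=; have [|H] := pselect (exists2 x, K x & nbhs x P); last by exists P.
  case=> x Kx nx.
  have [y [Ky Py nCy]] : exists y, [/\ K y, P° y & ~ closure (N k) y].
    apply: contrapT => H.
    have : interior (closure (N k)) x.
      rewrite /interior /= /nbhs /= -nbhs_subspace_in//.
      have : nbhs x P° by exact: nbhs_interior.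
      apply: filterS => z Pz Kz; apply: contrapT => ncz; apply: H.
      by exists z.
    by rewrite (ndN k).
  have [B nB NB0] : exists2 B, nbhs (y : subspace K) B & forall z, B z -> ~ N k z.
    apply: contrapT => H; apply: nCy => B nB; apply: contrapT => NB; apply: H.
    by exists B => // z Bz Nz; apply: NB; exists z.
  move: nB; rewrite /nbhs /= -nbhs_subspace_in// => nB.
  have nPB : nbhs y (P `&` [set z | K z -> B z]) by apply: filterI => //; exact: nB.
  have [Q1 nQ1 sQ1] := regX y _ nPB.
  exists Q1 => _; split; first by exists y.
    by move=> z /sQ1[].
  by move=> z Kz /sQ1[_ /(_ Kz)] /NB0.
have [s hs] := choice step.
pose a := fix a n := if n is n'.+1 then s (n', a n') else O.
have ha n : exists2 x, K x & nbhs x (a n).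
  by elim: n => [|n IH]; [exists t|have [] := hs (n, a n) IH].
have sub n m : (n <= m)%N -> a m `<=` a n.
  elim: m => [|m IH]; first by rewrite leqn0 => /eqP ->.
  rewrite leq_eqVlt => /orP[/eqP -> //|/IH nm].
  have [_ h _] := hs (m, a m) (ha m).
  by apply: subset_trans nm; apply: subset_trans h; exact: subset_closure.
pose F := filter_from [set: nat] (fun n => a n `&` K).
have FF : ProperFilter F.
  apply: filter_from_proper; last first.
    by move=> n _; have [x Kx nx] := ha n; exists x; split => //; exact: nbhs_singleton nx.
  apply: filter_from_filter; first by exists 0%N.
  move=> i j _ _; exists (maxn i j) => // x [ax Kx].
  by split; split => //; apply: sub ax; rewrite ?leq_maxl ?leq_maxr.
have FK : F K by exists 0%N => // x [].
have [p [Kp cp]] := cK F FF FK.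
have clp n : closure (a n) p.
  move=> B nB; have [|y [[ay _] By]] := cp (a n `&` K) B _ nB; first by exists n.
  by exists y.
exists p; split => //.
  by have [_ h _] := hs (0%N, a 0%N) (ha 0%N); apply: h; exact: (clp 1%N).
by move=> k; have [_ _] := hs (k, a k) (ha k); apply => //; exact: (clp k.+1).
Qed.

(** A convex function of [r] lies below its chord on [[0, 1]]. *)
Lemma expr1D_le (R : realType) (r : R) n : 0 <= r <= 1 ->
  (1 + r) ^+ n <= 1 + r * (2 ^+ n - 1).
Proof.
move=> /andP[r0 r1]; elim: n => [|n IH]; first by rewrite !expr0 subrr mulr0 addr0.
have n1 : 1 <= 2 ^+ n :> R by rewrite exprn_ege1// ler1n.
rewrite !exprS; move: IH n1; set y := (1 + r) ^+ n; set z := 2 ^+ n => IH n1.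
have h1 := ler_wpM2l (addr_ge0 ler01 r0) IH.
have h2 : r * (r * (z - 1)) <= 1 * (r * (z - 1)).
  by rewrite ler_wpM2r// mulr_ge0// subr_ge0.
lra.
Qed.

(** * The character space, its Shilov boundary and peak functions *)

Section CharacterSpace.
Variables (R : realType) (A : completeNormedModType (Cx R)).
Variables (mul : A -> A -> A) (one : A).
Hypothesis ba : is_comm_banach_alg mul one.
Local Notation M := (max_ideal_space mul one).
Local Notation X := {ptws A -> Cx R}.

Lemma eval_continuous (f : A) : continuous (fun x : X => x f : Cx R).
Proof. exact: (@proj_continuous A (fun=> Cx R) f). Qed.

Lemma nbhs_eval (x : X) (f : A) (e : R) : 0 < e ->
  nbhs x [set y : X | md (y f - x f) < e].
Proof. by move=> e0; exact: (eval_continuous (nbhs_md (x f) e0)). Qed.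

Lemma nbhs_evals (x : X) (fs : seq A) (e : R) : 0 < e ->
  nbhs x [set y : X | forall f, f \in fs -> md (y f - x f) < e].
Proof.
move=> e0; elim: fs => [|g fs IH]; first by apply: filterS filterT => y.
apply: filterS (filterI (nbhs_eval x g e0) IH) => y [h1 h2] f.
by rewrite inE => /orP[/eqP->|/h2].
Qed.

Lemma md_continuous : continuous (@md R).
Proof.
move=> z B /nbhs_ballP[e e0 eB]; apply: filterS (nbhs_md z e0) => y /= h.
apply: eB; rewrite -ball_normE /= ltr_norml; apply/andP; split.
  by rewrite ltrNl opprB (le_lt_trans (md_dist _ _)).
by rewrite (le_lt_trans (md_dist _ _))// mdC.
Qed.

Lemma md_eval_continuous (f : A) : continuous (fun x : X => md (x f)).
Proof.
move=> x; apply: (@continuous_comp X (Cx R) R (fun x => x f) (@md R) x).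
  exact: eval_continuous.
exact: md_continuous.
Qed.

Lemma md_small_eq0 (z : Cx R) (k : R) : (forall e : R, 0 < e -> md z <= k * e) -> z = 0.
Proof.
move=> h; apply/eqP; rewrite -md_eq0 eq_le md_ge0 andbT.
apply/ler_addgt0Pr => e e0; rewrite add0r.
have k1 : 0 < `|k| + 1 by rewrite ltr_wpDl.
have h1 := h _ (divr_gt0 e0 k1); apply: le_trans h1 _.
rewrite mulrA ler_pdivrMr// mulrC ler_pM2l//.
by rewrite (le_trans (ler_norm _))// lerDl.
Qed.

Lemma max_ideal_space_closed : closed (M : set X).
Proof.
move=> x clx.
have apx (fs : seq A) (e : R) : 0 < e ->
    exists2 y, M y & forall f, f \in fs -> md (y f - x f) < e.
  by move=> e0; have [y [My h]] := clx _ (nbhs_evals x fs e0); exists y.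
split.
- move=> a f g; apply/eqP; rewrite -subr_eq0; apply/eqP.
  apply: (@md_small_eq0 _ (2 + md a)) => e e0.
  have [y [yl _ _] h] := apx [:: a *: f + g; f; g] e e0.
  have h1 := h _ (mem_head _ _).
  have h2 : md (y f - x f) < e by apply: h; rewrite !inE eqxx orbT.
  have h3 : md (y g - x g) < e by apply: h; rewrite !inE eqxx !orbT.
  have -> : x (a *: f + g) - (a * x f + x g) =
     a * (y f - x f) + (y g - x g) - (y (a *: f + g) - x (a *: f + g)).
    by rewrite (yl a f g); ring.
  apply: le_trans (mdB _ _) _; have := mdD (a * (y f - x f)) (y g - x g).
  rewrite mdM; have := ler_wpM2l (md_ge0 a) (ltW h2); lra.
- move=> f g; apply/eqP; rewrite -subr_eq0; apply/eqP.
  apply: (@md_small_eq0 _ (1 + md (x f) + nrm g)) => e e0.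
  have [y My h] := apx [:: mul f g; f; g] e e0.
  have [_ yM _] := My.
  have h1 := h _ (mem_head _ _).
  have h2 : md (y f - x f) < e by apply: h; rewrite !inE eqxx orbT.
  have h3 : md (y g - x g) < e by apply: h; rewrite !inE eqxx !orbT.
  have -> : x (mul f g) - x f * x g =
     x f * (y g - x g) + (y f - x f) * y g - (y (mul f g) - x (mul f g)).
    by rewrite (yM f g); ring.
  apply: le_trans (mdB _ _) _.
  have := mdD (x f * (y g - x g)) ((y f - x f) * y g); rewrite !mdM.
  have := ler_wpM2l (md_ge0 (x f)) (ltW h3).
  have := ler_pM (md_ge0 _) (md_ge0 _) (ltW h2) (char_le_nrm ba g My); lra.
- apply/eqP; rewrite -subr_eq0; apply/eqP.
  apply: (@md_small_eq0 _ 1) => e e0.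
  have [y [_ _ y1] h] := apx [:: one] e e0.
  by rewrite -y1 mdC mul1r ltW// h// mem_head.
Qed.

(** Banach-Alaoglu: the characters form a closed part of the product of the discs of radius
    [nrm f]. *)
Lemma max_ideal_space_compact : compact (M : set X).
Proof.
have cpt : compact [set x : X | forall f : A, md (x f) <= nrm f].
  exact: (@tychonoff A (fun=> Cx R) (fun f => [set z | md z <= nrm f])
            (fun f => @disc_compact R (nrm f))).
apply: subclosed_compact max_ideal_space_closed cpt _ => x Mx f.
exact: (char_le_nrm ba f Mx).
Qed.

Lemma max_attained f : M !=set0 ->
  exists2 m0, M m0 & forall m, M m -> md (m f) <= md (m0 f).
Proof.
move=> M0.
have c : {within (M : set X), continuous (fun x : X => md (x f))}.
  by apply: continuous_subspaceT; exact: md_eval_continuous.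
have [m Mm h] := compact_EVT_max M0 max_ideal_space_compact c.
by exists m; [exact: set_mem Mm|move=> x Mx; apply: h; exact: mem_set].
Qed.

Hypothesis ss : semisimple mul one.

Lemma max_ideal_space_neq0 : M !=set0.
Proof.
apply: contrapT => H; have /negP := ba_one_neq0 ba; apply; apply/eqP/ss => m Mm.
by exfalso; apply: H; exists m.
Qed.

(** A closed boundary omitting [x] is refuted by an [f] that vanishes on it with [x f != 0]: the
    maximum of its modulus would be 0. *)
Lemma shilov_regular : regular mul one -> shilov_boundary mul one = M.
Proof.
move=> reg; apply/seteqP; split=> x.
  move=> /(_ M); apply; split; first by exists setT; split; [exact: closedT|rewrite setTI].
  split=> // f; have [m0 Mm0 h] := max_attained f max_ideal_space_neq0.
  by exists m0 => // m /h; rewrite !mdE lecR.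
move=> Mx F [cF [FM bF]]; apply: contrapT => nFx.
have [f [xf0 Ff]] := reg F x cF Mx nFx.
have [m0 /Ff m00 /(_ x Mx)] := bF f.
by rewrite m00 normr0 normr_le0 (negbTE xf0).
Qed.

Section Peak.
Variables (g : X -> Cx R) (s : X).
Hypotheses (gapx : forall e : R, 0 < e -> exists f : A,
    forall t, M t -> md (g t - t f) <= e) (Ms : M s) (gs : g s = 1)
  (g1 : forall x, M x -> x <> s -> md (g x) < 1).

(** Points off [V] with [g] nearly of modulus 1 would cluster at some [p] other than [s]. The values
    of [g] there are compared through an approximant [f], which supplies the continuity. *)
Lemma peak_off (V : set X) : nbhs s V ->
  exists2 th : R, 0 <= th < 1 & forall x, M x -> ~ V x -> md (g x) <= th.
Proof.
move=> nV; apply: contrapT => H.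
have step (n : nat) : exists x, [/\ M x, ~ V x & 1 - n.+1%:R^-1 < md (g x)].
  apply: contrapT => H2; apply: H; exists (1 - n.+1%:R^-1).
    by rewrite subr_ge0 invf_le1// ler1n/= gtrBl invr_gt0.
  move=> x Mx nVx; rewrite leNgt; apply/negP => h; apply: H2.
  by exists x.
have [x hx] := choice step.
have [|p [Mp cp]] := @max_ideal_space_compact (x @ \oo) _.
  by exists 0%N => // n _; have [] := hx n.
have ps : p <> s.
  move=> ps; rewrite ps in cp.
  have [|y [[n _ <-] Vx]] := cp (x @` setT) V _ nV.
    by exists 0%N => // n _ /=; exists n.
  by have [_] := hx n.
have gp := g1 Mp ps.
pose d : R := (1 - md (g p)) / 4.
have d0 : 0 < d by rewrite divr_gt0// subr_gt0.
have [f hf] := gapx d0.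
have [N hN] : exists N : nat, d^-1 <= N%:R.
  by exists (Num.truncn d^-1).+1; rewrite ltW// truncnS_gt.
have [|y [[n Nn <-] yp]] := cp (x @` [set n | (N <= n)%N]) _ _ (nbhs_eval p f d0).
  by exists N => // n Nn /=; exists n.
have [Mx _ h] := hx n.
have nd : n.+1%:R^-1 <= d.
  by rewrite -[leRHS]invrK lef_pV2 ?posrE ?invr_gt0// (le_trans hN)// ler_nat ltnW.
have h1 := hf _ Mx; have h2 := hf _ Mp.
have h3 := md_dist (g (x n)) (x n f); have h4 := md_dist (x n f) (p f).
have h5 := md_dist (p f) (g p); rewrite mdC in h5.
rewrite /= in yp; have d4 : 4 * d = 1 - md (g p) by rewrite /d; field.
have arith (a b c u v : R) : a - b <= d -> b - c <= d -> c - u <= d -> v <= d ->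
    1 - v < a -> 4 * d = 1 - u -> (0 : R) < 0 by move=> *; lra.
by have := arith _ _ _ _ _ (le_trans h3 h1) (le_trans h4 (ltW yp)) (le_trans h5 h2) nd h d4;
  rewrite ltxx.
Qed.

(** [h] is the [N]-th power of [f / s f] for an [f] close to [g]: the exponent [N] is fixed by the
    bound off the neighbourhood, and the accuracy of [f] is chosen after it. *)
Lemma peak_approx (fs : seq A) (e tau : R) : 0 < e -> 0 < tau -> tau <= 1 ->
  exists h : A, [/\ s h = 1, forall x, M x -> md (x h) <= 1 + tau
    & forall x, M x -> (exists2 f, f \in fs & e <= md (x f - s f)) -> md (x h) <= tau].
Proof.
move=> e0 t0 t1.
have [th /andP[th0 th1] hth] := peak_off (nbhs_evals s fs e0).
pose th' : R := (1 + th) / 2.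
have [N0 hN] := @geometric_small R th' 1 tau ltac:(rewrite /th'; lra) ltac:(rewrite /th'; lra) t0.
pose N := N0.+1.
(* The first term keeps the quotient below [th'] off the neighbourhood, the second makes
   [(1 + 4 d)^N <= 1 + tau]. *)
pose d : R := Num.min ((1 - th) / 8) (tau / (4 * 2 ^+ N)).
have N2 : 0 < 2 ^+ N :> R by rewrite exprn_gt0.
have d0 : 0 < d by rewrite lt_min !divr_gt0// ?subr_gt0// mulr_gt0.
have d1 : d <= (1 - th) / 8 by rewrite ge_min lexx.
have d2 : d * (4 * 2 ^+ N) <= tau by rewrite -ler_pdivlMr ?mulr_gt0// ge_min lexx orbT.
have [f hf] := gapx d0.
have sf : 1 - d <= md (s f).
  by have := hf _ Ms; have := md_dist (g s) (s f); rewrite gs md1; lra.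
have dlt : d <= 1 / 8 by lra.
have sf0 : 0 < md (s f) by lra.
have powE n x : M x -> x (iter n (mul f) one) = x f ^+ n.
  move=> [_ xM x1]; elim: n => [|n IH]; first by rewrite expr0.
  by rewrite iterS xM IH exprS.
pose h := (s f ^+ N)^-1 *: iter N (mul f) one.
have hE x : M x -> md (x h) = (md (x f) / md (s f)) ^+ N.
  move=> Mx; have [xl _ _] := Mx.
  have x0 : x 0 = 0 by have := xl (-1) 0 0; rewrite scaler0 addr0 mulN1r addNr.
  have := xl (s f ^+ N)^-1 (iter N (mul f) one) 0; rewrite !addr0 x0 addr0 => ->.
  by rewrite powE// mdM mdV !mdX -exprVn -exprMn mulrC.
have xf1 x : M x -> md (x f) <= 1 + d.
  move=> Mx; have := hf _ Mx; have := md_dist (x f) (g x); rewrite mdC.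
  have : md (g x) <= 1.
    by have [->|/(g1 Mx)/ltW//] := pselect (x = s); rewrite gs md1.
  lra.
exists h; split.
- have [xl _ _] := Ms.
  have x0 : s 0 = 0 by have := xl (-1) 0 0; rewrite scaler0 addr0 mulN1r addNr.
  have := xl (s f ^+ N)^-1 (iter N (mul f) one) 0; rewrite !addr0 x0 addr0 => ->.
  by rewrite powE// mulVf// expf_neq0// -md_gt0.
- move=> x Mx; rewrite hE//.
  pose r : R := 4 * d.
  have rr : md (x f) / md (s f) <= 1 + r.
    by rewrite ler_pdivrMr// /r; have := xf1 x Mx; nra.
  have r01 : 0 <= r <= 1 by rewrite /r; apply/andP; split; lra.
  apply: (@le_trans _ _ ((1 + r) ^+ N)).
    by rewrite lerXn2r ?nnegrE ?divr_ge0 ?md_ge0// addr_ge0//; case/andP: r01.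
  apply: le_trans (expr1D_le _ r01) _; rewrite lerD2l.
  rewrite /r; move: d2 N2 d0; set z := 2 ^+ N; nra.
- move=> x Mx [f0 f0fs ef0]; rewrite hE//.
  have nV : ~ [set y : X | forall f, f \in fs -> md (y f - s f) < e] x.
    by move=> /(_ _ f0fs); rewrite ltNge ef0.
  have gx := hth x Mx nV.
  have xf : md (x f) <= th + d.
    by have := hf _ Mx; have := md_dist (x f) (g x); rewrite mdC; lra.
  apply: (@le_trans _ _ (th' ^+ N)).
    rewrite lerXn2r ?nnegrE ?divr_ge0 ?md_ge0//; first by rewrite /th'; lra.
    by rewrite ler_pdivrMr// /th'; nra.
  by have := hN N (leqW (leqnn _)); rewrite mul1r.
Qed.

End Peak.
End CharacterSpace.

(** * Finite extrema, and exponential against polynomial growth *)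

Section FiniteFamilies.
Variable R : realType.

Lemma fin_max (F : nat -> R) n : exists2 k, (k <= n)%N & forall j, (j <= n)%N -> F j <= F k.
Proof.
elim: n => [|n [k kn hk]].
  by exists 0%N => // j; rewrite leqn0 => /eqP ->.
have [h|h] := leP (F n.+1) (F k).
  exists k; first exact: leqW.
  by move=> j; rewrite leq_eqVlt => /orP[/eqP ->//|]; exact: hk.
exists n.+1 => // j; rewrite leq_eqVlt => /orP[/eqP ->//|jn].
by rewrite (le_trans (hk j jn))// ltW.
Qed.

Lemma fin_pos_lb (F : nat -> R) n : (forall k, (k <= n)%N -> 0 < F k) ->
  exists2 e : R, 0 < e & forall k, (k <= n)%N -> e <= F k.
Proof.
elim: n => [|n IH] h.
  by exists (F 0%N); [exact: h|move=> k; rewrite leqn0 => /eqP ->].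
have [|e e0 he] := IH; first by move=> k kn; apply: h; exact: leqW.
exists (Num.min e (F n.+1)); first by rewrite lt_min e0 h.
move=> k; rewrite leq_eqVlt => /orP[/eqP ->|kn]; first by rewrite ge_min lexx orbT.
by rewrite ge_min he.
Qed.

(** With [m = 10 k], the bound [(m + 2)^5 <= 12^5 2^(5 k)] uses one factor [2^(5 k)] of [2^m], and
    [12^5 X <= k] uses the other. The degree 5 is that of the losses in [hnum_choice]. *)
Lemma poly_exp_small (X : R) : exists m : nat, X * m.+2%:R ^+ 5 <= 2 ^+ m.
Proof.
pose k := (Num.truncn `|X * 12 ^+ 5|).+1.
exists (10 * k)%N.
have hk : X * 12 ^+ 5 <= k%:R.
  by rewrite (le_trans (ler_norm _))// ltW// truncnS_gt.
have k2 : k%:R <= 2 ^+ k :> R by rewrite -natrX ler_nat ltnW// ltn_expl.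
have k1 : 1 <= k%:R :> R by rewrite ler1n.
have [X0|X0] := leP X 0.
  by rewrite (@le_trans _ _ 0)// ?exprn_ge0// mulr_le0_ge0// exprn_ge0.
apply: (@le_trans _ _ (X * (12 * 2 ^+ k) ^+ 5)).
  rewrite ler_pM2l// lerXn2r ?nnegrE ?mulr_ge0 ?exprn_ge0//.
  have -> : (10 * k).+2%:R = 10 * k%:R + 2 :> R by rewrite -addn2 natrD natrM.
  lra.
have -> : X * (12 * 2 ^+ k) ^+ 5 = X * 12 ^+ 5 * 2 ^+ (5 * k).
  by rewrite exprMn -exprM (mulnC k) mulrA.
have -> : 2 ^+ (10 * k) = 2 ^+ (5 * k) * 2 ^+ (5 * k) :> R by rewrite -exprD -mulnDl.
rewrite ler_pM2r ?exprn_gt0// (le_trans hk)// (le_trans k2)// ler_weXn2l ?ler1n//.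
by rewrite leq_pmull.
Qed.

End FiniteFamilies.

(** * Coefficient majorants and the reweighted kernel polynomial *)

Section PolyMajorants.
Variable R : realType.
Implicit Types p q P Q : {poly R}.

(** A majorant turns evaluation at 1 into a bound on the l1 norm of the coefficients that is
    compatible with products. *)
Definition maj p P := forall i, `|p`_i| <= P`_i.

Lemma maj_add p q P Q : maj p P -> maj q Q -> maj (p + q) (P + Q).
Proof.
move=> h1 h2 i; rewrite !coefD (le_trans (ler_normD _ _))//.
by rewrite lerD// (h1, h2).
Qed.

Lemma maj_opp p P : maj p P -> maj (- p) P.
Proof. by move=> h i; rewrite coefN normrN. Qed.

Lemma maj_sub p q P Q : maj p P -> maj q Q -> maj (p - q) (P + Q).
Proof. by move=> h1 h2; apply: maj_add => //; exact: maj_opp. Qed.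

Lemma maj_mul p q P Q : maj p P -> maj q Q -> maj (p * q) (P * Q).
Proof.
move=> h1 h2 i; rewrite !coefM (le_trans (ler_norm_sum _ _ _))//.
by apply: ler_sum => j _; rewrite normrM ler_pM.
Qed.

Lemma maj_scale (a : R) p P : maj p P -> maj (a *: p) (`|a| *: P).
Proof. by move=> h i; rewrite !coefZ normrM ler_wpM2l. Qed.

Lemma maj_exp p P n : maj p P -> maj (p ^+ n) (P ^+ n).
Proof.
move=> h; elim: n => [|n IH]; last by rewrite !exprS; exact: maj_mul.
by move=> i; rewrite expr0 coef1; case: eqP => _; rewrite ?normr1 ?normr0.
Qed.

Lemma maj_nonneg p : (forall i, 0 <= p`_i) -> maj p p.
Proof. by move=> h i; rewrite ger0_norm. Qed.

Lemma horner1_sum p n : (size p <= n)%N -> p.[1] = \sum_(i < n) p`_i.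
Proof.
by move=> h; rewrite (horner_coef_wide _ h); apply: eq_bigr => i _; rewrite expr1n mulr1.
Qed.

Lemma maj_sum p P n : maj p P -> \sum_(i < n) `|p`_i| <= P.[1].
Proof.
move=> h; rewrite (@horner1_sum P (n + size P)) ?leq_addl// big_split_ord /=.
rewrite -[leLHS]addr0 lerD//; first by apply: ler_sum.
by apply: sumr_ge0 => i _; rewrite (le_trans _ (h _)).
Qed.

(** Through this operator a weight polynomial in the index of the coefficients becomes a
    differential expression, from which powers of [geo n] can be factored out. *)
Definition euler p := 'X * p^`().

Lemma coef_euler p i : (euler p)`_i = p`_i * i%:R.
Proof.
rewrite /euler coefXM; case: i => [|i]; first by rewrite mulr0.
by rewrite /= coef_deriv mulr_natr.
Qed.

Lemma eulerM p q : euler (p * q) = euler p * q + p * euler q.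
Proof. by rewrite /euler derivM; ring. Qed.

Lemma eulerX p n : euler (p ^+ n.+1) = p ^+ n * euler p * n.+1%:R.
Proof.
elim: n => [|n IH]; first by rewrite expr0 expr1; ring.
by rewrite exprS eulerM IH exprS -[n.+2%:R]natr1; ring.
Qed.

Definition geo n : {poly R} := \sum_(i < n) 'X^i.

Lemma coef_geo n i : (geo n)`_i = (i < n)%N%:R.
Proof.
rewrite /geo coef_sum; under eq_bigr do rewrite coefXn.
have [ltin|geni] := ltnP i n.
  rewrite (bigD1 (Ordinal ltin)) //= eqxx big1 ?addr0// => j /negP ji.
  by case: eqP => // e; exfalso; apply: ji; apply/eqP/val_inj.
by rewrite big1 // => j _; case: eqP => // e; move: (ltn_ord j); rewrite -e ltnNge geni.
Qed.

Lemma size_geo n : (size (geo n) <= n)%N.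
Proof.
by apply/leq_sizeP => j nj; rewrite coef_geo ltnNge nj.
Qed.

Lemma geo_mul n : ('X - 1) * geo n = 'X^n - 1.
Proof. by rewrite /geo -subrX1. Qed.

Definition gker (m n : nat) (K : R) : {poly R} :=
  let r := (m.+2 * n)%:R in
  (r ^+ 2 - K ^+ 2) *: geo n ^+ 2 + (2 * K * m.+2%:R) *: (geo n * euler (geo n))
  - (m.+2%:R * m.+1%:R) *: euler (geo n) ^+ 2
  - m.+2%:R *: (geo n * euler (euler (geo n))).

(* [geo n ^+ m.+2] with its [k]-th coefficient multiplied by [((m + 2) n)^2 - (k - K)^2]
   (see [coef_ker]); [gker] is what the Euler operator leaves after factoring out
   [geo n ^+ m]. *)
Definition ker (m n : nat) (K : R) : {poly R} := geo n ^+ m * gker m n K.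

Lemma coef_ker m n K k :
  (ker m n K)`_k = (geo n ^+ m.+2)`_k * ((m.+2 * n)%:R ^+ 2 - (k%:R - K) ^+ 2).
Proof.
have -> : ker m n K = ((m.+2 * n)%:R ^+ 2 - K ^+ 2) *: geo n ^+ m.+2
   + (2 * K) *: euler (geo n ^+ m.+2) - euler (euler (geo n ^+ m.+2)).
  have e0 (a : nat) : euler (a%:R : {poly R}) = 0.
    by rewrite /euler -polyC_natr derivC mulr0.
  rewrite (eulerX _ m.+1) (eulerM (_ * _)) (eulerM (geo n ^+ m.+1)) (eulerX _ m) e0.
  rewrite /ker /gker -!mul_polyC !(rmorphB, rmorphM, rmorphXn, rmorph_nat) /=.
  by rewrite !exprS; ring.
rewrite !(coefD, coefN, coefZ, coef_euler); ring.
Qed.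

Lemma maj_geo n : maj (geo n) (geo n).
Proof. by apply: maj_nonneg => i; rewrite coef_geo ler0n. Qed.

Lemma geo_exp_ge0 m n i : 0 <= (geo n ^+ m)`_i.
Proof. exact: le_trans (normr_ge0 _) (maj_exp m (maj_geo n) i). Qed.

Lemma horner1_geo n : (geo n).[1] = n%:R.
Proof.
rewrite (horner1_sum (size_geo n)) (eq_bigr (fun=> 1)).
  by rewrite sumr_const card_ord.
by move=> i _; rewrite coef_geo ltn_ord.
Qed.

Lemma size_euler p : (size (euler p) <= size p)%N.
Proof. by apply/leq_sizeP => j hj; rewrite coef_euler nth_default// mul0r. Qed.

Lemma euler_ge0 p : (forall i, 0 <= p`_i) -> forall i, 0 <= (euler p)`_i.
Proof. by move=> h i; rewrite coef_euler mulr_ge0. Qed.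

Lemma horner1_euler p n : (forall i, 0 <= p`_i) -> (size p <= n)%N ->
  0 <= (euler p).[1] <= n%:R * p.[1].
Proof.
move=> h sp; rewrite (horner1_sum (leq_trans (size_euler p) sp)) (horner1_sum sp).
apply/andP; split; first by apply: sumr_ge0 => i _; exact: euler_ge0.
rewrite mulr_sumr; apply: ler_sum => i _; rewrite coef_euler mulrC ler_wpM2r//.
by rewrite ler_nat ltnW.
Qed.

Lemma size_geo_exp m n : (size (geo n ^+ m) <= (m * n).+1)%N.
Proof.
apply: leq_trans (size_poly_exp_leq _ _) _; rewrite ltnS mulnC leq_mul2l.
by apply/orP; right; rewrite (leq_trans (leq_pred _))// size_geo.
Qed.

Lemma size_mul2 p q n : (size p <= n)%N -> (size q <= n)%N -> (size (p * q)%R <= 2 * n)%N.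
Proof.
move=> hp hq; apply: leq_trans (size_polyMleq _ _) _.
by rewrite (leq_trans (leq_pred _))// mul2n -addnn leq_add.
Qed.

Lemma size_gker m n K : (size (gker m n K) <= 2 * n)%N.
Proof.
have s1 := size_geo n.
have s2 := leq_trans (size_euler _) s1.
have s3 := leq_trans (size_euler _) s2.
by rewrite /gker; do 3 (try (apply: leq_trans (size_polyD _ _) _; rewrite geq_max ?size_polyN; apply/andP; split));
  apply: leq_trans (size_scale_leq _ _) _; rewrite ?expr2; apply: size_mul2.
Qed.

Lemma size_ker m n K : (size (ker m n K) <= (m.+2 * n).+1)%N.
Proof.
apply: leq_trans (size_polyMleq _ _) _.
have := size_geo_exp m n; have := size_gker m n K; lia.
Qed.

Lemma size_XnB1_gker m n K : (0 < n)%N ->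
  (size (('X^n - 1) ^+ m * gker m n K)%R <= (m.+2 * n).+1)%N.
Proof.
move=> n0; apply: leq_trans (size_polyMleq _ _) _.
have s1 : (size (('X^n - 1 : {poly R}) ^+ m) <= (m * n).+1)%N.
  apply: leq_trans (size_poly_exp_leq _ _) _.
  by rewrite size_XnsubC// ltnS mulnC.
have s2 := size_gker m n K.
apply: leq_trans (leq_pred _) _; apply: leq_trans (leq_add s1 s2) _; lia.
Qed.

(** The four terms of [gker] have l1 norms at most 1, 2, 1 and 1 times [r^2 n^2], and
    [('X^n - 1) ^+ m] contributes only [2^m]. For comparison, [geo n ^+ m.+2] has l1 norm
    [n^(m + 2)]. *)
Lemma maj_XnB1_gker m n (K : R) : (0 < n)%N -> 0 <= K <= (m.+2 * n)%:R ->
  exists2 P, maj (('X^n - 1) ^+ m * gker m n K) P &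
    P.[1] <= 2 ^+ m * (5 * (m.+2 * n)%:R ^+ 2 * n%:R ^+ 2).
Proof.
move=> n0 /andP[K0 KR]; set r : R := (m.+2 * n)%:R in KR *.
have mg := maj_geo n.
have g0 i : 0 <= (geo n)`_i by rewrite coef_geo ler0n.
have me : maj (euler (geo n)) (euler (geo n)) by apply: maj_nonneg; exact: euler_ge0.
have mee : maj (euler (euler (geo n))) (euler (euler (geo n))).
  by apply: maj_nonneg; do 2 apply: euler_ge0.
have /andP[e0 e1] := horner1_euler g0 (size_geo n).
have /andP[f0 f1] := horner1_euler (euler_ge0 g0) (leq_trans (size_euler _) (size_geo n)).
exists (('X^n + 1) ^+ m * (`|r ^+ 2 - K ^+ 2| *: geo n ^+ 2
   + `|2 * K * m.+2%:R| *: (geo n * euler (geo n))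
   + `|m.+2%:R * m.+1%:R| *: euler (geo n) ^+ 2
   + `|m.+2%:R| *: (geo n * euler (euler (geo n))))).
  apply: maj_mul.
    apply: maj_exp; apply: maj_sub; apply: maj_nonneg => i.
      by rewrite coefXn ler0n.
    by rewrite coef1 ler0n.
  apply: maj_sub; [apply: maj_sub; [apply: maj_add|]|]; apply: maj_scale.
  - exact: maj_exp.
  - exact: maj_mul.
  - exact: maj_exp.
  - exact: maj_mul.
rewrite hornerM horner_exp hornerD hornerXn hornerC expr1n.
apply: ler_wpM2l; first by rewrite exprn_ge0.
rewrite !(hornerD, hornerZ) !horner_exp !(hornerM (geo n)) horner1_geo.
rewrite horner1_geo in e1.
rewrite (@ger0_norm _ (r ^+ 2 - K ^+ 2)); last by rewrite subr_ge0 lerXn2r ?nnegrE.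
rewrite !ger0_norm ?mulr_ge0//.
move: e0 e1 f0 f1; set e := (euler (geo n)).[1]; set f := (euler _).[1] => e0 e1 f0 f1.
have rE : r = m.+2%:R * n%:R by rewrite /r natrM.
set a : R := m.+2%:R; set N : R := n%:R in e1 f1 rE *.
have N0 : 0 <= N by rewrite ler0n.
have a0 : 0 <= a by rewrite ler0n.
have a1 : m.+1%:R <= a by rewrite ler_nat.
have h1 : (r ^+ 2 - K ^+ 2) * N ^+ 2 <= r ^+ 2 * N ^+ 2.
  by rewrite ler_wpM2r ?exprn_ge0// lerBlDr lerDl exprn_ge0.
have h2 : 2 * K * a * (N * e) <= 2 * r ^+ 2 * N ^+ 2.
  have : 2 * K * a * (N * e) <= 2 * r * a * (N * (N * N)).
    rewrite ler_pM ?mulr_ge0//; first by rewrite ler_wpM2r// ler_wpM2l.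
    by rewrite ler_wpM2l.
  have -> : 2 * r * a * (N * (N * N)) = 2 * r ^+ 2 * N ^+ 2 by rewrite rE; ring.
  by [].
have h3 : a * m.+1%:R * e ^+ 2 <= r ^+ 2 * N ^+ 2.
  have : a * m.+1%:R * e ^+ 2 <= a * a * (N * N) ^+ 2.
    rewrite ler_pM ?mulr_ge0 ?exprn_ge0//; first by rewrite ler_wpM2l.
    by rewrite lerXn2r ?nnegrE ?mulr_ge0.
  have -> : a * a * (N * N) ^+ 2 = r ^+ 2 * N ^+ 2 by rewrite rE; ring.
  by [].
have h4 : a * (N * f) <= r ^+ 2 * N ^+ 2.
  have : a * (N * f) <= a * a * (N * (N * (N * N))).
    rewrite ler_pM ?mulr_ge0//; first by rewrite ler_peMr// ler1n.
    by rewrite ler_wpM2l// (le_trans f1)// ler_wpM2l.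
  have -> : a * a * (N * (N * (N * N))) = r ^+ 2 * N ^+ 2 by rewrite rE; ring.
  by [].
lra.
Qed.

(** Pigeonhole: at most [m n + 1] coefficients add up to [n^m]. *)
Lemma geo_exp_max m n : (0 < n)%N -> exists2 k0, (k0 <= m * n)%N &
  n%:R ^+ m <= (m * n).+1%:R * (geo n ^+ m)`_k0.
Proof.
move=> n0; have [k0 k0R h] := @fin_max R (fun k => (geo n ^+ m)`_k) (m * n).
exists k0 => //.
have -> : n%:R ^+ m = (geo n ^+ m).[1] :> R by rewrite horner_exp horner1_geo.
rewrite (horner1_sum (size_geo_exp m n)).
apply: (@le_trans _ _ (\sum_(i < (m * n).+1) (geo n ^+ m)`_k0)).
  by apply: ler_sum => i _; apply: h; rewrite -ltnS.
by rewrite sumr_const card_ord mulr_natl.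
Qed.

End PolyMajorants.

(** * Weighted composition operators along orbits *)

Section Dynamics.
Variables (R : realType) (A : completeNormedModType (Cx R)).
Variables (mul : A -> A -> A) (one : A).
Hypothesis ba : is_comm_banach_alg mul one.
Local Notation chi := (is_character mul one).

Lemma ch0 x : chi x -> x 0 = 0.
Proof. by move=> [h _ _]; have := h (-1) 0 0; rewrite scaler0 addr0 mulN1r addNr. Qed.

Lemma chD x f g : chi x -> x (f + g) = x f + x g.
Proof. by move=> [h _ _]; have := h 1 f g; rewrite scale1r mul1r. Qed.

Lemma chZ x a f : chi x -> x (a *: f) = a * x f.
Proof. by move=> cx; have [h _ _] := cx; have := h a f 0; rewrite addr0 ch0// addr0. Qed.

Lemma chN x f : chi x -> x (- f) = - x f.
Proof. by move=> cx; rewrite -scaleN1r chZ// mulN1r. Qed.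

Lemma chB x f g : chi x -> x (f - g) = x f - x g.
Proof. by move=> cx; rewrite chD// chN. Qed.

Lemma chM x f g : chi x -> x (mul f g) = x f * x g.
Proof. by case. Qed.

Lemma ch1 x : chi x -> x one = 1.
Proof. by case. Qed.

Lemma ch_sum x (I : Type) (r : seq I) (P : pred I) (F : I -> A) : chi x ->
  x (\sum_(i <- r | P i) F i) = \sum_(i <- r | P i) x (F i).
Proof. by move=> cx; apply: (big_morph x (fun f g => chD f g cx) (ch0 cx)). Qed.

Lemma ch_big x (I : Type) (r : seq I) (P : pred I) (F : I -> A) : chi x ->
  x (\big[mul/one]_(i <- r | P i) F i) = \prod_(i <- r | P i) x (F i).
Proof. by move=> cx; apply: (big_morph x (fun f g => chM f g cx) (ch1 cx)). Qed.

Record aut (U V : A -> A) : Prop := Aut {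
  aut_lin : lin U;
  aut_mul : forall f g, U (mul f g) = mul (U f) (U g);
  aut_one : U one = one;
  aut_K : cancel U V;
  aut_VK : cancel V U }.

Lemma aut_sym U V : aut U V -> aut V U.
Proof.
case=> l m o k vk; split => //.
- by move=> a x y; rewrite -{1}(vk x) -{1}(vk y) -l k.
- by move=> f g; rewrite -{1}(vk f) -{1}(vk g) -m k.
- by rewrite -o k.
Qed.

Lemma aut_iter U V n : aut U V -> aut (iter n U) (iter n V).
Proof.
case=> l m o k vk; split.
- exact: lin_iter.
- by elim: n => [|n IH] f g //=; rewrite IH m.
- by elim: n => [|n IH] //=; rewrite IH o.
- by elim: n => [|n IH] f //; rewrite iterSr iterS k IH.
- by elim: n => [|n IH] f //; rewrite iterSr iterS vk IH.
Qed.

(* [sh U k x] is [phi^k x] for the map [phi] that [U] induces on characters. *)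
Definition sh (U : A -> A) (k : nat) (x : A -> Cx R) : A -> Cx R := fun f => x (iter k U f).

Lemma chi_sh U V k x : aut U V -> chi x -> chi (sh U k x).
Proof.
move=> /(aut_iter k)[l m o _ _] [xl xm x1]; split.
- by move=> a f g; rewrite /sh l xl.
- by move=> f g; rewrite /sh m xm.
- by rewrite /sh o x1.
Qed.

Lemma shD U a b x : sh U a (sh U b x) = sh U (a + b) x.
Proof. by apply/funext => f; rewrite /sh addnC iterD. Qed.

Lemma shK U V k x : aut U V -> sh U k (sh V k x) = x.
Proof. by move=> /(aut_iter k)[_ _ _ k1 k2]; apply/funext => f; rewrite /sh k1. Qed.

Definition wop (w : A) (U : A -> A) (g : A) := mul w (U g).
Definition wn (w : A) (U : A -> A) (k : nat) := \big[mul/one]_(i < k) iter i U w.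

Lemma wop_lin w U : lin U -> lin (wop w U).
Proof. by move=> l a x y; rewrite /wop l (lin_mul ba). Qed.

Lemma iter_wop w U V k g : aut U V -> iter k (wop w U) g = mul (wn w U k) (iter k U g).
Proof.
move=> au; elim: k => [|k IH]; first by rewrite /wn big_ord0 (ba_mul1 ba).
rewrite iterS IH /wop (aut_mul au) (ba_mulA ba) /wn big_ord_recl; congr (mul (mul _ _) _).
by rewrite (big_morph U (aut_mul au) (aut_one au)); apply: eq_bigr.
Qed.

Lemma ch_wn w U k x : chi x -> x (wn w U k) = \prod_(i < k) x (iter i U w).
Proof. by move=> cx; rewrite /wn ch_big. Qed.

(** Cocycle identity for the weights along the orbit of [x]. *)
Lemma ch_wnD w U V a b x : aut U V -> chi x ->
  x (wn w U (a + b)) = x (wn w U a) * sh U a x (wn w U b).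
Proof.
move=> au cx; rewrite !(ch_wn _ _ _ cx) (ch_wn _ _ _ (chi_sh a au cx)).
rewrite [LHS]big_split_ord /=.
by congr (_ * _); apply: eq_bigr => i _; rewrite /sh -iterD.
Qed.

Lemma ch_wop w U V k g x : aut U V -> chi x ->
  x (iter k (wop w U) g) = x (wn w U k) * sh U k x g.
Proof. by move=> au cx; rewrite (iter_wop _ _ _ au) chM. Qed.

Lemma ch_wn_bd w U V (B : R) k x : aut U V -> 0 < B ->
  (forall x, chi x -> B^-1 <= md (x w) <= B) -> chi x ->
  B^-1 ^+ k <= md (x (wn w U k)) <= B ^+ k.
Proof.
move=> au B0 hB cx; rewrite ch_wn// md_prod.
elim: k => [|k /andP[h1 h2]]; first by rewrite big_ord0 !expr0 lexx.
rewrite big_ord_recr !exprSr /=.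
have /andP[b1 b2] := hB _ (chi_sh k au cx).
have B1 : 0 <= B^-1 by rewrite invr_ge0 ltW.
have P0 : 0 <= \prod_(i < k) md (x (iter i U w)) by apply: prodr_ge0 => i _; exact: md_ge0.
by apply/andP; split; apply: ler_pM => //; rewrite ?exprn_ge0// md_ge0.
Qed.

(** Polynomial functional calculus [p(T) h]. *)
Definition act (T : A -> A) (p : {poly R}) (h : A) : A :=
  \sum_(i < size p) (p`_i)%:C%C *: iter i T h.

Lemma act_wide T (p : {poly R}) h n : (size p <= n)%N ->
  act T p h = \sum_(i < n) (p`_i)%:C%C *: iter i T h.
Proof.
move=> sp; rewrite /act (big_ord_widen n (fun i => (p`_i)%:C%C *: iter i T h) sp).
rewrite big_mkcond; apply: eq_bigr => i _; case: ltnP => // h1.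
by rewrite nth_default// scale0r.
Qed.

Lemma act_add T (p q : {poly R}) h : act T (p + q) h = act T p h + act T q h.
Proof.
pose n := (size (p + q)%R + (size p + size q))%N.
rewrite !(@act_wide _ _ _ n) ?/n; try lia.
by rewrite -big_split; apply: eq_bigr => i _; rewrite coefD rmorphD scalerDl.
Qed.

Lemma act_C T (a : R) h : act T a%:P h = a%:C%C *: h.
Proof.
by rewrite (@act_wide _ _ _ 1) ?size_polyC_leq1// big_ord1 coefC.
Qed.

Lemma act_MX T (p : {poly R}) h : act T (p * 'X) h = act T p (T h).
Proof.
rewrite (@act_wide _ (p * 'X) _ (size p).+1) ?size_mulXn//; last first.
  by apply: leq_trans (size_polyMleq _ _) _; rewrite size_polyX addn2.
rewrite big_ord_recl coefMX /= scale0r add0r /act; apply: eq_bigr => i _.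
by rewrite coefMX /= -iterS iterSr.
Qed.

Lemma act_mul T (p q : {poly R}) h : lin T -> act T (p * q) h = act T p (act T q h).
Proof.
move=> l; elim/poly_ind: p q h => [|p c IH] q h.
  by rewrite mul0r /act size_poly0 !big_ord0.
rewrite mulrDl -mulrA act_add IH act_add act_MX act_C.
rewrite ['X * q]mulrC act_MX; congr (_ + _).
  congr act; rewrite /act (lin_sum l); apply: eq_bigr => i _.
  by rewrite (lin_scale l) -iterS iterSr.
have -> : c%:P * q = c *: q by rewrite mul_polyC.
rewrite (@act_wide _ _ _ (size q)) ?size_scale_leq// /act scaler_sumr.
by apply: eq_bigr => i _; rewrite coefZ rmorphM scalerA.
Qed.

Lemma act_XB1 T h : act T ('X - 1) h = T h - h.
Proof.
rewrite -polyC1 -rmorphN /= act_add act_C rmorphN rmorph1 scaleN1r.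
have -> : ('X : {poly R}) = 1%:P * 'X by rewrite mul1r.
by rewrite act_MX act_C rmorph1 scale1r.
Qed.

End Dynamics.

(** For [n > 1], [1 - 1/n] is the inverse of [1 + 1/(n - 1)], to which Bernoulli's inequality
    applies. *)
Lemma one_sub_inv_exp (R : realType) (n : nat) : (0 < n)%N ->
  (1 - n%:R^-1) ^+ n <= 2^-1 :> R.
Proof.
case: n => // n _; have [->|n0] := posnP n.
  by rewrite invr1 subrr expr1 invr_ge0.
have N0 : 0 < n%:R :> R by rewrite ltr0n.
have N1 : 0 < n.+1%:R :> R by rewrite ltr0n.
have E : (1 - n.+1%:R^-1 : R) = (1 + n%:R^-1)^-1.
  have -> : 1 + n%:R^-1 = n.+1%:R / n%:R :> R by rewrite -natr1; field; rewrite gt_eqF.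
  rewrite invf_div; apply: (mulIf (lt0r_neq0 N1)).
  by rewrite mulrBl mul1r mulVf ?gt_eqF// -mulrA mulVf ?gt_eqF// mulr1 -natr1 addrK.
rewrite E exprVn lef_pV2 ?posrE ?exprn_gt0 ?addr_gt0 ?invr_gt0//.
have h (k : nat) : 1 + k%:R * n%:R^-1 <= (1 + n%:R^-1) ^+ k :> R.
  elim: k => [|k IH]; first by rewrite mul0r addr0 expr0.
  rewrite exprS; have v0 : 0 < n%:R^-1 :> R by rewrite invr_gt0.
  have := ler_wpM2l (addr_ge0 ler01 (ltW v0)) IH; apply: le_trans.
  rewrite -natr1 mulrDl mul1r.
  have : 0 <= k%:R * n%:R^-1 * n%:R^-1 :> R by rewrite !mulr_ge0// ltW.
  set z := n%:R^-1; lra.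
apply: le_trans (h n.+1).
have -> : n.+1%:R / n%:R = 1 + n%:R^-1 :> R.
  by rewrite -[n.+1%:R]natr1 mulrDl mulfV ?mul1r ?gt_eqF.
have : 0 < n%:R^-1 :> R by rewrite invr_gt0.
set z := n%:R^-1; lra.
Qed.

(** * Failure of the dichotomy and windows of near-maximal weight *)

Section Dichotomy.
Variables (R : realType) (A : completeNormedModType (Cx R)).
Variables (mul : A -> A -> A) (one : A).
Hypothesis ba : is_comm_banach_alg mul one.
Local Notation chi := (is_character mul one).
Variables (U V : A -> A) (w : A) (beta : nat).
Hypothesis au : aut mul one U V.
Let B : R := 2 ^+ beta.
Hypothesis hB : forall x, chi x -> B^-1 <= md (x w) <= B.
Let T := wop mul w U.
Let wk := wn mul one w U.
Let nonper (s : A -> Cx R) := forall k, (0 < k)%N -> sh U k s <> s.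
Let D k s := md (sh V k s (wk k)).

Hypothesis dens : forall t (fs : seq A) (e : R), chi t -> 0 < e ->
  exists s, [/\ chi s, nonper s & forall f, f \in fs -> md (s f - t f) < e].

Definition dichotomy_at (N : nat) := forall t, chi t ->
  md (t (wn mul one w U N)) <= 1 / 2 \/ 2 <= md (sh V N t (wn mul one w U N)).

Let B0 : 0 < B. Proof. by rewrite exprn_gt0. Qed.
Let B1 : 1 <= B. Proof. by rewrite exprn_ege1// ler1n. Qed.

Let wk_bd k x : chi x -> B^-1 ^+ k <= md (x (wk k)) <= B ^+ k.
Proof. by move=> cx; exact: (ch_wn_bd _ au). Qed.

Let wk_gt0 k x : chi x -> 0 < md (x (wk k)).
Proof.
by move=> /(wk_bd k)/andP[h _]; rewrite (lt_le_trans _ h)// exprn_gt0// invr_gt0.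
Qed.

Let nonper_sh k s : chi s -> nonper s -> nonper (sh U k s).
Proof.
move=> cs ns j j0 h; apply: (ns j j0).
have := congr1 (sh V k) h.
by rewrite shD addnC -shD !(shK k _ (aut_sym au)).
Qed.

Let nonper_shV k s : chi s -> nonper s -> nonper (sh V k s).
Proof.
move=> cs ns j j0 h; apply: (ns j j0).
have := congr1 (sh U k) h.
by rewrite shD addnC -shD !(shK k _ au).
Qed.

(** Failure at [N] gives an orbit on which [e k = |w_k(x0)|] is below 2 at [N] and at most halves
    from [N] to [2 N]. Maximising [1 / e k], damped by [(1 + eta)^|k - N|], yields an index [ks]
    that no index at distance [d] beats by more than [(1 + eta)^d]. For [s = phi^(ks + k0) x0] one
    has [D k s = e (ks + k0) / e (ks + k0 - k)], so [k0] is nearly optimal. *)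
Lemma window_point (eta : R) (r k0 : nat) : 0 < eta -> (k0 <= r)%N ->
  (forall i, ~ dichotomy_at (2 ^ i)) ->
  exists s, [/\ chi s, nonper s & forall k, (k <= r)%N -> D k s <= (1 + eta) ^+ r * D k0 s].
Proof.
move=> eta0 k0r nd.
have q1 : 1 < 1 + eta by rewrite ltrDl.
have q0 : 0 < 1 + eta by rewrite (lt_trans ltr01).
(* At distance [N1] from the centre the damping outweighs all that weights can do within [r] steps
   of either end; so [ks] stays at least [r] away from 0 and from [2 N]. *)
have [N1 hN1] : exists N1 : nat, forall n, (N1 <= n)%N -> 2 * B ^+ r < (1 + eta) ^+ n.
  have [] := @geometric_small R (1 + eta)^-1 (2 * B ^+ r) 2^-1.
  - by rewrite invr_ge0 ltW.
  - by rewrite invf_lt1.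
  - by rewrite invr_gt0.
  move=> N h; exists N => n Nn; have := h n Nn.
  rewrite exprVn ler_pdivrMr ?exprn_gt0// => /le_lt_trans; apply.
  by rewrite gtr_pMl ?exprn_gt0// invf_lt1// ltr1n.
pose i := (N1 + r)%N; pose N := (2 ^ i)%N.
have NN : (N1 + r < N)%N by rewrite ltn_expl.
have [t [ct t1 t2]] : exists t, [/\ chi t, 1 / 2 < md (t (wk N)) & md (sh V N t (wk N)) < 2].
  apply: contrapT => H; apply: (nd i) => t ct.
  have [h|h] := leP (md (t (wk N))) (1 / 2); first by left.
  right; rewrite leNgt; apply/negP => h2; apply: H; by exists t.
clearbody N.
(* A perturbation below [e1] preserves both strict inequalities, so a nonperiodic point can replace
   [t]. *)
pose e1 : R := Num.min (md (t (wk N)) - 1 / 2) (2 - md (sh V N t (wk N))).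
have e10 : 0 < e1 by rewrite lt_min !subr_gt0 t1.
have [s1 [cs1 ns1 hs1]] := dens [:: wk N; iter N V (wk N)] ct e10.
have s11 : 1 / 2 < md (s1 (wk N)).
  have h1 := hs1 _ (mem_head _ _).
  have h2 : e1 <= md (t (wk N)) - 1 / 2 by rewrite ge_min lexx.
  have h3 := md_dist (t (wk N)) (s1 (wk N)); rewrite mdC in h3; lra.
pose x0 := sh V N s1.
have cx0 : chi x0 by exact: chi_sh (aut_sym au) cs1.
have x0N : sh U N x0 = s1 by rewrite /x0 (shK _ _ au).
have eN2 : md (x0 (wk N)) < 2.
  have h1 : md (s1 (iter N V (wk N)) - t (iter N V (wk N))) < e1 by apply: hs1; rewrite !inE eqxx orbT.
  have h2 : e1 <= 2 - md (t (iter N V (wk N))) by rewrite ge_min lexx orbT.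
  have h3 := md_dist (s1 (iter N V (wk N))) (t (iter N V (wk N))).
  rewrite /x0 /sh; lra.
pose e k := md (x0 (wk k)).
have e0 k : 0 < e k by exact: wk_gt0.
have eD a b : e (a + b)%N = e a * md (sh U a x0 (wk b)) by rewrite /e /wk (ch_wnD _ _ _ au cx0) mdM.
pose dist (a b : nat) := ((a - b) + (b - a))%N.
have [ks ks2N hmax] := @fin_max R (fun k => (e k)^-1 / (1 + eta) ^+ dist k N) (N + N).
have qp n : 0 < (1 + eta) ^+ n by rewrite exprn_gt0.
have hE k : (k <= N + N)%N -> (e k)^-1 <= (1 + eta) ^+ dist k ks * (e ks)^-1.
  move=> /hmax; rewrite ler_pdivrMr// => /le_trans; apply.
  have alg (a b c : R) : 0 < a -> 0 < b -> c * a^-1 = a^-1 / b * (c * b).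
    by move=> a0 b0; field; rewrite !gt_eqF.
  rewrite (alg _ _ _ (e0 ks) (qp (dist ks N))).
  rewrite -exprD ler_wpM2l ?mulr_ge0 ?invr_ge0 ?(ltW (e0 _)) ?(ltW (qp _))//.
  by rewrite ler_weXn2l ?(ltW q1)// /dist; clear; lia.
have hN : (1 + eta) ^+ dist ks N * e ks <= e N.
  have := hmax N (leq_addr _ _); rewrite /dist subnn addn0 expr0 divr1.
  rewrite -/(dist ks N) ler_pdivlMr// => h.
  by rewrite -ler_pdivlMr// -ler_pdivrMl.
have ks_ge : (r <= ks)%N.
  rewrite leqNgt; apply/negP => kr.
  have : 2 * B ^+ r < (1 + eta) ^+ dist ks N by apply: hN1; rewrite /dist; clear -NN kr; lia.
  have /andP[h1 _] := wk_bd ks cx0.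
  have h2 : B^-1 ^+ r <= e ks.
    by apply: le_trans h1; rewrite ler_wiXn2l ?invr_ge0 ?(ltW B0) ?invf_le1// ltnW.
  apply/negP; rewrite -leNgt; rewrite exprVn -div1r ler_pdivrMr ?exprn_gt0// in h2.
  have p : 0 < e ks * B ^+ r by rewrite mulr_gt0// exprn_gt0.
  have h3 : (1 + eta) ^+ dist ks N * e ks <= 2 by rewrite (le_trans hN)// ltW.
  have b0 : 0 < B ^+ r by rewrite exprn_gt0.
  move: h3 h2 (e0 ks) b0 (qp (dist ks N)); set Q := _ ^+ dist _ _; set b := B ^+ r; set z := e ks.
  move=> h3 h2 z0 b0 Q0; have := ler_wpM2l (ltW Q0) h2; have := ler_wpM2r (ltW b0) h3; lra.
have ks_le : (ks + r <= N + N)%N.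
  rewrite leqNgt; apply/negP => kr.
  have : 2 * B ^+ r < (1 + eta) ^+ dist ks N by apply: hN1; rewrite /dist; clear -NN kr; lia.
  have E2 : e (N + N)%N = e N * md (s1 (wk N)) by rewrite eD x0N.
  have E3 := eD ks (N + N - ks)%N; rewrite subnKC// E2 in E3.
  have cks : chi (sh U ks x0) by exact: chi_sh au cx0.
  have /andP[_ h1] := wk_bd (N + N - ks)%N cks.
  have h2 : md (sh U ks x0 (wk (N + N - ks)%N)) <= B ^+ r.
    by apply: le_trans h1 _; rewrite ler_weXn2l//; clear -kr; lia.
  apply/negP; rewrite -leNgt.
  have b0 : 0 < B ^+ r by rewrite exprn_gt0.
  move: hN E3 h2 s11 (e0 ks) (e0 N) b0 (qp (dist ks N)).
  set Q := _ ^+ dist _ _; set b := B ^+ r; set z := e ks; set y := e N.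
  set a := md (s1 _); set f := md (sh _ _ _ _) => h3 E3 h2 s11' z0 y0 b0 Q0.
  have k1 : y * (1 / 2) <= y * a by rewrite ler_wpM2l// ltW.
  have k2 : z * f <= z * b by rewrite ler_wpM2l// ltW.
  have k3 : Q * z <= 2 * b * z by lra.
  by rewrite ler_pM2r in k3.
exists (sh U (ks + k0) x0); split.
- exact: chi_sh au cx0.
- by apply: nonper_sh => //; apply: nonper_shV.
have Dk k : (k <= r)%N -> D k (sh U (ks + k0) x0) = e (ks + k0)%N * (e (ks + k0 - k)%N)^-1.
  move=> kr; rewrite /D.
  have -> : sh V k (sh U (ks + k0) x0) = sh U (ks + k0 - k) x0.
    have {1}-> : (ks + k0 = k + (ks + k0 - k))%N by clear -kr ks_ge; lia.
    by rewrite -shD (shK k _ (aut_sym au)).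
  have {2}-> : (ks + k0 = (ks + k0 - k) + k)%N by clear -kr ks_ge; lia.
  by rewrite eD mulrAC mulfV ?mul1r ?gt_eqF.
move=> k kr; rewrite !Dk// addnK mulrCA ler_pM2l//.
apply: le_trans (hE _ _) _; first by clear -k0r ks_le; lia.
apply: ler_wpM2r; first by rewrite invr_ge0 ltW.
apply: ler_weXn2l; first exact: ltW.
rewrite /dist; clear -k0r kr ks_ge; lia.
Qed.

End Dichotomy.

(** * Descent: halving the norm of a peaking function *)

Section Descent.
Variables (R : realType) (A : completeNormedModType (Cx R)).
Variables (mul : A -> A -> A) (one : A).
Hypothesis ba : is_comm_banach_alg mul one.
Local Notation chi := (is_character mul one).
Variables (U V : A -> A) (w : A) (beta : nat).
Hypothesis au : aut mul one U V.
Let B : R := 2 ^+ beta.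
Hypothesis hB : forall x, chi x -> B^-1 <= md (x w) <= B.
Let T := wop mul w U.
Let wk := wn mul one w U.
Let nonper (s : A -> Cx R) := forall k, (0 < k)%N -> sh U k s <> s.
Let D k s := md (sh V k s (wk k)).

Let B0 : 0 < B. Proof. by rewrite exprn_gt0. Qed.
Let B1 : 1 <= B. Proof. by rewrite exprn_ege1// ler1n. Qed.

Let wk_bd k x : chi x -> B^-1 ^+ k <= md (x (wk k)) <= B ^+ k.
Proof. by move=> cx; exact: (ch_wn_bd _ au). Qed.

Let D_bd k x : chi x -> B^-1 ^+ k <= D k x <= B ^+ k.
Proof. by move=> cx; apply: wk_bd; exact: chi_sh (aut_sym au) cx. Qed.

Let D_gt0 k x : chi x -> 0 < D k x.
Proof.
by move=> /(D_bd k)/andP[h _]; rewrite (lt_le_trans _ h)// exprn_gt0// invr_gt0.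
Qed.

Definition basic_nbhd (fs : seq A) (e : R) (s x : A -> Cx R) :=
  forall f, f \in fs -> md (x f - s f) < e.

(** The neighbourhood is cut out by functions separating [s] from [phi^k s], by their translates
    under [U^k], which test [phi^k x], and by [V^k w_k], whose modulus at [x] is [D k x]. *)
Lemma isolating_nbhd (r : nat) (tau : R) s : chi s -> nonper s -> 0 < tau ->
  exists fs, exists2 e, 0 < e &
    (forall x, chi x -> basic_nbhd fs e s x -> forall k, (0 < k <= r)%N ->
       ~ basic_nbhd fs e s (sh U k x)) /\
    (forall x, chi x -> basic_nbhd fs e s x -> forall k, (k <= r)%N ->
       (1 - tau) * D k s <= D k x <= (1 + tau) * D k s).
Proof.
move=> cs ns t0.
have sep k : exists f, (0 < k)%N -> sh U k s f != s f.
  have [->|k0] := posnP k; first by exists 0.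
  apply: contrapT => H; apply: (ns k k0); apply/funext => f; apply: contrapT => h.
  by apply: H; exists f => _; apply/eqP.
have [f hf] := choice sep.
pose d k : R := if k is 0%N then 1 else md (sh U k s (f k) - s (f k)) / 2.
have [|e1 e10 h1] := @fin_pos_lb R d r.
  by case=> [|k] _; rewrite /d// divr_gt0// md_gt0 subr_eq0 hf.
have [|e2 e20 h2] := @fin_pos_lb R (fun k => tau * D k s) r.
  by move=> k _; rewrite mulr_gt0// D_gt0.
pose e : R := Num.min e1 e2.
have e0 : 0 < e by rewrite lt_min e10.
have ee1 : e <= e1 by rewrite ge_min lexx.
have ee2 : e <= e2 by rewrite ge_min lexx orbT.
pose l1 := [seq f k | k <- iota 0 r.+1].
pose l2 := [seq iter k U (f k) | k <- iota 0 r.+1].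
pose l3 := [seq iter k V (wk k) | k <- iota 0 r.+1].
exists (l1 ++ l2 ++ l3), e => //.
have m0 k : (k <= r)%N -> k \in iota 0 r.+1 by move=> kr; rewrite mem_iota add0n.
split=> x cx hx k kr.
  move=> hk; case/andP: kr => k0 kr.
  have a1 : md (sh U k x (f k) - s (f k)) < e.
    by apply: hk; rewrite mem_cat map_f ?m0.
  have a2 : md (x (iter k U (f k)) - s (iter k U (f k))) < e.
    by apply: hx; rewrite !mem_cat (map_f (fun k => iter k U (f k))) ?m0 ?orbT.
  have := h1 k kr; rewrite /d; case: k k0 kr hk a1 a2 => // k _ kr _ a1 a2 a3.
  have := mdD (sh U k.+1 s (f k.+1) - sh U k.+1 x (f k.+1)) (sh U k.+1 x (f k.+1) - s (f k.+1)).
  rewrite addrA subrK (mdC (sh U k.+1 s _)); move: a1 a2 a3; rewrite /sh.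
  move=> a1 a2 a3 a4; have : (0 : R) < 0 by lra.
  by rewrite ltxx.
have a1 : md (x (iter k V (wk k)) - s (iter k V (wk k))) < e.
  by apply: hx; rewrite !mem_cat (map_f (fun k => iter k V (wk k))) ?m0 ?orbT.
have a2 := h2 k kr; have a3 := md_dist (x (iter k V (wk k))) (s (iter k V (wk k))).
have a4 := md_dist (s (iter k V (wk k))) (x (iter k V (wk k))); rewrite mdC in a4.
by rewrite /D /sh in a2 *; apply/andP; split; lra.
Qed.

Variable nu : A -> R.
Variables C c : R.
Hypotheses (nu_ge0 : forall f, 0 <= nu f)
  (nuD : forall f g, nu (f + g) <= nu f + nu g)
  (nuZ : forall a f, nu (a *: f) = md a * nu f)
  (nu_ev : forall x f, chi x -> md (x f) <= nu f)
  (C0 : 0 <= C)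
  (nu_prod : forall (p : nat) (f : nat -> A) (S : R), (0 < p)%N ->
     (forall x, chi x -> forall j : 'I_p, \prod_(i < p | i != j) md (x (f i)) <= S) ->
     nu (\big[mul/one]_(i < p) f i) <= C * (S * \sum_(i < p) nu (f i)))
  (c0 : 0 < c) (nu_low : forall g, c * nu g <= nu (T g - g)).

Let nu_sum (I : Type) (l : seq I) (F : I -> A) :
  nu (\sum_(i <- l) F i) <= \sum_(i <- l) nu (F i).
Proof.
have n0 : nu 0 = 0 by have := nuZ 0 0; rewrite scale0r md0 mul0r.
elim/big_rec2: _ => [|i y x _ h]; first by rewrite n0.
by rewrite (le_trans (nuD _ _))// lerD2l.
Qed.

Lemma nu_act (S : A -> A) (p P : {poly R}) h n (Y : R) : (size p <= n)%N -> maj p P ->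
  0 <= Y -> (forall k, (k < n)%N -> nu (iter k S h) <= Y) -> nu (act S p h) <= P.[1] * Y.
Proof.
move=> sp mp Y0 hY; rewrite (act_wide _ _ sp); apply: le_trans (nu_sum _ _) _.
apply: (@le_trans _ _ ((\sum_(i < n) `|p`_i|) * Y)).
  rewrite mulr_suml; apply: ler_sum => i _; rewrite nuZ md_real ler_wpM2l//.
  by apply: hY.
by rewrite ler_wpM2r// maj_sum.
Qed.

Lemma nu_low_iter k g : c ^+ k * nu g <= nu (act T (('X - 1) ^+ k) g).
Proof.
have lT : lin T := wop_lin ba w (aut_lin au).
elim: k => [|k IH]; first by rewrite !expr0 mul1r -polyC1 act_C rmorph1 scale1r.
rewrite !exprS (act_mul _ _ _ lT) act_XB1 -mulrA.
by apply: le_trans (nu_low _); rewrite ler_pM2l.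
Qed.

Lemma nu_pow p f (F : R) : (0 < p)%N -> 0 <= F -> (forall x, chi x -> md (x f) <= F) ->
  nu (\big[mul/one]_(i < p) f) <= C * (F ^+ p.-1 * (p%:R * nu f)).
Proof.
move=> p0 F0 hF; have := @nu_prod p (fun=> f) (F ^+ p.-1) p0.
rewrite sumr_const card_ord -[nu f *+ p]mulr_natl; apply=> x cx j.
apply: (@le_trans _ _ (\prod_(i < p | i != j) F)).
  by apply: ler_prod => i _; rewrite md_ge0 hF.
by rewrite prodr_const cardC1 card_ord.
Qed.

(** [T^k (h h)] is the product of two copies of [U^k h] and the [k] factors of [w_k]. Whichever
    factor is omitted, a copy of [U^k h] remains, so [Q] applies; omitting a factor of [w_k] costs
    [B]. *)
Lemma nu_iter_sq k h (Q Gk : R) : 0 <= Q ->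
  (forall x, chi x -> md (x h) <= 1) ->
  (forall x, chi x -> md (x (wk k)) * md (sh U k x h) <= Q) ->
  (forall i, (i <= k)%N -> forall f, nu (iter i U f) <= Gk * nu f) -> 0 <= Gk ->
  nu (iter k T (mul h h)) <= C * (B * Q * (Gk * (2 * nu h + k%:R * nu w))).
Proof.
move=> Q0 h1 hQ hG Gk0.
pose F i := if (i < 2)%N then iter k U h else iter (i - 2) U w.
have -> : iter k T (mul h h) = \big[mul/one]_(i < k.+2) F i.
  rewrite !big_ord_recl /= /T (iter_wop ba _ _ _ au) (aut_mul (aut_iter k au)).
  rewrite {1 2}/F /= [RHS](ba_mulA ba) [RHS](ba_mulC ba) /wn; congr (mul _ _).
  by apply: eq_bigr => i _; rewrite /F /= subSS subn1.
apply: le_trans (nu_prod (S := B * Q) _ _) _ => //; last first.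
  rewrite ler_wpM2l// ler_wpM2l ?mulr_ge0 ?(ltW B0)//.
  rewrite !big_ord_recl /= {1 2}/F /= addrA mulrDr lerD//.
    have := hG k (leqnn k) h; rewrite mulrCA; lra.
  rewrite mulr_natl -[X in _ *+ X]card_ord -sumr_const mulr_sumr.
  apply: ler_sum => i _; rewrite /F /= subSS subn1 /=; apply: hG.
  by rewrite add0n ltnW.
move=> x cx j.
have P1 : \prod_(i < k) md (x (F i.+2)) = md (x (wk k)).
  rewrite /wk (ch_wn _ _ _ cx) md_prod; apply: eq_bigr => i _.
  by rewrite /F /= subSS subn1.
have hk : md (x (iter k U h)) <= 1 by apply: (h1 (sh U k x)); exact: chi_sh au cx.
have hq := hQ x cx; rewrite /sh in hq.
have BQ : Q <= B * Q by rewrite ler_peMl.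
case: j => -[|[|j]] hj.
- rewrite big_mkcond /= !big_ord_recl /= mul1r P1.
  by rewrite /F /= mulrC (le_trans hq).
- rewrite big_mkcond /= !big_ord_recl /= mul1r P1.
  by rewrite /F /= mulrC (le_trans hq).
- set jj := Ordinal hj.
  have tot : \prod_(i < k.+2) md (x (F i)) = md (x (iter k U h)) * (md (x (iter k U h)) * md (x (wk k))).
    by rewrite !big_ord_recl /= P1.
  have /andP[bj _] := hB (chi_sh j au cx).
  have Fj : F jj = iter j U w by rewrite /F /= subSS subn1.
  rewrite (bigD1 jj)//= Fj in tot.
  have pos : 0 <= \prod_(i < k.+2 | i != jj) md (x (F i)).
    by apply: prodr_ge0 => i _; exact: md_ge0.
  have k1 : B^-1 * \prod_(i < k.+2 | i != jj) md (x (F i)) <= Q.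
    apply: le_trans (ler_wpM2r pos bj) _; rewrite tot.
    by apply: le_trans hq; rewrite [leRHS]mulrC ler_piMl ?mulr_ge0 ?md_ge0.
  by rewrite ler_pdivrMl in k1.
Qed.

Let rn (m n : nat) := (m.+2 * n)%N.

Lemma coef_ker_bd m n K k : (K <= rn m n)%N -> (k <= rn m n)%N ->
  0 <= (ker m n (K%:R : R))`_k <= (rn m n)%:R ^+ 2 * (geo R n ^+ m.+2)`_k.
Proof.
move=> KR kR; rewrite coef_ker -/(rn m n); have g0 := geo_exp_ge0 R m.+2 n k.
have h : (k%:R - K%:R) ^+ 2 <= (rn m n)%:R ^+ 2 :> R.
  have a1 : k%:R <= (rn m n)%:R :> R by rewrite ler_nat.
  have a2 : K%:R <= (rn m n)%:R :> R by rewrite ler_nat.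
  have a3 : 0 <= k%:R :> R by rewrite ler0n.
  have a4 : 0 <= K%:R :> R by rewrite ler0n.
  rewrite -subr_ge0 subr_sqr mulr_ge0//; lra.
rewrite mulr_ge0 ?subr_ge0//= mulrC ler_wpM2r// lerBlDr lerDl sqr_ge0//.
Qed.

(** Only the term of index [k] may see [h] at a large value; each other term carries [tau^2], and
    the coefficients sum to at most [r^2 n^(m + 2)]. *)
Lemma kernel_approx (m n K k : nat) h x (tau : R) : chi x -> (K <= rn m n)%N ->
  (k <= rn m n)%N -> 0 <= tau ->
  (forall j, (j <= rn m n)%N -> j != k -> md (sh U j x h) <= tau) ->
  md (x (act T (ker m n K%:R) (mul h h)) -
      ((ker m n K%:R)`_k)%:C%C * (x (wk k) * sh U k x h ^+ 2))
  <= (rn m n)%:R ^+ 2 * n%:R ^+ m.+2 * B ^+ rn m n * tau ^+ 2.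
Proof.
move=> cx KR kR t0 hj; set r := rn m n in KR kR hj *.
rewrite (act_wide _ _ (size_ker m n K%:R)) -/r (ch_sum _ _ _ cx).
have E j : x (((ker m n K%:R)`_j)%:C%C *: iter j T (mul h h)) =
   ((ker m n K%:R)`_j)%:C%C * (x (wk j) * sh U j x h ^+ 2).
  rewrite (chZ _ _ cx) /T (ch_wop ba _ _ _ au cx) -/(wk j); congr (_ * (_ * _)).
  by rewrite (chM _ _ (chi_sh j au cx)) expr2.
rewrite (eq_bigr _ (fun (i : 'I_r.+1) _ => E i)).
rewrite (bigD1 (Ordinal (kR : (k < r.+1)%N)))//= addrAC subrr add0r.
apply: le_trans (md_sum _ _ _) _.
have t2 : 0 <= B ^+ r * tau ^+ 2 by rewrite mulr_ge0 ?exprn_ge0// ltW.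
apply: (@le_trans _ _ (\sum_(i < r.+1) r%:R ^+ 2 * (geo R n ^+ m.+2)`_i * (B ^+ r * tau ^+ 2))).
  rewrite big_mkcond /=; apply: ler_sum => i _.
  have g0 := geo_exp_ge0 R m.+2 n i.
  case: ifP => [ik|_]; last by rewrite mulr_ge0// mulr_ge0// exprn_ge0.
  have ir : (i <= r)%N by rewrite -ltnS.
  have /andP[q0 q1] := coef_ker_bd KR ir.
  rewrite mdM mdM md_real ger0_norm// mdX.
  have /andP[_ b1] := wk_bd i cx.
  apply: ler_pM => //; first by rewrite mulr_ge0 ?exprn_ge0 ?md_ge0.
  apply: ler_pM; rewrite ?exprn_ge0 ?md_ge0//.
    by apply: le_trans b1 _; rewrite ler_weXn2l.
  by rewrite lerXn2r ?nnegrE ?md_ge0// hj.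
rewrite -mulr_suml -mulr_sumr.
have sz : (size (geo R n ^+ m.+2) <= r.+1)%N by exact: size_geo_exp.
by rewrite -(horner1_sum sz) horner_exp horner1_geo -!mulrA.
Qed.

Hypothesis amax : forall f, exists2 x, chi x & forall y, chi y -> md (y f) <= md (x f).
Hypothesis peak : forall s fs (e tau : R), chi s -> 0 < e -> 0 < tau -> tau <= 1 ->
  exists h, [/\ s h = 1, forall x, chi x -> md (x h) <= 1 + tau
    & forall x, chi x -> ~ basic_nbhd fs e s x -> md (x h) <= tau].

(** The class preserved by the descent: sup norm 1 keeps [nu h] at least 1, and smallness off the
    neighbourhood is what the next step consumes. *)
Let Cls (fs : seq A) (e tau : R) s h :=
  [/\ forall x, chi x -> md (x h) <= 1, exists2 x, chi x & md (x h) = 1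
    & forall x, chi x -> ~ basic_nbhd fs e s x -> md (x h) <= tau].

Let Cls_init fs e tau s : chi s -> 0 < e -> 0 < tau -> tau <= 1 -> exists h, Cls fs e tau s h.
Proof.
move=> cs e0 t0 t1; have [h [h1 h2 h3]] := peak fs cs e0 t0 t1.
have [x cx hx] := amax h.
have F1 : 1 <= md (x h) by have := hx s cs; rewrite h1 md1.
have F0 : 0 < md (x h) by rewrite (lt_le_trans ltr01).
exists ((md (x h))^-1%:C%C *: h).
have E y : chi y -> md (y ((md (x h))^-1%:C%C *: h)) = md (y h) / md (x h).
  by move=> cy; rewrite (chZ _ _ cy) mdM md_real ger0_norm ?invr_ge0 ?(ltW F0)// mulrC.
split.
- by move=> y cy; rewrite E// ler_pdivrMr// mul1r hx.
- by exists x => //; rewrite E// mulfV// gt_eqF.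
- move=> y cy /(h3 y cy) hy; rewrite E// ler_pdivrMr//.
  by apply: le_trans hy _; rewrite ler_peMr// ltW.
Qed.

Let Cls_nu fs e tau s h : Cls fs e tau s h -> 1 <= nu h.
Proof. by move=> [_ [x cx <-] _]; exact: nu_ev. Qed.

Section Step.
Variables (m n k0 : nat) (e G : R) (s : A -> Cx R).
Hypotheses (n1 : (1 < n)%N) (e0 : 0 < e) (G1 : 1 <= G)
  (gU : forall k f, nu (iter k U f) <= G * (1 + e) ^+ k * nu f)
  (gV : forall k f, nu (iter k V f) <= G * (1 + e) ^+ k * nu f).
Let r := rn m n.
Hypotheses (k0r : (k0 <= r)%N)
  (hk0 : n%:R ^+ m.+2 <= r.+1%:R * (geo R n ^+ m.+2)`_k0)
  (cs : chi s)
  (hD : forall k, (k <= r)%N -> D k s <= (1 + e) ^+ r * D k0 s).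
Let cc k := (geo R n ^+ m.+2)`_k.
Let rho : R := r%:R ^+ 2.
(** With [b = B^r] and [z = 2^r] this gives [tau b^2 z^4 = 1], enough to absorb the weights and the
    polynomial factors below. *)
Let j := ((2 * beta + 4) * r)%N.
Let tau : R := (2 ^+ j)^-1.
(** Off the neighbourhood the translate of [f] stays below [1 - 1 / (4 r^2)] of its sup; the power
    [4 r^2] brings this below 1/2, and the further power [j] below [tau]. *)
Let p := (4 * r ^ 2 * j)%N.
Let q : R := (1 + e) ^+ r.
Let sg : R := rho * n%:R ^+ m.+2 * B ^+ r * tau ^+ 2.
Variable K : nat.
Hypotheses (KR : (K <= r)%N) (hK : forall k, (k <= r)%N -> cc k * D k s <= cc K * D K s).
Let v : R := cc K * D K s.

Let r4 : (4 <= r)%N.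
Proof. by rewrite /r /rn; clear -n1; nia. Qed.

Let rho1 : 1 <= rho.
Proof. by rewrite /rho exprn_ege1// ler1n; clear -r4; lia. Qed.

Let tau0 : 0 < tau. Proof. by rewrite invr_gt0 exprn_gt0. Qed.

Let z : R := 2 ^+ r.
Let b : R := B ^+ r.

Let tauE : tau * (b ^+ 2 * z ^+ 4) = 1.
Proof.
rewrite /tau /b /z /B -!exprM -exprD; rewrite (_ : (_ + _ = j)%N); last by rewrite /j; ring.
by rewrite mulVf// gt_eqF// exprn_gt0.
Qed.

Let b1 : 1 <= b. Proof. by rewrite /b exprn_ege1. Qed.
Let z16 : 16 <= z.
Proof.
rewrite /z (_ : 16 = 2 ^+ 4 :> R); last by rewrite -natrX.
by rewrite ler_weXn2l// ler1n.
Qed.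
Let rz : r.+1%:R <= z. Proof. by rewrite /z -natrX ler_nat ltn_expl. Qed.
Let r0' : 0 <= r%:R :> R. Proof. exact: ler0n. Qed.
Let rhoz : rho <= z ^+ 2.
Proof.
have h : r%:R <= z by apply: le_trans rz; rewrite ler_nat.
by rewrite /rho lerXn2r ?nnegrE// (le_trans r0' h).
Qed.

Let tau_rho : tau * rho <= 64^-1.
Proof.
have h1 : 64 * rho <= b ^+ 2 * z ^+ 4.
  apply: (@le_trans _ _ (1 * z ^+ 4)); last first.
    by rewrite ler_wpM2r ?exprn_ge0 ?(le_trans _ z16)// exprn_ege1.
  rewrite mul1r (_ : z ^+ 4 = z ^+ 2 * z ^+ 2); last by rewrite -exprD.
  have h2 : 64 <= z ^+ 2.
    by apply: (@le_trans _ _ (16 ^+ 2)); [rewrite -natrX ler_nat|rewrite lerXn2r ?nnegrE// (le_trans _ z16)].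
  by rewrite ler_pM// ?(le_trans ler01)//.
have := ler_wpM2l (ltW tau0) h1; rewrite tauE; lra.
Qed.

Let tau1 : tau <= 64^-1.
Proof. by have := ler_wpM2l (ltW tau0) rho1; have := tau_rho; lra. Qed.

Let Dk0 : 0 < D k0 s. Proof. exact: D_gt0. Qed.

Let b_D k x : chi x -> (k <= r)%N -> b^-1 <= D k x.
Proof.
move=> cx kr; have /andP[h _] := D_bd k cx; apply: le_trans h.
by rewrite /b -exprVn ler_wiXn2l ?invr_ge0 ?(ltW B0)// invf_le1.
Qed.

Let cc0 k : 0 <= cc k. Proof. exact: geo_exp_ge0. Qed.

Let nm0 : 0 < n%:R ^+ m.+2 :> R.
Proof. by rewrite exprn_gt0// ltr0n ltnW. Qed.

(** Two maxima meet here: [k0] maximises the coefficients alone, [K] their products with the weights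
    [D k s]. *)
Let v_ge : n%:R ^+ m.+2 * D k0 s <= r.+1%:R * v.
Proof.
apply: le_trans (ler_wpM2r (ltW Dk0) hk0) _; rewrite -mulrA ler_wpM2l//.
exact: hK.
Qed.

Let v0 : 0 < v.
Proof.
have : 0 < r.+1%:R * v by rewrite (lt_le_trans _ v_ge)// mulr_gt0.
by rewrite pmulr_rgt0// ltr0n.
Qed.

Let sg0 : 0 <= sg.
Proof.
have t2 : 0 <= tau ^+ 2 by rewrite exprn_ge0// ltW.
have b0 : 0 <= B ^+ r by rewrite exprn_ge0// ltW.
exact: mulr_ge0 (mulr_ge0 (mulr_ge0 (le_trans ler01 rho1) (ltW nm0)) b0) t2.
Qed.

(** Of [tau^2 = b^-4 z^-8] only [b^2 z^3] is spent, on [rho <= z^2], [n^(m + 2) <= z v b] and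
    [B^r = b]. *)
Let sg_v : sg <= v / 16.
Proof.
have h1 : n%:R ^+ m.+2 <= z * v * b.
  have h : n%:R ^+ m.+2 * b^-1 <= z * v.
    apply: (@le_trans _ _ (n%:R ^+ m.+2 * D k0 s)); first by rewrite ler_pM2l// b_D.
    by apply: le_trans v_ge _; rewrite ler_wpM2r// ltW.
  by rewrite -ler_pdivrMr// (lt_le_trans ltr01).
have zz : 0 <= z by rewrite (le_trans _ z16).
have bb : 0 <= b by rewrite (le_trans _ b1).
have h2 : sg <= z ^+ 2 * (z * v * b) * b * tau ^+ 2.
  rewrite /sg -/b ler_wpM2r ?exprn_ge0 ?(ltW tau0)// ler_wpM2r//.
  by rewrite ler_pM// ?(le_trans ler01)//.
apply: le_trans h2 _.
have -> : v / 16 = v / 16 * (tau * (b ^+ 2 * z ^+ 4)) ^+ 2 by rewrite tauE expr1n mulr1.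
have -> : z ^+ 2 * (z * v * b) * b * tau ^+ 2 = (v * tau ^+ 2 * b ^+ 2 * z ^+ 3) * 1 by ring.
have -> : v / 16 * (tau * (b ^+ 2 * z ^+ 4)) ^+ 2 =
    (v * tau ^+ 2 * b ^+ 2 * z ^+ 3) * (b ^+ 2 * (z ^+ 4 * (z / 16))) by field.
have vt : 0 <= v * tau ^+ 2 * b ^+ 2 * z ^+ 3.
  by rewrite mulr_ge0 ?exprn_ge0// mulr_ge0 ?exprn_ge0// mulr_ge0 ?(ltW v0)// exprn_ge0// ltW.
apply: (ler_wpM2l vt); apply: mulr_ege1; first by rewrite exprn_ege1.
apply: mulr_ege1; first by rewrite exprn_ege1// (le_trans _ z16)// ler1n.
by rewrite ler_pdivlMr// mul1r.
Qed.

Let rho16 : 16 <= rho.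
Proof.
have h : 4 <= r%:R :> R by rewrite ler_nat.
have -> : 16 = 4 ^+ 2 :> R by rewrite -natrX.
by rewrite /rho lerXn2r ?nnegrE// (le_trans _ h).
Qed.

Variables (fs : seq A) (e1 : R).
Let Vn := basic_nbhd fs e1 s.
Hypotheses (hi : forall x, chi x -> Vn x -> forall k, (0 < k <= r)%N -> ~ Vn (sh U k x))
  (hii : forall x, chi x -> Vn x -> forall k, (k <= r)%N ->
       (1 - tau) * D k s <= D k x <= (1 + tau) * D k s).

Let uniqV x a d : chi x -> (a < d <= r)%N -> Vn (sh U a x) -> ~ Vn (sh U d x).
Proof.
move=> cx /andP[ad dr] Va.
have := @hi (sh U a x) (chi_sh a au cx) Va (d - a)%N.
rewrite shD subnK ?(ltnW ad)//; apply.
by rewrite subn_gt0 ad (leq_trans (leq_subr _ _)).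
Qed.

Variable h : A.
Hypothesis hh : Cls fs e1 tau s h.
Let f := act T (ker m n K%:R) (mul h h).

Let h_le1 x : chi x -> md (x h) <= 1. Proof. by case: hh => a _ _; exact: a. Qed.
Let h_off x : chi x -> ~ Vn x -> md (x h) <= tau. Proof. by case: hh => _ _; apply. Qed.

(** Seen from [phi^-K y], the term of index [K] meets [h] at its peak with the full weight [rho]. *)
Let lower y : chi y -> md (y h) = 1 -> rho * v * (1 - tau) - sg <= md (sh V K y f).
Proof.
move=> cy yh.
have Vy : Vn y.
  apply: contrapT => nV; have := h_off cy nV; rewrite yh leNgt => /negP; apply.
  by rewrite (le_lt_trans tau1)// invf_lt1// ltr1n.
pose x := sh V K y.
have cx : chi x by exact: chi_sh (aut_sym au) cy.
have xK : sh U K x = y by rewrite /x (shK _ _ au).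
have oth i : (i <= r)%N -> i != K -> md (sh U i x h) <= tau.
  move=> ir iK; apply: h_off; first exact: chi_sh au cx.
  move: iK; rewrite neq_ltn => /orP[iK|iK] Vi.
    by apply: (@uniqV x i K cx) Vi _; rewrite ?iK// xK.
  by apply: (@uniqV x K i cx) Vi; rewrite ?iK// xK.
have := @kernel_approx m n K K h x tau cx KR KR (ltW tau0) oth.
rewrite -/r -/rho -/sg -/f -/x xK coef_ker -/(rn m n) -/r -/rho -/(cc K) subrr expr0n /= subr0.
have /andP[d1 _] := hii cy Vy KR.
set mn := _ * _ => h1.
have -> : md (x f) = md (mn - (mn - x f)) by rewrite opprB addrC subrK.
apply: le_trans (md_dist _ _); rewrite (mdC mn).
have -> : md mn = cc K * rho * D K y.
  rewrite /mn mdM mdM md_real ger0_norm ?mulr_ge0 ?(le_trans ler01 rho1)// mdX yh expr1n mulr1.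
  by [].
have h2 : cc K * rho * ((1 - tau) * D K s) <= cc K * rho * D K y.
  by rewrite ler_wpM2l// mulr_ge0// (le_trans ler01 rho1).
have h3 : cc K * rho * ((1 - tau) * D K s) = rho * v * (1 - tau) by rewrite /v; ring.
by rewrite h3 in h2; lra.
Qed.

Let cc_le k : (k <= r)%N -> cc k <= n%:R ^+ m.+2.
Proof.
move=> kr; rewrite -[n%:R]horner1_geo -horner_exp (horner1_sum (size_geo_exp R m.+2 n)).
rewrite (bigD1 (Ordinal (kr : (k < r.+1)%N)))//= lerDl sumr_ge0// => i _.
Qed.

(** If the orbit segment from [phi^-K y] meets the neighbourhood, it does so at some [k != K], with
    weight at most [rho - 1]. By maximality of [v] this loses [v], of which [tau] and [sg] give back
    at most [v / 64] and [v / 16]. *)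
Let upper y : chi y -> ~ Vn y -> md (sh V K y f) <= rho * v - 59 / 64 * v.
Proof.
move=> cy nVy; pose x := sh V K y.
have cx : chi x by exact: chi_sh (aut_sym au) cy.
have xK : sh U K x = y by rewrite /x (shK _ _ au).
have rv : 16 * v <= rho * v by rewrite ler_pM2r.
have [[k [kr Vk]]|nV] := pselect (exists k, (k <= r)%N /\ Vn (sh U k x)).
  have kK : k != K by apply/eqP => kK; apply: nVy; rewrite -xK -kK.
  have oth i : (i <= r)%N -> i != k -> md (sh U i x h) <= tau.
    move=> ir ik; apply: h_off; first exact: chi_sh au cx.
    move: ik; rewrite neq_ltn => /orP[ik|ik] Vi.
      by apply: (@uniqV x i k cx) Vi Vk; rewrite ik.
    by apply: (@uniqV x k i cx) Vk Vi; rewrite ik.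
  have := @kernel_approx m n K k h x tau cx KR kr (ltW tau0) oth.
  rewrite -/r -/rho -/sg -/f -/x => h1.
  have /andP[q0 _] := coef_ker_bd KR kr.
  have := md_dist (x f) (((ker m n K%:R)`_k)%:C%C * (x (wk k) * sh U k x h ^+ 2)).
  rewrite mdM mdM md_real ger0_norm// mdX => h2.
  have ck : chi (sh U k x) by exact: chi_sh au cx.
  have xk : md (x (wk k)) = D k (sh U k x) by rewrite /D (shK _ _ (aut_sym au)).
  have /andP[_ d2] := hii ck Vk kr.
  have h3 : md (x (wk k)) * md (sh U k x h) ^+ 2 <= (1 + tau) * D k s.
    rewrite xk -[leRHS]mulr1 ler_pM ?md_ge0 ?exprn_ge0 ?md_ge0//.
    by rewrite exprn_ile1 ?md_ge0// h_le1.
  have h4 : (ker m n K%:R)`_k <= cc k * (rho - 1).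
    rewrite coef_ker -/(rn m n) -/r -/rho -/(cc k) ler_wpM2l// lerD2l lerN2.
    rewrite -real_normK ?num_real// exprn_ege1//.
    move: kK; rewrite neq_ltn => /orP[|] kK.
      have : k.+1%:R <= K%:R :> R by rewrite ler_nat.
      by rewrite -natr1 => h4; rewrite distrC ger0_norm; lra.
    have : K.+1%:R <= k%:R :> R by rewrite ler_nat.
    by rewrite -natr1 => h4; rewrite ger0_norm; lra.
  have t1 : 0 <= (1 + tau) * D k s by rewrite mulr_ge0 ?addr_ge0 ?(ltW tau0)// ltW// D_gt0.
  have h5 : (ker m n K%:R)`_k * (md (x (wk k)) * md (sh U k x h) ^+ 2)
     <= cc k * (rho - 1) * ((1 + tau) * D k s).
    rewrite ler_pM// mulr_ge0 ?exprn_ge0 ?md_ge0//.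
  have h6 : cc k * (rho - 1) * ((1 + tau) * D k s) <= (rho - 1) * (1 + tau) * v.
    have -> : cc k * (rho - 1) * ((1 + tau) * D k s) = (rho - 1) * (1 + tau) * (cc k * D k s) by ring.
    rewrite ler_wpM2l ?hK// mulr_ge0 ?subr_ge0 ?addr_ge0 ?(ltW tau0)//.
  have h7 : tau * rho * v <= 64^-1 * v by rewrite ler_wpM2r ?(ltW v0).
  have h8 : 0 <= tau * v by rewrite mulr_ge0 ?(ltW tau0) ?(ltW v0).
  have := sg_v; rewrite -/x; lra.
have oth i : (i <= r)%N -> i != K -> md (sh U i x h) <= tau.
  move=> ir _; apply: h_off; first exact: chi_sh au cx.
  by move=> Vi; apply: nV; exists i.
have := @kernel_approx m n K K h x tau cx KR KR (ltW tau0) oth.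
rewrite -/r -/rho -/sg -/f -/x xK => h1.
have /andP[q0 q1] := coef_ker_bd KR KR.
have := md_dist (x f) (((ker m n K%:R)`_K)%:C%C * (x (wk K) * y h ^+ 2)).
rewrite mdM mdM md_real ger0_norm// mdX => h2.
have h3 : (ker m n K%:R)`_K * (md (x (wk K)) * md (y h) ^+ 2) <= sg.
  have /andP[_ w1] := wk_bd K cx.
  rewrite /sg -mulrA ler_pM ?mulr_ge0 ?exprn_ge0 ?md_ge0//.
    apply: le_trans q1 _; rewrite -/r -/rho -/(cc K) ler_wpM2l ?cc_le//.
    by rewrite (le_trans ler01 rho1).
  rewrite ler_pM ?exprn_ge0 ?md_ge0//.
    by apply: le_trans w1 _; rewrite ler_weXn2l.
  by rewrite lerXn2r ?nnegrE ?md_ge0 ?(ltW tau0)// h_off.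
have := sg_v; rewrite -/x; have := v0; lra.
Qed.

Let nuf : nu f <= (c ^+ m)^-1 * (2 ^+ m * (5 * rho * n%:R ^+ 2)) *
   (C * (B * (2 * q * D k0 s) * (G * q * (2 * nu h + r%:R * nu w)))).
Proof.
set Y := C * _.
have G0 : 0 <= G by rewrite (le_trans ler01).
have q0 : 0 <= q by rewrite exprn_ge0// addr_ge0// ltW.
have Y0 : 0 <= Y.
  do ![apply: mulr_ge0 => //]; rewrite ?(ltW B0) ?(ltW Dk0)//.
  by rewrite addr_ge0// mulr_ge0.
have lT : lin T := wop_lin ba w (aut_lin au).
rewrite -mulrA ler_pdivlMl ?exprn_gt0//.
apply: le_trans (nu_low_iter m f) _.
rewrite /f -(act_mul _ _ _ lT) /ker mulrA -exprMn geo_mul.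
have Kr1 : (0 : R) <= K%:R by exact: ler0n.
have Kr2 : K%:R <= (m.+2 * n)%:R :> R by rewrite ler_nat.
have Kr := introT andP (conj Kr1 Kr2).
have n0 : (0 < n)%N by rewrite ltnW.
have [P mP P1] := maj_XnB1_gker n0 Kr.
have hY k : (k < r.+1)%N -> nu (iter k T (mul h h)) <= Y.
  rewrite ltnS => kr.
  have Q0 : 0 <= 2 * q * D k0 s by rewrite !mulr_ge0// ltW.
  have Gq0 : 0 <= G * q by exact: mulr_ge0.
  have gk i : (i <= k)%N -> forall f0, nu (iter i U f0) <= G * q * nu f0.
    move=> ik f0; apply: le_trans (gU i f0) _; rewrite ler_wpM2r// ler_wpM2l//.
    by rewrite /q ler_weXn2l ?(leq_trans ik)// lerDl ltW.
  (* Inside the neighbourhood this is the near-maximality of [D k0 s] in the window; outside, the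
     bound [tau] on [h] beats [B^r]. *)
  have hQ x : chi x -> md (x (wk k)) * md (sh U k x h) <= 2 * q * D k0 s.
    move=> cx; have ck : chi (sh U k x) by exact: chi_sh au cx.
    have q1 : 1 <= q by rewrite /q exprn_ege1// lerDl ltW.
    have [Vk|nV] := pselect (Vn (sh U k x)).
      have xk : md (x (wk k)) = D k (sh U k x) by rewrite /D (shK _ _ (aut_sym au)).
      have /andP[_ d2] := hii ck Vk kr.
      have d3 := hD kr; rewrite -/q in d3.
      have t1 : (1 + tau) * D k s <= 2 * (q * D k0 s).
        have t2 := tau1; apply: ler_pM => //; rewrite ?ltW ?D_gt0// ?addr_gt0//; lra.
      rewrite xk -mulrA -[leRHS]mulr1 ler_pM ?md_ge0 ?h_le1//; exact: le_trans d2 t1.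
    have /andP[_ w1] := wk_bd k cx.
    have w2 : md (x (wk k)) <= b by apply: le_trans w1 _; rewrite ler_weXn2l.
    have := h_off ck nV => t1.
    apply: (@le_trans _ _ (b * tau)); first by rewrite ler_pM ?md_ge0.
    have bp : 0 < b by rewrite (lt_le_trans ltr01).
    have z1 : 1 <= z ^+ 4 by rewrite exprn_ege1// (le_trans _ z16)// ler1n.
    have t2 : b * tau <= b^-1.
      rewrite -[leRHS]mulr1 ler_pdivlMl// -tauE mulrA [leLHS](_ : _ = tau * b ^+ 2 * 1); last by ring.
      by rewrite -[leRHS]mulrA [leRHS]mulrA ler_wpM2l// mulr_ge0 ?exprn_ge0 ?(ltW tau0) ?(ltW bp).
    apply: le_trans t2 _; apply: le_trans (b_D cs k0r) _.
    by rewrite ler_peMl ?(ltW Dk0)//; lra.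
  apply: le_trans (nu_iter_sq Q0 h_le1 hQ gk Gq0) _.
  apply: ler_wpM2l => //; apply: ler_wpM2l; first by rewrite mulr_ge0 ?(ltW B0).
  by apply: ler_wpM2l => //; rewrite lerD2l; apply: ler_wpM2r => //; rewrite ler_nat.
apply: le_trans (nu_act (size_XnB1_gker m K%:R n0) mP Y0 hY) _.
by rewrite ler_wpM2r.
Qed.

Hypothesis hnum : 20 * G ^+ 2 * q ^+ 3 * C ^+ 2 * p%:R * B * r.+1%:R * (2 + r%:R * nu w) *
  (2 / (c * n%:R)) ^+ m <= 2^-1.

(* The new function is the [p]-th power of [f / sup |f|], translated by [V^K]. *)
Lemma descent_step : exists2 h', Cls fs e1 tau s h' & nu h' <= 2^-1 * nu h.
Proof.
have [x0 cx0 hx0] := amax f.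
set F := md (x0 f) in hx0.
have hF : rho * v - 5 / 64 * v <= F.
  case: hh => _ [y cy yh] _; have l1 := lower cy yh.
  apply: le_trans (hx0 _ (chi_sh K (aut_sym au) cy)); apply: le_trans l1.
  have l2 : tau * rho * v <= 64^-1 * v by rewrite ler_wpM2r ?(ltW v0).
  have := sg_v; lra.
have rv : 16 * v <= rho * v by rewrite ler_pM2r.
have F1 : rho * v / 2 <= F by have := v0; lra.
have F0 : 0 < F by have := v0; lra.
have j0 : (0 < j)%N by rewrite /j; clear -r4; nia.
have p0 : (0 < p)%N by rewrite /p; clear -r4 j0; nia.
pose h' := ((F ^+ p)^-1)%:C%C *: iter K V (\big[mul/one]_(i < p) f).
have E y : chi y -> md (y h') = (md (sh V K y f) / F) ^+ p.
  move=> cy; rewrite /h' (chZ _ _ cy) mdM md_real ger0_norm ?invr_ge0 ?exprn_ge0 ?(ltW F0)//.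
  have -> : y (iter K V (\big[mul/one]_(i < p) f)) = sh V K y (\big[mul/one]_(i < p) f) by [].
  rewrite (ch_big _ _ _ (chi_sh K (aut_sym au) cy)) md_prod prodr_const card_ord.
  by rewrite expr_div_n mulrC.
have G0 : 0 <= G by rewrite (le_trans ler01).
have q0 : 0 < q by rewrite exprn_gt0// addr_gt0.
exists h'.
  split.
  - move=> y cy; rewrite E// exprn_ile1 ?divr_ge0 ?md_ge0 ?(ltW F0)//.
    by rewrite ler_pdivrMr// mul1r hx0//; exact: chi_sh (aut_sym au) cy.
  - exists (sh U K x0); first exact: chi_sh au cx0.
    by rewrite E ?(shK _ _ (aut_sym au)) ?divff ?expr1n ?gt_eqF//; exact: chi_sh au cx0.
  - move=> y cy nV; rewrite E//.
    have N0 : (0 < 4 * r ^ 2)%N by clear -r4; nia.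
    have u1 : md (sh V K y f) / F <= 1 - ((4 * r ^ 2)%:R)^-1.
      rewrite ler_pdivrMr// natrM natrX -/rho; apply: le_trans (upper cy nV) _.
      have r0 : 0 < rho by rewrite (lt_le_trans ltr01).
      have u2 : (4 * rho)^-1 * rho = 4^-1 by rewrite invfM -mulrA mulVf ?mulr1// gt_eqF.
      have u3 : 0 <= 1 - (4 * rho)^-1.
        have u0 : 0 < 4 * rho by rewrite mulr_gt0.
        have u1 : 1 <= 4 * rho by rewrite (le_trans rho1)// ler_peMl ?(ltW r0)// ler1n.
        by rewrite subr_ge0 invf_le1.
      apply: le_trans (ler_wpM2l u3 hF).
      rewrite [leRHS](_ : _ = rho * v - 5 / 64 * v - ((4 * rho)^-1 * rho) * v + (4*rho)^-1 * (5/64*v)); last by ring.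
      have u4 : 0 <= (4*rho)^-1 * (5/64*v) by apply: mulr_ge0; [rewrite invr_ge0; lra | have := v0; lra].
      rewrite u2; have := v0; lra.
    rewrite /p exprM /tau -exprVn lerXn2r ?nnegrE ?exprn_ge0 ?divr_ge0 ?md_ge0 ?(ltW F0)//.
    apply: le_trans (one_sub_inv_exp R N0); rewrite lerXn2r ?nnegrE ?divr_ge0 ?md_ge0 ?(ltW F0)//.
    by apply: le_trans u1; rewrite divr_ge0 ?md_ge0 ?(ltW F0).
have a1 : nu h' <= (F ^+ p)^-1 * (G * q * (C * (F ^+ p.-1 * (p%:R * nu f)))).
  rewrite /h' nuZ md_real ger0_norm ?invr_ge0 ?exprn_ge0 ?(ltW F0)//.
  rewrite ler_wpM2l ?invr_ge0 ?exprn_ge0 ?(ltW F0)//; apply: le_trans (gV _ _) _.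
  apply: ler_pM => //; first by rewrite mulr_ge0// exprn_ge0// addr_ge0// ltW.
    by rewrite ler_wpM2l// /q ler_weXn2l// lerDl ltW.
  exact: nu_pow (ltW F0) hx0.
have a2 : (F ^+ p)^-1 * (G * q * (C * (F ^+ p.-1 * (p%:R * nu f)))) = G * q * C * p%:R * (F^-1 * nu f).
  have -> : F ^+ p = F * F ^+ p.-1 by rewrite -exprS prednK.
  have : F ^+ p.-1 != 0 by rewrite gt_eqF// exprn_gt0.
  have : F != 0 by rewrite gt_eqF.
  move: (F ^+ p.-1) (p%:R) => Fp pp h1 h2; field.
  by rewrite h1 h2.
rewrite a2 in a1; apply: le_trans a1 _.
have nh := Cls_nu hh.
have a3 : 2 * nu h + r%:R * nu w <= (2 + r%:R * nu w) * nu h.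
  by rewrite [leRHS]mulrDl lerD2l ler_peMr// mulr_ge0.
have iF : F^-1 <= (rho * v / 2)^-1.
  by rewrite lef_pV2 ?posrE// divr_gt0// mulr_gt0// (lt_le_trans ltr01).
have nn0 : 0 < n%:R :> R by rewrite ltr0n ltnW.
(* [D k0 s] is traded for [v], which cancels against [F >= rho v / 2]; the final bound is
   independent of [s]. *)
have a4 : nu f <= (c ^+ m)^-1 * (2 ^+ m * (5 * rho * n%:R ^+ 2)) *
   (C * (B * (2 * q * (r.+1%:R * v / n%:R ^+ m.+2)) * (G * q * ((2 + r%:R * nu w) * nu h)))).
  apply: le_trans nuf _.
  have rr : 0 <= rho by rewrite (le_trans ler01).
  rewrite ler_wpM2l ?mulr_ge0 ?invr_ge0 ?exprn_ge0 ?(ltW c0)// ler_wpM2l//.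
  have x1 : 0 <= 2 * nu h + r%:R * nu w by rewrite addr_ge0 ?mulr_ge0.
  apply: ler_pM; rewrite ?mulr_ge0 ?(ltW B0) ?(ltW q0) ?(ltW Dk0)//.
    rewrite ler_wpM2l ?(ltW B0)// ler_wpM2l ?mulr_ge0 ?(ltW q0)//.
    by rewrite ler_pdivlMr// mulrC v_ge.
  by rewrite ler_wpM2l// mulr_ge0// ltW.
have a5 := ler_pM (_ : 0 <= F^-1) (nu_ge0 f) iF a4.
have a6 : G * q * C * p%:R * (F^-1 * nu f) <=
  G * q * C * p%:R * ((rho * v / 2)^-1 * ((c ^+ m)^-1 * (2 ^+ m * (5 * rho * n%:R ^+ 2)) *
   (C * (B * (2 * q * (r.+1%:R * v / n%:R ^+ m.+2)) * (G * q * ((2 + r%:R * nu w) * nu h)))))).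
  by rewrite ler_wpM2l ?a5 ?invr_ge0 ?(ltW F0)// !mulr_ge0// ltW.
apply: le_trans a6 _.
apply: le_trans (ler_wpM2r (nu_ge0 h) hnum).
rewrite le_eqVlt; apply/orP; left; apply/eqP.
rewrite expr_div_n exprMn (_ : n%:R ^+ m.+2 = n%:R ^+ m * n%:R ^+ 2 :> R);
  last by rewrite -exprD addn2.
have : c ^+ m != 0 by rewrite gt_eqF// exprn_gt0.
have : n%:R ^+ m != 0 :> R by rewrite gt_eqF// exprn_gt0.
have : n%:R != 0 :> R by rewrite gt_eqF.
have : rho != 0 by rewrite gt_eqF// (lt_le_trans ltr01).
have : v != 0 by rewrite gt_eqF.
move: (n%:R ^+ m) (2 ^+ m) => X2 X6; move: (c ^+ m) (n%:R) (rho) (v) (r.+1%:R) => X1 X3 X4 X5 X7.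
move: (r%:R) (p%:R) => X8 X9 h1 h2 h3 h4 h5.
by field; rewrite h1 h2 h3 h4 h5.
Qed.

End Step.

Hypothesis dens : forall t (fs : seq A) (e : R), chi t -> 0 < e ->
  exists s, [/\ chi s, nonper s & forall f, f \in fs -> md (s f - t f) < e].
Hypothesis growth : forall e : R, 0 < e -> exists2 G, 1 <= G &
  (forall k f, nu (iter k U f) <= G * (1 + e) ^+ k * nu f) /\
  (forall k f, nu (iter k V f) <= G * (1 + e) ^+ k * nu f).

(** Losses: [q^3 <= 4 * 2^m] from the powers of [U] and [V], and degree 5 in [m + 2], namely three
    from [p] and one each from [r + 1] and [2 + r nu w]. Gain: [(2 / (c n))^m <= 4^-m]. *)
Let hnum_choice (G : R) : 1 <= G -> forall n, (0 < n)%N -> 8 <= c * n%:R ->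
  forall e : R, 0 < e -> (1 + e) ^+ (3 * n) <= 2 -> exists m,
  20 * G ^+ 2 * ((1 + e) ^+ rn m n) ^+ 3 * C ^+ 2 *
   (4 * rn m n ^ 2 * ((2 * beta + 4) * rn m n))%:R * B * (rn m n).+1%:R *
   (2 + (rn m n)%:R * nu w) * (2 / (c * n%:R)) ^+ m <= 2^-1.
Proof.
move=> G1 n n0 cn e e0 e2.
pose P0 : R := (4 * n ^ 2 * ((2 * beta + 4) * n))%:R.
pose X : R := 160 * G ^+ 2 * C ^+ 2 * B * P0 * n.+1%:R * (2 + n%:R * nu w).
have [m hm] := poly_exp_small X; exists m.
pose M : R := m.+2%:R; pose z : R := 2 ^+ m; rewrite -/M -/z in hm.
have z0 : 0 < z by rewrite exprn_gt0.
have M1 : 1 <= M by rewrite ler1n.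
have M0 : 0 <= M by rewrite (le_trans ler01).
have rE : (rn m n)%:R = M * n%:R :> R by rewrite natrM.
have a1 : ((1 + e) ^+ rn m n) ^+ 3 <= 4 * z.
  rewrite -exprM (_ : (rn m n * 3 = 3 * n * m.+2)%N); last by rewrite /rn; ring.
  rewrite exprM (_ : 4 * z = 2 ^+ m.+2); last by rewrite !exprS mulrA -natrM.
  by rewrite lerXn2r ?nnegrE// exprn_ge0// addr_ge0// ltW.
have a2 : (4 * rn m n ^ 2 * ((2 * beta + 4) * rn m n))%:R = P0 * M ^+ 3.
  by rewrite /P0 /M -natrX -natrM; congr (_%:R); rewrite /rn; ring.
have a3 : (rn m n).+1%:R <= n.+1%:R * M.
  by rewrite -[(rn m n).+1%:R]natr1 -[n.+1%:R]natr1 rE; lra.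
have a4 : 2 + (rn m n)%:R * nu w <= (2 + n%:R * nu w) * M.
  rewrite rE; lra.
have nn0 : 0 < n%:R :> R by rewrite ltr0n.
have a5 : (2 / (c * n%:R)) ^+ m <= (z ^+ 2)^-1.
  have -> : (z ^+ 2)^-1 = (4^-1) ^+ m.
    by rewrite /z -exprM mulnC exprM exprVn -natrX.
  rewrite lerXn2r ?nnegrE ?divr_ge0 ?mulr_ge0 ?(ltW c0) ?invr_ge0//.
  rewrite ler_pdivrMr ?mulr_gt0//; lra.
have P00 : 0 <= P0 by exact: ler0n.
have nw0 : 0 <= 2 + n%:R * nu w by rewrite addr_ge0 ?mulr_ge0.
have ar0 : 0 <= 2 + (rn m n)%:R * nu w by rewrite addr_ge0 ?mulr_ge0.
have b1 : ((1 + e) ^+ rn m n) ^+ 3 * (P0 * M ^+ 3) * (rn m n).+1%:R *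
   (2 + (rn m n)%:R * nu w) * (2 / (c * n%:R)) ^+ m <=
   4 * z * (P0 * M ^+ 3) * (n.+1%:R * M) * ((2 + n%:R * nu w) * M) * (z ^+ 2)^-1.
  have q0 : 0 <= ((1 + e) ^+ rn m n) ^+ 3 by rewrite !exprn_ge0// addr_ge0// ltW.
  have pm : 0 <= P0 * M ^+ 3 by rewrite mulr_ge0// exprn_ge0.
  have s1 := ler_pM q0 pm a1 (lexx _).
  have s2 := ler_pM (mulr_ge0 q0 pm) (ler0n _ _) s1 a3.
  have s3 := ler_pM (mulr_ge0 (mulr_ge0 q0 pm) (ler0n _ _)) ar0 s2 a4.
  apply: (ler_pM (mulr_ge0 (mulr_ge0 (mulr_ge0 q0 pm) (ler0n _ _)) ar0) _ s3 a5).
  by rewrite exprn_ge0// divr_ge0// mulr_ge0// ltW.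
have cst : 0 <= 20 * G ^+ 2 * C ^+ 2 * B.
  rewrite mulr_ge0 ?(ltW B0)//; apply: mulr_ge0; last by rewrite exprn_ge0.
  by rewrite mulr_ge0// exprn_ge0// (le_trans ler01).
rewrite a2; move: (ler_wpM2l cst b1).
set L := ((1 + e) ^+ rn m n) ^+ 3; set L2 := (2 / (c * n%:R)) ^+ m.
move: (rn m n).+1%:R => r1; move: ((rn m n)%:R) => r2.
have -> : 20 * G ^+ 2 * C ^+ 2 * B * (L * (P0 * M ^+ 3) * r1 * (2 + r2 * nu w) * L2) =
  20 * G ^+ 2 * L * C ^+ 2 * (P0 * M ^+ 3) * B * r1 * (2 + r2 * nu w) * L2 by ring.
move=> b2; apply: le_trans b2 _.
have -> : 20 * G ^+ 2 * C ^+ 2 * B * (4 * z * (P0 * M ^+ 3) * (n.+1%:R * M) * ((2 + n%:R * nu w) * M) / z ^+ 2)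
  = (X * M ^+ 5 / z) / 2.
  rewrite /X; move: (n.+1%:R) (n%:R) => y1 y2; field; by rewrite gt_eqF.
have : X * M ^+ 5 / z <= 1 by rewrite ler_pdivrMr// mul1r.
lra.
Qed.

(** The order of choices matters: [n] depends on [c], [e] on [n], [G] on [e], and [m] on all of
    them; the window of length [r] and its point [s] come after. *)
Lemma dichotomy_exists : (exists x, chi x) -> exists i, dichotomy_at mul one U V w (2 ^ i).
Proof.
move=> [x0 cx0]; apply: contrapT => nd'.
have nd i : ~ dichotomy_at mul one U V w (2 ^ i) by move=> h; apply: nd'; exists i.
pose n := (Num.truncn (8 / c)).+2.
have n1 : (1 < n)%N by [].
have n0 : (0 < n)%N by [].
have cn : 8 <= c * n%:R.
  rewrite mulrC -ler_pdivrMr//; apply: le_trans (ltW (truncnS_gt _)) _.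
  by rewrite ler_nat.
pose e : R := (2 ^+ (3 * n))^-1.
have e0 : 0 < e by rewrite invr_gt0 exprn_gt0.
have e2 : (1 + e) ^+ (3 * n) <= 2.
  apply: le_trans (expr1D_le _ _) _.
    by rewrite (ltW e0) /e invf_le1 ?exprn_gt0// exprn_ege1// ler1n.
  by rewrite mulrBr mulVf ?gt_eqF ?exprn_gt0// mulr1; lra.
have [G G1 [gU gV]] := growth e0.
have [m hnum] := hnum_choice G1 n0 cn e0 e2.
have [k0 k0r hk0] := geo_exp_max R m.+2 n0.
have [s [cs ns hD]] := window_point au hB dens e0 k0r nd.
have [K KR hK] := fin_max (fun k => (geo R n ^+ m.+2)`_k * D k s) (rn m n).
pose tau : R := (2 ^+ ((2 * beta + 4) * rn m n))^-1.
have t0 : 0 < tau by rewrite invr_gt0 exprn_gt0.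
have t1 : tau <= 1 by rewrite /tau invf_le1 ?exprn_gt0// exprn_ege1// ler1n.
have [fs [e1 e10 [hi hii]]] := isolating_nbhd (rn m n) cs ns t0.
have [h0 hh0] := Cls_init fs cs e10 t0 t1.
have step h : Cls fs e1 tau s h -> exists2 h', Cls fs e1 tau s h' & nu h' <= 2^-1 * nu h.
  by move=> hh; apply: (descent_step n1 e0 G1 gU gV k0r hk0 cs hD KR hK hi hii hh hnum).
have it i : exists2 h, Cls fs e1 tau s h & nu h <= nu h0 * (2^-1) ^+ i.
  elim: i => [|i [h hh hi']]; first by exists h0; rewrite ?expr0 ?mulr1.
  have [h' hh' l] := step h hh; exists h' => //; apply: le_trans l _.
  by rewrite exprS mulrCA ler_pM2l ?invr_gt0.
have q1 : 2^-1 < 1 :> R by rewrite invf_lt1// ltr1n.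
have h20 : 0 < 2^-1 :> R by rewrite invr_gt0.
have [N hN] := geometric_small (nu h0) (ltW h20) q1 h20.
have [h hh l] := it N; have := Cls_nu hh; have := hN N (leqnn N); lra.
Qed.
End Descent.

(** * Continuity in terms of bounds *)

Section Continuity.
Variables (R : realType) (A : completeNormedModType (Cx R)).

Lemma continuous_lin_bdd (S : A -> A) : lin S -> continuous S -> exists2 b : R, 0 <= b & bdd b S.
Proof.
move=> lS cS; have /cvgr_dist_le /(_ 1 ltr01) : S x @[x --> (0 : A)] --> S 0 by exact: cS.
rewrite (lin_zero lS) => /nbhs_norm0P [e /= e0 he].
have eR : e = (complex.Re e)%:C%C by rewrite (RRe_real (gtr0_real e0)).
pose d : R := complex.Re e / 2.
have d0 : 0 < d by rewrite divr_gt0// -ltcR -eR.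
have hd f : nrm f <= d -> nrm (S f) <= 1.
  move=> fd; have /he : `|f| < e.
    by rewrite eR nrmE ltcR (le_lt_trans fd)// /d ltr_pdivrMr// ltr_pMr ?ltr1n// -ltcR -eR.
  by rewrite /= sub0r normrN nrmE -[1]/(1%:C%C) lecR.
exists d^-1; first by rewrite invr_ge0 ltW.
move=> f; have [->|f0] := eqVneq f 0; first by rewrite (lin_zero lS) nrm0 mulr0.
have nf : 0 < nrm f by rewrite lt_neqAle nrm_ge0 eq_sym nrm_eq0 f0.
have dn : 0 <= d / nrm f by rewrite divr_ge0 ?ltW.
have := hd ((d / nrm f)%:C%C *: f); rewrite (lin_scale lS) !nrmZ md_real ger0_norm//.
rewrite -mulrA mulVf ?gt_eqF// mulr1 => /(_ (lexx _)).
by rewrite mulrAC ler_pdivrMr// mul1r ler_pdivlMl.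
Qed.

Lemma lipschitz_continuous_nrm (S : A -> A) (b : R) :
  (forall f g, nrm (S f - S g) <= b * nrm (f - g)) -> continuous S.
Proof.
move=> hS f; apply/cvgrPdist_le => e e0.
have eR : e = (complex.Re e)%:C%C by rewrite (RRe_real (gtr0_real e0)).
have e1 : 0 < complex.Re e by rewrite -ltcR -eR.
have b1 : 0 < 1 + `|b| by rewrite ltr_wpDr.
have d0 : (0 : Cx R) < (complex.Re e / (1 + `|b|))%:C%C by rewrite ltcR divr_gt0.
have := @cvgr_dist_lt _ _ _ _ _ (fun x : A => x) f (@cvg_id _ (nbhs f)) _ d0.
move=> /(_ (nbhs_filter f)); apply: filterS => g /=.
rewrite !nrmE ltcR => fg; rewrite eR lecR; apply: le_trans (hS _ _) _.
apply: (@le_trans _ _ ((1 + `|b|) * nrm (f - g))).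
  rewrite ler_wpM2r ?nrm_ge0//; have := ler_norm b; lra.
by rewrite mulrC -ler_pdivlMr// ltW.
Qed.

End Continuity.

(** * The sup norm on the character space *)

Section SupNorm.
Variables (R : realType) (A : completeNormedModType (Cx R)).
Variables (mul : A -> A -> A) (one : A).
Hypothesis ba : is_comm_banach_alg mul one.
Hypothesis ss : semisimple mul one.
Local Notation chi := (is_character mul one).
Local Notation M := (max_ideal_space mul one).
Local Notation X := {ptws A -> Cx R}.

Lemma supnorm_le (g : X -> Cx R) (S : R) : (forall t, M t -> md (g t) <= S) -> supnorm M g <= S.
Proof.
move=> h; have [m Mm] := max_ideal_space_neq0 ba ss.
by apply: ge_sup; [exists (md (g m)), m|move=> _ [t Mt <-]; exact: h].
Qed.

Lemma supnorm_ge (g : X -> Cx R) (S : R) t : (forall t, M t -> md (g t) <= S) -> M t ->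
  md (g t) <= supnorm M g.
Proof.
move=> h Mt; apply: ub_le_sup; last by exists t.
by exists S => _ [u Mu <-]; exact: h.
Qed.

Definition sn (f : A) : R := supnorm M (fun t : X => t f).

Lemma sn_ge t f : chi t -> md (t f) <= sn f.
Proof.
by move=> ct; apply: (@supnorm_ge _ (nrm f)) => // u cu; exact: (char_le_nrm ba).
Qed.

Lemma sn_le f (S : R) : (forall t, chi t -> md (t f) <= S) -> sn f <= S.
Proof. by move=> h; apply: supnorm_le. Qed.

Lemma sn_ge0 f : 0 <= sn f.
Proof. by have [m Mm] := max_ideal_space_neq0 ba ss; apply: le_trans (sn_ge f Mm); exact: md_ge0. Qed.

Lemma snD f g : sn (f + g) <= sn f + sn g.
Proof.
apply: sn_le => t ct; rewrite (chD _ _ ct) (le_trans (mdD _ _))// lerD//; exact: sn_ge.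
Qed.

Lemma snZ a f : sn (a *: f) = md a * sn f.
Proof.
have le b g : sn (b *: g) <= md b * sn g.
  by apply: sn_le => t ct; rewrite (chZ _ _ ct) mdM ler_wpM2l ?md_ge0//; exact: sn_ge.
apply/eqP; rewrite eq_le le /=; have [->|a0] := eqVneq a 0.
  by rewrite md0 mul0r sn_ge0.
have := le a^-1 (a *: f); rewrite scalerA mulVf// scale1r mdV.
by rewrite ler_pdivlMl ?md_gt0.
Qed.

Lemma snN f : sn (- f) = sn f.
Proof. by rewrite -scaleN1r snZ mdN md1 mul1r. Qed.

Lemma snB f g : sn (f - g) <= sn f + sn g.
Proof. by rewrite -(snN g) snD. Qed.

Lemma snC f g : sn (f - g) = sn (g - f).
Proof. by rewrite -snN opprB. Qed.

Lemma sn_sum (I : Type) (l : seq I) (P : pred I) (F : I -> A) :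
  sn (\sum_(i <- l | P i) F i) <= \sum_(i <- l | P i) sn (F i).
Proof.
elim/big_rec2: _ => [|i y x _ h].
  by rewrite -(scale0r (0 : A)) snZ md0 mul0r.
by rewrite (le_trans (snD _ _))// lerD2l.
Qed.

Lemma sn_aut U V k f : aut mul one U V -> sn (iter k U f) <= sn f.
Proof.
by move=> au; apply: sn_le => t ct; apply: (@sn_ge (sh U k t)); exact: chi_sh au ct.
Qed.

(** One factor is bounded by the sum of the norms, the others by [S]: the product inequality with
    constant 1. *)
Lemma sn_prod (p : nat) (f : nat -> A) (S : R) : (0 < p)%N ->
  (forall x, chi x -> forall j : 'I_p, \prod_(i < p | i != j) md (x (f i)) <= S) ->
  sn (\big[mul/one]_(i < p) f i) <= 1 * (S * \sum_(i < p) sn (f i)).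
Proof.
case: p => // p _ h; rewrite mul1r; apply: sn_le => t ct.
rewrite (ch_big _ _ _ ct) md_prod (bigD1 ord0)//= mulrC.
have l1 := h t ct ord0.
have l0 : 0 <= \prod_(i < p.+1 | i != ord0) md (t (f i)) by apply: prodr_ge0 => i _; exact: md_ge0.
apply: ler_pM => //; first exact: md_ge0.
apply: le_trans (sn_ge _ ct) _; rewrite (bigD1 ord0)//= lerDl.
by apply: sumr_ge0 => i _; exact: sn_ge0.
Qed.

End SupNorm.

(** * Density of nonperiodic points, peak functions, product inequality *)

Section Density.
Variables (R : realType) (A : completeNormedModType (Cx R)).
Variables (mul : A -> A -> A) (one : A).
Hypothesis ba : is_comm_banach_alg mul one.
Hypothesis ss : semisimple mul one.
Hypothesis reg : regular mul one.
Local Notation chi := (is_character mul one).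
Local Notation X := {ptws A -> Cx R}.

Lemma iter_induced (U : A -> A) n (t : X) : iter n (induced_map U) t = sh U n t.
Proof.
elim: n => [|n IH] //=; rewrite IH; apply/funext => f.
by rewrite /induced_map /sh -iterSr.
Qed.

Lemma nonperiodic_dense (U : A -> A) :
  first_category_in (shilov_boundary mul one)
    [set t | shilov_boundary mul one t /\ periodic_point (induced_map U) t] ->
  forall t (fs : seq A) (e : R), chi t -> 0 < e ->
  exists s, [/\ chi s, forall k, (0 < k)%N -> sh U k s <> s & forall f, f \in fs -> md (s f - t f) < e].
Proof.
rewrite (shilov_regular ba ss reg) => -[_ [N [ndN cN]]] t fs e ct e0.
have regX : regular_space X by exact: uniform_regular.
have [s [cs hs ns]] := baire_compact regX (max_ideal_space_compact ba) ndN ct (nbhs_evals t fs e0).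
exists s; split => // k k0 ks.
have [|i _ Ni] := cN s; last exact: (ns i).
by split=> //; exists k; rewrite iter_induced.
Qed.

Lemma peak_functions : all_peak_points mul one ->
  forall s fs (e tau : R), chi s -> 0 < e -> 0 < tau -> tau <= 1 ->
  exists h, [/\ s h = 1, forall x, chi x -> md (x h) <= 1 + tau
    & forall x, chi x -> ~ basic_nbhd fs e s x -> md (x h) <= tau].
Proof.
rewrite /all_peak_points /check_alg (shilov_regular ba ss reg) => H s fs e tau cs e0 t0 t1.
have [g [[_ gapx] [gs g1]]] := H s cs.
have g1' x : max_ideal_space mul one x -> x <> s -> md (g x) < 1.
  by move=> cx xs; have := g1 x cx xs; rewrite -[1]/(1%:C%C) md_le_lt.
have [h [h1 h2 h3]] := peak_approx ba gapx cs gs g1' fs e0 t0 t1.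
exists h; split=> // x cx nb; apply: h3 => //; apply: contrapT => H2; apply: nb => f ff.
by rewrite ltNge; apply/negP => l; apply: H2; exists f.
Qed.

Lemma nrm_prod_ineq (c : R) :
  (forall (p : nat) (f : 'I_p -> A), (0 < p)%N ->
       `|aprod mul one f| <=
         (c * \sum_(j < p) complex.Re `|f j| *
            supnorm (shilov_boundary mul one)
              (fun t : {ptws A -> (Cx R)} => \prod_(k < p | k != j) t (f k)))%:C%C) ->
  0 < c ->
  forall (p : nat) (f : nat -> A) (S : R), (0 < p)%N ->
  (forall x, chi x -> forall j : 'I_p, \prod_(i < p | i != j) md (x (f i)) <= S) ->
  nrm (\big[mul/one]_(i < p) f i) <= c * (S * \sum_(i < p) nrm (f i)).
Proof.
move=> H c0 p f S p0 hS.
have := H p (fun i => f i) p0; rewrite nrmE lecR /aprod => h; apply: le_trans h _.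
rewrite ler_wpM2l ?(ltW c0)// mulr_sumr; apply: ler_sum => j _.
rewrite mulrC ler_wpM2r ?nrm_ge0// (shilov_regular ba ss reg).
apply: (supnorm_le ba ss) => t ct; rewrite md_prod.
exact: hS.
Qed.

End Density.

(** * Resolvents and growth of the powers of the automorphism *)

Lemma not_op_spectrum_low (R : realType) (A : completeNormedModType (Cx R)) (T : A -> A) l :
  lin T -> ~ op_spectrum T l ->
  (forall f, exists u, T u - l *: u = f) /\
  exists2 c : R, 0 < c & forall g, c * nrm g <= nrm (T g - l *: g).
Proof.
move=> lT /contrapT[S [cS [S1 S2]]]; split=> [f|]; first by exists (S f).
(* [op_spectrum] provides a continuous inverse; its linearity is inherited from [T]. *)
have lS : lin S.
  move=> a x y; rewrite -{1}(S2 x) -{1}(S2 y).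
  rewrite -[RHS]S1 lT; congr (S _).
  rewrite scalerBr !scalerDr !scalerA (mulrC l) opprD addrACA.
  by [].
have [b b0 hb] := continuous_lin_bdd lS cS.
have b1 : 0 < b + 1 by rewrite ltr_wpDl.
exists (b + 1)^-1; first by rewrite invr_gt0.
move=> g; rewrite ler_pdivrMl//; have := hb (T g - l *: g); rewrite S1 => h.
by apply: le_trans h _; rewrite ler_wpM2r ?nrm_ge0// lerDl.
Qed.

(** Since 0 is off the spectrum, [V] is bounded, and then [U] by the open mapping theorem. The
    resolvents of [V] come from [V - l = - l V (U - l^-1)]. *)
Lemma aut_growth (R : realType) (A : completeNormedModType (Cx R)) (mul : A -> A -> A) (one : A)
   (U : A -> A) : is_automorphism mul one U ->
  op_spectrum U = [set z : (Cx R) | `|z| = 1] ->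
  exists V, [/\ aut mul one U V, exists2 b : R, 0 <= b & bdd b U, exists2 b : R, 0 <= b & bdd b V &
  forall e : R, 0 < e -> exists2 G : R, 1 <= G &
  (forall k f, nrm (iter k U f) <= G * (1 + e) ^+ k * nrm f) /\
  (forall k f, nrm (iter k V f) <= G * (1 + e) ^+ k * nrm f)].
Proof.
move=> [lU mU oU [V UK VK]] sp.
have au : aut mul one U V by split.
have lV : lin V := aut_lin (aut_sym au).
have res (l : Cx R) : md l != 1 -> (forall f, exists u, U u - l *: u = f) /\
  exists2 c : R, 0 < c & forall g, c * nrm g <= nrm (U g - l *: g).
  move=> l1; apply: not_op_spectrum_low => //; rewrite sp /= mdE => h.
  by move/eqP: l1; apply; exact: complexI h.
have [b b0 hV] : exists2 b : R, 0 <= b & bdd b V.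
  have [_ [c c0 h]] : (forall f, exists u, U u - 0 *: u = f) /\
      exists2 c : R, 0 < c & forall g, c * nrm g <= nrm (U g - 0 *: g).
    by apply: res; rewrite md0 eq_sym oner_eq0.
  exists c^-1; first by rewrite invr_ge0 ltW.
  by move=> f; have := h (V f); rewrite scale0r subr0 VK ler_pdivlMl.
have [k k0 hU] := bounded_inverse lU lV UK VK b0 hV.
have gU (e : R) := spectral_radius_growth lU k0 hU (fun l (h : 1 < md l) => res l (negbT (gt_eqF h))) (e := e).
have resV (l : Cx R) : 1 < md l -> (forall f, exists u, V u - l *: u = f) /\
  exists2 c : R, 0 < c & forall g, c * nrm g <= nrm (V g - l *: g).
  move=> l1; have l0 : 0 < md l by rewrite (lt_trans ltr01).
  have ln : l != 0 by rewrite -md_gt0.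
  have [|s1 [c c0 s2]] := res l^-1.
    by rewrite mdV; rewrite lt_eqF// invf_lt1.
  have E u : V u - l *: u = - l *: V (U u - l^-1 *: u).
    rewrite (lin_sub lV) (lin_scale lV) UK scalerBr scalerA mulNr mulfV// scaleN1r opprK.
    by rewrite scaleNr addrC.
  split=> [f|].
    have [u hu] := s1 (- l^-1 *: U f); exists u.
    by rewrite E hu (lin_scale lV) UK scalerA mulrNN mulfV// scale1r.
  have k1 : 0 < k + 1 by rewrite ltr_wpDl.
  exists (c / (k + 1)); first by rewrite divr_gt0.
  move=> g; rewrite E nrmZ mdN.
  have h1 : nrm (U g - l^-1 *: g) <= (k + 1) * nrm (V (U g - l^-1 *: g)).
    have := hU (V (U g - l^-1 *: g)); rewrite VK => h; apply: le_trans h _.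
    by rewrite ler_wpM2r ?nrm_ge0// lerDl.
  have h2 := le_trans (s2 g) h1.
  have h3 : c / (k + 1) * nrm g <= nrm (V (U g - l^-1 *: g)).
    by rewrite mulrAC ler_pdivrMr// [leRHS]mulrC.
  by apply: le_trans h3 _; rewrite ler_peMl ?nrm_ge0// ltW.
have gV (e : R) := spectral_radius_growth lV b0 hV resV (e := e).
exists V; split=> //; [by exists k|by exists b|].
move=> e e0; have [G1 G11 h1] := gU e e0; have [G2 G21 h2] := gV e e0.
have e1 n : 0 <= (1 + e) ^+ n by rewrite exprn_ge0// addr_ge0// ltW.
exists (Num.max G1 G2); first by rewrite le_max G11.
split=> n f.
  apply: le_trans (h1 n f) _; rewrite ler_wpM2r ?nrm_ge0// ler_wpM2r// le_max lexx//.
by apply: le_trans (h2 n f) _; rewrite ler_wpM2r ?nrm_ge0// ler_wpM2r// le_max lexx orbT.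
Qed.

(** * Bounds on weights, and the sup-norm lower bound *)

Section Weights.
Variables (R : realType) (A : completeNormedModType (Cx R)).
Variables (mul : A -> A -> A) (one : A).
Hypothesis ba : is_comm_banach_alg mul one.
Hypothesis ss : semisimple mul one.
Local Notation chi := (is_character mul one).

(** A power of two is taken so that [tau] can cancel [B^r] exactly. *)
Lemma weight_bound w v : mul w v = one -> exists beta : nat,
  forall x, chi x -> (2 ^+ beta)^-1 <= md (x w) <= 2 ^+ beta.
Proof.
move=> wv; pose beta := (Num.truncn (nrm w + nrm v)).+1.
have hb : nrm w + nrm v <= 2 ^+ beta.
  apply: le_trans (ltW (truncnS_gt _)) _; rewrite -natrX ler_nat.
  by rewrite ltnW// ltn_expl.
have b0 : 0 < 2 ^+ beta :> R by rewrite exprn_gt0.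
exists beta; move: hb b0; move: (2 ^+ beta) => b hb b0 x cx.
have w1 : md (x w) <= b.
  by apply: le_trans (char_le_nrm ba w cx) _; have := nrm_ge0 v; lra.
have v1 : md (x v) <= b.
  by apply: le_trans (char_le_nrm ba v cx) _; have := nrm_ge0 w; lra.
have E : md (x w) * md (x v) = 1 by rewrite -mdM -(chM _ _ cx) wv (ch1 cx) md1.
rewrite w1 andbT -[(_ ^-1)]mul1r ler_pdivrMr// -E ler_wpM2l//.
exact: md_ge0.
Qed.

Variables (U V : A -> A) (w : A) (beta : nat).
Hypothesis au : aut mul one U V.
Let B : R := 2 ^+ beta.
Hypothesis hB : forall x, chi x -> B^-1 <= md (x w) <= B.
Let T := wop mul w U.

Let B0 : 0 < B. Proof. by rewrite exprn_gt0. Qed.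
Let B1 : 1 <= B. Proof. by rewrite exprn_ege1// ler1n. Qed.

Lemma sn_iter_wop k g : sn mul one (iter k T g) <= B ^+ k * sn mul one g.
Proof.
apply: (sn_le ba ss) => t ct; rewrite (ch_wop ba _ _ _ au ct) mdM.
have /andP[_ h] := ch_wn_bd k au B0 hB ct.
by apply: ler_pM => //; [exact: md_ge0|exact: md_ge0|exact: (sn_ge ba _ (chi_sh k au ct))].
Qed.

(** Read [T^N g - g] at [t] if [|w_N(t)| <= 1/2], and at [phi^-N t] otherwise. Either way [|g(t)|]
    is at most half the sup norm of [g] plus that of [T^N g - g], which telescopes into
    [T g - g]. *)
Lemma dichotomy_low N : dichotomy_at mul one U V w N ->
  forall g, sn mul one g <= 2 * (\sum_(i < N) B ^+ i) * sn mul one (T g - g).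
Proof.
move=> dN g; set y := T g - g; set L := \sum_(i < N) _; set s := sn mul one g.
have s0 : 0 <= s by exact: sn_ge0.
have Ly : sn mul one (iter N T g - g) <= L * sn mul one y.
  rewrite (iter_sub_tele (wop_lin ba w (aut_lin au))); apply: le_trans (sn_sum ba ss _ _ _) _.
  by rewrite mulr_suml; apply: ler_sum => i _; exact: sn_iter_wop.
have Ly0 : 0 <= L * sn mul one y by apply: le_trans Ly; exact: sn_ge0.
have h : s <= s / 2 + L * sn mul one y.
  apply: (sn_le ba ss) => t ct; case: (dN t ct) => h.
    have := sn_ge ba (iter N T g - g) ct; rewrite (chB _ _ ct) (ch_wop ba _ _ _ au ct).
    have := md_dist (t g) (t (wn mul one w U N) * sh U N t g); rewrite mdC mdM.
    have := ler_pM (md_ge0 _) (md_ge0 _) h (sn_ge ba g (chi_sh N au ct)).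
    rewrite -/s; lra.
  have ct' := chi_sh N (aut_sym au) ct.
  have := sn_ge ba (iter N T g - g) ct'; rewrite (chB _ _ ct') (ch_wop ba _ _ _ au ct').
  rewrite (shK _ _ au).
  have := md_dist (sh V N t (wn mul one w U N) * t g) (sh V N t g); rewrite mdM.
  have := ler_wpM2r (md_ge0 (t g)) h; have := sn_ge ba g ct'; rewrite -/s; lra.
lra.
Qed.

End Weights.

Lemma ler_eps_lin (R : realType) (x y k : R) : 0 <= k ->
  (forall e, 0 < e -> x <= y + k * e) -> x <= y.
Proof.
move=> k0 h; apply/ler_addgt0Pr => e e0.
have k1 : 0 < k + 1 by rewrite ltr_wpDl.
have := h (e / (k + 1)) (divr_gt0 e0 k1); move=> h1; apply: le_trans h1 _.
rewrite lerD2l mulrCA ger_pMr// ler_pdivrMr// mul1r lerDl//.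
Qed.

Lemma lin_shift (K : comPzRingType) (A : lmodType K) (T : A -> A) l :
  lin T -> lin (fun f => T f - l *: f).
Proof.
move=> lT a x y; rewrite lT scalerBr scalerDr !scalerA (mulrC l) opprD.
exact: addrACA.
Qed.

(** * The operator on the uniform closure *)

Section CheckAlgebra.
Variables (R : realType) (A : completeNormedModType (Cx R)).
Variables (mul : A -> A -> A) (one : A).
Hypothesis ba : is_comm_banach_alg mul one.
Hypothesis ss : semisimple mul one.
Hypothesis reg : regular mul one.
Local Notation chi := (is_character mul one).
Local Notation M := (max_ideal_space mul one).
Local Notation X := {ptws A -> Cx R}.
Variables (U V : A -> A) (w : A) (beta : nat).
Hypothesis au : aut mul one U V.
Let B : R := 2 ^+ beta.
Hypothesis hB : forall x, chi x -> B^-1 <= md (x w) <= B.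
Let T := wop mul w U.
Variable l : Cx R.
Local Notation sn := (sn mul one).

Let B0 : 0 < B. Proof. by rewrite exprn_gt0. Qed.
Let kb : R := B + md l.
Let kb0 : 0 < kb. Proof. by rewrite ltr_wpDr ?md_ge0. Qed.
Let lT : lin T. Proof. exact: (wop_lin ba w (aut_lin au)). Qed.

Let shE : shilov_boundary mul one = M. Proof. exact: shilov_regular. Qed.

Let chk := check_alg mul one.
Let Op (h : X -> Cx R) (t : X) := check_op mul one w U h t - l * h t.
(** The representative of [f] in [check_alg]. *)
Let hat (f : A) (t : X) : Cx R := if `[< M t >] then t f else 0.

Let chkP g : chk g <-> (forall t, ~ M t -> g t = 0) /\
  (forall e : R, 0 < e -> exists f : A, forall t, M t -> md (g t - t f) <= e).
Proof. by rewrite /chk /check_alg shE. Qed.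

Let OpE h t : M t -> Op h t = t w * h (sh U 1 t) - l * h t.
Proof. by move=> Mt; rewrite /Op /check_op shE; case: asboolP. Qed.

Let Op_off h t : h t = 0 -> ~ M t -> Op h t = 0.
Proof. by move=> ht Mt; rewrite /Op /check_op shE; case: asboolP => // _; rewrite ht mulr0 subr0. Qed.

Let Op_dist h (f : A) (e : R) : 0 <= e -> (forall t, M t -> md (h t - t f) <= e) ->
  forall t, M t -> md (Op h t - t (T f - l *: f)) <= kb * e.
Proof.
move=> e0 hf t Mt; rewrite OpE// (chB _ _ Mt) (chZ _ _ Mt) (chM _ _ Mt).
have -> : t w * h (sh U 1 t) - l * h t - (t w * t (U f) - l * t f) =
  t w * (h (sh U 1 t) - t (U f)) - l * (h t - t f) by ring.
apply: le_trans (mdB _ _) _; rewrite !mdM mulrDl lerD//.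
  have /andP[_ hw] := hB Mt; apply: ler_pM => //; try exact: md_ge0.
  by apply: (hf (sh U 1 t)); exact: chi_sh au Mt.
by rewrite ler_wpM2l ?md_ge0// hf.
Qed.

Let chk_hat f : chk (hat f).
Proof.
apply/chkP; split=> [t nM|e e0]; first by rewrite /hat; case: asboolP.
by exists f => t Mt; rewrite /hat; case: asboolP => // _; rewrite subrr md0 ltW.
Qed.

Let Op_hat f : Op (hat f) = hat (T f - l *: f).
Proof.
apply/funext => t; have [Mt|nM] := pselect (M t); last first.
  by rewrite Op_off// /hat; case: asboolP.
have MU : M (sh U 1 t) by exact: (chi_sh 1 au Mt).
by rewrite OpE// /hat (asboolT Mt) (asboolT MU) (chB _ _ Mt) (chZ _ _ Mt) (chM _ _ Mt).
Qed.

Let chk_op h : chk h -> chk (Op h).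
Proof.
move=> /chkP[h0 h1]; apply/chkP; split=> [t nM|e e0]; first by rewrite Op_off// h0.
have d0 : 0 < e / kb by rewrite divr_gt0.
have [f hf] := h1 _ d0; exists (T f - l *: f) => t Mt.
apply: le_trans (Op_dist (ltW d0) hf Mt) _.
by rewrite mulrCA mulfV ?mulr1// gt_eqF.
Qed.

Let chk_sub g h : chk g -> chk h -> chk (fun t => g t - h t).
Proof.
move=> /chkP[g0 g1] /chkP[h0 h1]; apply/chkP; split=> [t nM|e e0].
  by rewrite g0// h0// subrr.
have d0 : 0 < e / 2 by rewrite divr_gt0.
have [f hf] := g1 _ d0; have [k hk] := h1 _ d0; exists (f - k) => t Mt.
have -> : g t - h t - t (f - k) = (g t - t f) - (h t - t k) by rewrite (chB _ _ Mt); ring.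
by apply: le_trans (mdB _ _) _; have := hf t Mt; have := hk t Mt; lra.
Qed.

Let chk_bound h : chk h -> exists S : R, forall t, M t -> md (h t) <= S.
Proof.
move=> /chkP[_ /(_ 1 ltr01)[f hf]]; exists (1 + nrm f) => t Mt.
have := hf t Mt; have := md_dist (h t) (t f); have := char_le_nrm ba f Mt; lra.
Qed.

(** Elements of the closure must be approximated by elements of [A], so an inverse there leaves on
    [A] a sup-norm lower bound and dense range. By [check_resolvent] these two properties also
    suffice. *)
Lemma check_resolvent_low :
  ~ fun_op_spectrum (shilov_boundary mul one) (check_alg mul one) (check_op mul one w U) l ->
  (exists2 c : R, 0 < c & forall g, c * sn g <= sn (T g - l *: g)) /\
  (forall f (e : R), 0 < e -> exists q, sn (T q - l *: q - f) <= e).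
Proof.
move=> /contrapT[S [S1 [K hK] S2 S3]]; rewrite shE in hK.
have snE f : supnorm M (hat f) = sn f.
  rewrite -[RHS]/(supnorm M (fun t : X => t f)) /supnorm; congr (sup _).
  apply/seteqP; split=> y [t Mt <-]; exists t => //.
    by rewrite /hat asboolT.
  by rewrite /hat asboolT.
split.
  have K1 : 0 < `|K| + 1 by rewrite ltr_wpDl.
  exists (`|K| + 1)^-1; first by rewrite invr_gt0.
  move=> g; rewrite ler_pdivrMl//; have := hK _ (chk_op (chk_hat g)).
  have := S2 _ (chk_hat g); rewrite -[X in S X]/(Op (hat g)) => ->.
  rewrite Op_hat !snE => h; apply: le_trans h _; rewrite ler_wpM2r ?sn_ge0//.
  by have := ler_norm K; lra.
move=> f e e0; have /chkP[h0 h1] := S1 _ (chk_hat f).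
have d0 : 0 < e / kb by rewrite divr_gt0.
have [q hq] := h1 _ d0; exists q; apply: (sn_le ba ss) => t Mt.
have := Op_dist (ltW d0) hq Mt.
have : Op (S (hat f)) t = t f.
  have <- : hat f t = t f by rewrite /hat asboolT.
  exact: (congr1 (@^~ t) (S3 _ (chk_hat f))).
rewrite (chB _ f Mt) mdC => ->.
by rewrite mulrCA mulfV ?mulr1// gt_eqF.
Qed.

Variable c : R.
Hypotheses (c0 : 0 < c) (low : forall g, c * sn g <= sn (T g - l *: g)).

Let chk_low h (S : R) : chk h -> (forall t, M t -> md (Op h t) <= S) ->
  forall t, M t -> c * md (h t) <= S.
Proof.
move=> /chkP[h0 h1] hS t Mt; apply: (@ler_eps_lin _ _ _ (c + kb)).
  by rewrite addr_ge0 ?ltW.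
move=> e e0; have [f hf] := h1 e e0.
have a1 : sn (T f - l *: f) <= S + kb * e.
  apply: (sn_le ba ss) => u Mu; have := Op_dist (ltW e0) hf Mu; rewrite mdC.
  have := md_dist (u (T f - l *: f)) (Op h u); have := hS u Mu; lra.
have a2 : md (h t) <= e + sn f.
  have := md_dist (h t) (t f); have := hf t Mt; have := sn_ge ba f Mt; lra.
have a3 := ler_wpM2l (ltW c0) a2; have := low f; lra.
Qed.

Hypothesis as_ : forall f (e : R), 0 < e -> exists q, sn (T q - l *: q - f) <= e.

(** Elements [q n] solving up to [2^-n] are uniformly Cauchy by the lower bound; their limit is the
    solution. *)
Let chk_solve g : chk g -> exists h, chk h /\ Op h = g.
Proof.
move=> cg; have /chkP[g0 g1] := cg.
pose e (n : nat) : R := 2^-1 ^+ n.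
have e0 n : 0 < e n by rewrite exprn_gt0// invr_gt0.
have edec n m : (n <= m)%N -> e m <= e n.
  by move=> nm; rewrite /e ler_wiXn2l ?invr_ge0// invf_le1// ler1n.
have esm (k d : R) : 0 < d -> exists n, k * e n <= d.
  move=> d0; have [||N hN] := @geometric_small R 2^-1 k d _ _ d0; rewrite ?invr_ge0//.
    by rewrite invf_lt1// ltr1n.
  by exists N; exact: hN.
have exq n : exists q, forall t, M t -> md (g t - t (T q - l *: q)) <= e n.
  have d0 : 0 < e n / 2 by rewrite divr_gt0.
  have [f hf] := g1 _ d0; have [q hq] := as_ f d0; exists q => t Mt.
  have := hf t Mt; have := sn_ge ba (T q - l *: q - f) Mt; rewrite (chB _ f Mt) mdC => h1 h2.
  have := mdD (g t - t f) (t f - t (T q - l *: q)); rewrite addrA subrK; lra.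
have [q hq] := choice exq.
have qC n m t : (n <= m)%N -> M t -> md (t (q n) - t (q m)) <= 2 / c * e n.
  move=> nm Mt; rewrite -(chB _ _ Mt); apply: le_trans (sn_ge ba _ Mt) _.
  rewrite mulrAC ler_pdivlMr// mulrC; apply: le_trans (low _) _.
  apply: (sn_le ba ss) => u Mu.
  have -> : T (q n - q m) - l *: (q n - q m) = (T (q n) - l *: q n) - (T (q m) - l *: q m).
    exact: (lin_sub (lin_shift l lT)).
  rewrite (chB _ _ Mu); have h1 := hq n u Mu; have h2 := hq m u Mu; have := edec _ _ nm.
  rewrite mdC in h1.
  have := mdD (u (T (q n) - l *: q n) - g u) (g u - u (T (q m) - l *: q m)); rewrite addrA subrK.
  lra.
have exh (t : X) : exists y : Cx R, M t -> forall d : R, 0 < d ->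
    exists N, forall n, (N <= n)%N -> md (t (q n) - y) <= d.
  have [Mt|nM] := pselect (M t); last by exists 0.
  (* Convergence of the scalars [t (q n)] is read off from completeness of [A], along multiples of
     [one]. *)
  have [|y hy] := @nrm_complete _ _ (fun n => t (q n) *: one).
    move=> d d0; have [N hN] := esm (2 / c * nrm one) _ d0; exists N => m Nm.
    rewrite -scalerBl nrmZ mdC; have := ler_wpM2r (nrm_ge0 one) (qC _ _ _ Nm Mt).
    move: hN; rewrite mulrAC; exact: (fun a b => le_trans b a).
  exists (t y) => _ d /hy[N hN]; exists N => n Nn.
  have := char_le_nrm ba (t (q n) *: one - y) Mt.
  rewrite (chB _ _ Mt) (chZ _ _ Mt) (ch1 Mt) mulr1 => h1.
  exact: le_trans h1 (hN n Nn).
have [h hh] := choice exh.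
pose h' t := if `[< M t >] then h t else 0.
have h'E t : M t -> h' t = h t by move=> Mt; rewrite /h'; case: asboolP.
have unif n t : M t -> md (h' t - t (q n)) <= 2 / c * e n.
  move=> Mt; rewrite h'E// mdC; apply: (@ler_eps_lin _ _ _ 1) => // d d0.
  have [N hN] := hh t Mt d d0.
  have h1 := qC n (maxn n N) t (leq_maxl _ _) Mt; have h2 := hN _ (leq_maxr n N).
  have := mdD (t (q n) - t (q (maxn n N))) (t (q (maxn n N)) - h t); rewrite addrA subrK; lra.
have ch' : chk h'.
  apply/chkP; split=> [t nM|d d0]; first by rewrite /h'; case: asboolP.
  have [N hN] := esm (2 / c) _ d0; exists (q N) => t Mt.
  exact: le_trans (unif N t Mt) hN.
exists h'; split=> //; apply/funext => t; have [Mt|nM] := pselect (M t); last first.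
  by rewrite g0// Op_off// /h'; case: asboolP.
apply/eqP; rewrite -subr_eq0; apply/eqP; apply: (@md_small_eq0 _ _ 1) => d d0.
have [N hN] := esm (kb * (2 / c) + 1) _ d0.
have c2 : 0 <= 2 / c * e N by rewrite mulr_ge0 ?divr_ge0 ?ltW.
have h1 := Op_dist c2 (unif N) Mt; have h2 := hq N t Mt; rewrite mdC in h2.
have := mdD (Op h' t - t (T (q N) - l *: q N)) (t (T (q N) - l *: q N) - g t).
rewrite addrA subrK; lra.
Qed.

Lemma check_resolvent :
  ~ fun_op_spectrum (shilov_boundary mul one) (check_alg mul one) (check_op mul one w U) l.
Proof.
have : forall g, exists h, chk g -> chk h /\ Op h = g.
  move=> g; have [cg|ncg] := pselect (chk g); last by exists g.
  by have [h hh] := chk_solve cg; exists h.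
move=> /choice[S hS] sp; apply: sp; exists S; split.
- by move=> g /hS[].
- exists c^-1 => g cg; have [cS OS] := hS g cg; rewrite shE.
  apply: (supnorm_le ba ss) => t Mt; rewrite ler_pdivlMl//; apply: chk_low Mt => // u Mu.
  rewrite OS; have [D hD] := chk_bound cg; exact: (supnorm_ge hD).
- move=> g cg; have [cS OS] := hS _ (chk_op cg).
  change (S (Op g) = g); apply/funext => t; have [Mt|nM] := pselect (M t); last first.
    by have /chkP[-> //] := cS; have /chkP[-> //] := cg.
  apply/eqP; rewrite -subr_eq0 -md_eq0 eq_le md_ge0 andbT -(pmulr_rle0 _ c0).
  apply: (chk_low (chk_sub cS cg)) Mt => u Mu.
  have -> : Op (fun t => S (Op g) t - g t) u = Op (S (Op g)) u - Op g u.
    by rewrite !OpE//; ring.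
  by rewrite OS subrr md0.
- by move=> g /hS[].
Qed.

End CheckAlgebra.

(** * Roots on the unit circle *)

Section UnitCircle.
Variable R : realType.
Implicit Types u v z : Cx R.

Lemma unit_sqrt u : md u = 1 -> exists2 v, v ^+ 2 = u & md v = 1.
Proof.
move=> u1; exists (sqrtc (u : R[i])); first exact: sqr_sqrtc.
set v := sqrtc _; have h : md v ^+ 2 = 1 by rewrite -mdX /v -u1; congr md; exact: sqr_sqrtc.
by apply/eqP; rewrite -sqrp_eq1 ?md_ge0// h.
Qed.

Lemma md_parallelogram z : md (z + 1) ^+ 2 + md (z - 1) ^+ 2 = 2 * md z ^+ 2 + 2.
Proof.
have E (a b : R) : md (Complex a b : Cx R) ^+ 2 = a ^+ 2 + b ^+ 2.
  by rewrite /md normc_def /= sqr_sqrtr// addr_ge0 ?sqr_ge0.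
case: z => a b; rewrite -[1]/(Complex 1 0).
have -> : (Complex a b + Complex 1 0 : Cx R) = Complex (a + 1) (b + 0) by [].
have -> : (Complex a b - Complex 1 0 : Cx R) = Complex (a - 1) (b - 0) by [].
by rewrite !E; ring.
Qed.

(** [|v - 1|^2] and [|v + 1|^2] have product [|u - 1|^2] and sum 4, so one of them is at least 2;
    the sign of [v] makes it the second. *)
Lemma unit_sqrt_near u : md u = 1 -> exists v, [/\ v ^+ 2 = u, md v = 1 &
  md (v - 1) ^+ 2 <= md (u - 1) ^+ 2 / 2].
Proof.
move=> u1; have [v vu v1] := unit_sqrt u1.
have := md_parallelogram v; rewrite v1 expr1n mulr1 => P.
have F : md (u - 1) ^+ 2 = md (v - 1) ^+ 2 * md (v + 1) ^+ 2.
  by rewrite -exprMn -mdM -vu; congr (md _ ^+ 2); ring.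
have p1 : 0 <= md (v - 1) ^+ 2 by rewrite exprn_ge0 ?md_ge0.
have p2 : 0 <= md (v + 1) ^+ 2 by rewrite exprn_ge0 ?md_ge0.
have [h|h] := leP 2 (md (v + 1) ^+ 2).
  by exists v; split=> //; rewrite F; nra.
exists (- v); split; rewrite ?sqrrN ?mdN//.
have -> : md (- v - 1) = md (v + 1) by rewrite -opprD mdN.
by rewrite F; nra.
Qed.

Lemma unit_root_near u (d : R) : md u = 1 -> 0 < d ->
  exists v n, [/\ md v = 1, v ^+ n = u & md (v - 1) <= d].
Proof.
move=> u1 d0.
have step k : exists v n, [/\ md v = 1, v ^+ n = u & md (v - 1) ^+ 2 <= 4 * 2^-1 ^+ k].
  elim: k => [|k [v [n [v1 vn hv]]]].
    exists u, 1%N; split=> //; rewrite expr0 mulr1.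
    have := mdB u 1; rewrite u1 md1 => h.
    have -> : 4 = 2 ^+ 2 :> R by rewrite -natrX.
    by rewrite lerXn2r ?nnegrE ?md_ge0//; lra.
  have [v' [v'v v'1 h]] := unit_sqrt_near v1.
  exists v', (2 * n)%N; split=> //; first by rewrite exprM v'v.
  by rewrite [2^-1 ^+ k.+1]exprS; lra.
have d2 : 0 < d ^+ 2 by rewrite exprn_gt0.
have h0 : 0 <= 2^-1 :> R by rewrite invr_ge0.
have h1 : 2^-1 < 1 :> R by rewrite invf_lt1// ltr1n.
have [N hN] := geometric_small 4 h0 h1 d2.
have [v [n [v1 vn h]]] := step N; exists v, n; split=> //.
rewrite -(@ler_pXn2r _ 2) ?nnegrE ?md_ge0 ?(ltW d0)//.
exact: le_trans h (hN N (leqnn N)).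
Qed.

End UnitCircle.

(** * Dense range along the circle and for powers *)

Section ApproxSurjectivity.
Variables (R : realType) (A : completeNormedModType (Cx R)).
Variables (mul : A -> A -> A) (one : A).
Hypothesis ba : is_comm_banach_alg mul one.
Hypothesis ss : semisimple mul one.
Local Notation chi := (is_character mul one).
Variables (U V : A -> A) (w : A) (beta : nat).
Hypothesis au : aut mul one U V.
Let B : R := 2 ^+ beta.
Hypothesis hB : forall x, chi x -> B^-1 <= md (x w) <= B.
Let W := wop mul w U.
Local Notation sn := (sn mul one).
Let lW : lin W. Proof. exact: (wop_lin ba w (aut_lin au)). Qed.

Definition approx_onto (S : A -> A) (z : Cx R) :=
  forall f (e : R), 0 < e -> exists q, sn (S q - z *: q - f) <= e.

Variable c : R.
Hypotheses (c0 : 0 < c) (low : forall z, md z = 1 -> forall g, c * sn g <= sn (W g - z *: g)).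

(** Solving for the residual [r] at [z] up to a quarter gives a correction of norm at most
    [5 / (4 c)] times that of [r]; moving to [z'] adds [5/16], and [1/4 + 5/16 < 3/4] is a
    contraction. *)
Lemma approx_onto_step z z' : approx_onto W z -> md z = 1 -> md (z' - z) <= c / 4 ->
  approx_onto W z'.
Proof.
move=> aw z1 zz f e e0.
have step k : exists q, sn (W q - z' *: q - f) <= sn f * (3 / 4) ^+ k.
  elim: k => [|k [q hq]].
    by exists 0; rewrite (lin_zero lW) scaler0 !subr0 sub0r snN// expr0 mulr1.
  set r := f - (W q - z' *: q); have r0 : 0 <= sn r by exact: sn_ge0.
  rewrite snC// -/r in hq.
  have [r00|rn] := eqVneq (sn r) 0.
    by exists q; rewrite snC// -/r r00 mulr_ge0 ?sn_ge0// exprn_ge0.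
  have rp : 0 < sn r / 4 by rewrite divr_gt0// lt_neqAle eq_sym rn.
  have [u hu] := aw r _ rp.
  have cu : c * sn u <= sn r * (5 / 4).
    apply: le_trans (low z1 u) _; have := snD ba ss (W u - z *: u - r) r; rewrite subrK; lra.
  exists (q + u).
  have -> : W (q + u) - z' *: (q + u) - f = (W u - z *: u - r) - (z' - z) *: u.
    have -> := lin_add (lin_shift z' lW) q u.
    have -> : W u - z' *: u = (W u - z *: u) - (z' - z) *: u.
      by rewrite scalerBl opprB addrA subrK.
    rewrite /r; move: (W q - z' *: q) (W u - z *: u) ((z' - z) *: u) => P Y D.
    by rewrite opprB [RHS]addrAC (addrC P) addrA.
  apply: le_trans (snB ba ss _ _) _; rewrite snZ//.
  have := ler_pM (md_ge0 _) (sn_ge0 ba ss u) zz (lexx _).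
  rewrite exprS; lra.
have [||N hN] := @geometric_small R (3/4) (sn f) e _ _ e0; [lra|lra|].
by have [q hq] := step N; exists q; apply: le_trans hq (hN N _).
Qed.

(** A root [v] of [z] near 1 gives the chain [1, v, v^2, ...] with steps of length at most
    [c / 4]. *)
Lemma approx_onto_circle : approx_onto W 1 -> forall z, md z = 1 -> approx_onto W z.
Proof.
move=> a1 z z1; have d0 : 0 < c / 4 by rewrite divr_gt0.
have [v [n [v1 <- vd]]] := unit_root_near z1 d0.
elim: n => [|n IH]; first by rewrite expr0.
apply: approx_onto_step IH _ _; first by rewrite mdX v1 expr1n.
by rewrite exprS -[X in _ - X]mul1r -mulrBl mdM mdX v1 expr1n mulr1.
Qed.

(** [W^(2 n) - s^2 = (W^n - s)(W^n + s)]; both square roots occur, so the induction carries the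
    whole circle. *)
Lemma approx_onto_pow : approx_onto W 1 ->
  forall j z, md z = 1 -> approx_onto (iter (2 ^ j) W) z.
Proof.
move=> a1; elim=> [|j IH] z z1; first by rewrite expn0; exact: approx_onto_circle.
have [s sz s1] := unit_sqrt z1; move=> f e e0.
set n := (2 ^ j)%N in IH.
have B0 : 0 < B by rewrite exprn_gt0.
have kp : 0 < B ^+ n + 1 by rewrite addr_gt0// exprn_gt0.
have e2 : 0 < e / 2 by rewrite divr_gt0.
have e3 : 0 < e / 2 / (B ^+ n + 1) by rewrite divr_gt0.
have [u hu] := IH s s1 f _ e2.
have [q hq] := IH (- s) (etrans (mdN s) s1) u _ e3.
exists q; set d := _ - _ - u in hq.
have lWn : lin (iter n W) by exact: lin_iter.
have E : iter (2 ^ j.+1) W q - z *: q = iter n W (d + u) - s *: (d + u).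
  rewrite /d subrK scaleNr opprK (lin_add lWn) (lin_scale lWn) expnS mul2n -addnn iterD.
  by rewrite scalerDr scalerA -expr2 sz opprD addrA addrK.
have -> : iter (2 ^ j.+1) W q - z *: q - f = (iter n W d - s *: d) + (iter n W u - s *: u - f).
  by have /= E2 := lin_add (lin_shift s lWn) d u; rewrite E E2 -addrA.
apply: le_trans (snD ba ss _ _) _.
have h1 : sn (iter n W d - s *: d) <= (B ^+ n + 1) * sn d.
  apply: le_trans (snB ba ss _ _) _; rewrite snZ// s1 mulrDl lerD2r.
  exact: (sn_iter_wop ba ss au hB).
have := ler_wpM2l (ltW kp) hq; rewrite [in leRHS]mulrCA mulfV ?gt_eqF// mulr1; lra.
Qed.

End ApproxSurjectivity.

(** * Invariant partition into contracting and expanding points *)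

Section Partition.
Variables (R : realType) (A : completeNormedModType (Cx R)).
Variables (mul : A -> A -> A) (one : A).
Hypothesis ba : is_comm_banach_alg mul one.
Hypothesis ss : semisimple mul one.
Local Notation chi := (is_character mul one).
Local Notation sn := (sn mul one).
Variables (U V : A -> A) (w : A).
Hypothesis au : aut mul one U V.
Let av := aut_sym au.
Let W := wop mul w U.
Let wk := wn mul one w U.
Let al (t : A -> Cx R) : R := md (t w).
Let an n (t : A -> Cx R) : R := md (t (wk n)).
Hypothesis dich : forall t, chi t -> al t <= 1 / 2 \/ 2 <= al (sh V 1 t).
Hypothesis onto : forall j, approx_onto mul one (iter (2 ^ j) W) 1.

(** The second alternative of the dichotomy at [phi x] is a statement about [x], so a weight below 2
    at [x] forces contraction from [phi x] on. *)
Let fwd x k : chi x -> al x < 2 -> al (sh U k.+1 x) <= 1 / 2.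
Proof.
move=> cx; elim: k x cx => [|k IH] x cx h.
  case: (dich (chi_sh 1 au cx)) => //; rewrite (shK _ _ av) => h2.
  by have := lt_le_trans h h2; rewrite ltxx.
have := IH _ (chi_sh 1 au cx); rewrite shD addn1; apply.
case: (dich (chi_sh 1 au cx)) => [h1|]; first by rewrite (le_lt_trans h1)//; lra.
by rewrite (shK _ _ av) => h2; have := lt_le_trans h h2; rewrite ltxx.
Qed.

Let bwd x k : chi x -> 1 / 2 < al x -> 2 <= al (sh V k.+1 x).
Proof.
have one_step y : chi y -> 1 / 2 < al y -> 2 <= al (sh V 1 y).
  by move=> cy h; case: (dich cy) => // h2; have := lt_le_trans h h2; rewrite ltxx.
move=> cx h; elim: k => [|k IH]; first exact: one_step.
rewrite -(shD V 1 k.+1 x); apply: one_step; first exact: chi_sh av cx.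
by rewrite (lt_le_trans _ IH)//; lra.
Qed.

Let an_small n t : chi t -> al t <= 1 / 2 -> an n t <= 2^-1 ^+ n.
Proof.
move=> ct h; rewrite /an /wk (ch_wn _ _ _ ct) md_prod.
rewrite -[n in leRHS]card_ord -prodr_const; apply: ler_prod => i _; rewrite md_ge0 /=.
case: i => -[|i] hi /=; first by rewrite -/(al t); lra.
have : al t < 2 by lra.
by move=> /(fwd i ct); rewrite /al /sh /=; lra.
Qed.

Let an_big n t : chi t -> 1 / 2 < al t -> 2 ^+ n <= an n (sh V n t).
Proof.
move=> ct h; rewrite /an /wk (ch_wn _ _ _ (chi_sh n av ct)) md_prod.
rewrite -[n in leLHS]card_ord -prodr_const; apply: ler_prod => i _; rewrite ler0n /=.
have -> : sh V n t (iter i U w) = sh V (n - i).-1.+1 t w.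
  have ni : (n - i).-1.+1 = (n - i)%N by rewrite prednK// subn_gt0.
  rewrite ni -{1}(subnKC (ltnW (ltn_ord i))) -shD.
  by have := shK i (sh V (n - i) t) au => /(congr1 (@^~ w)).
exact: bwd.
Qed.

(** Both estimates on [q] have errors involving [sn q], which is unknown in advance. The two cases
    cover all characters and give [sn q <= 2 + sn q / 2], hence [sn q <= 4]; the factor 12 then
    makes [6 * 2^-n <= d / 2]. *)
Let key (d : R) : 0 < d -> d <= 1 -> exists q n, [/\ (1 < n)%N, 2^-1 ^+ n <= d,
  forall t, chi t -> md (t (wk n) * sh U n t q - t q + 1) <= d,
  forall t, chi t -> al t <= 1 / 2 -> md (t q - 1) <= d &
  forall t, chi t -> 1 / 2 < al t -> md (t q) <= d].
Proof.
move=> d0 d1.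
have h0 : 0 <= 2^-1 :> R by rewrite invr_ge0.
have h1 : 2^-1 < 1 :> R by rewrite invf_lt1// ltr1n.
have [N hN] := geometric_small 12 h0 h1 d0.
pose n := (2 ^ N.+1)%N.
have n1 : (1 < n)%N by rewrite /n expnS; have : (0 < 2 ^ N)%N; [rewrite expn_gt0|clear; lia].
have Nn : (N <= n)%N by rewrite ltnW// (leq_trans _ (ltnW (ltn_expl _ _))).
have hn := hN n Nn.
pose y : R := 2^-1 ^+ n; rewrite -/y in hn.
have y0 : 0 <= y by rewrite exprn_ge0.
have yh : y <= 1 / 2.
  rewrite /y; apply: (@le_trans _ _ (2^-1 ^+ 1)); last by rewrite expr1; lra.
  by rewrite ler_wiXn2l ?(ltW h1)// ltnW.
have e0 : 0 < d / 2 by rewrite divr_gt0.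
have [q hq] := onto N.+1 (- one) e0; rewrite -/n scale1r opprK in hq.
have eq t : chi t -> md (t (wk n) * sh U n t q - t q + 1) <= d / 2.
  move=> ct; have := sn_ge ba (iter n W q - q + one) ct.
  rewrite (chD _ _ ct) (chB _ _ ct) (ch1 ct) (ch_wop ba _ _ _ au ct) => h.
  exact: le_trans h hq.
have q0 : 0 <= sn q by exact: sn_ge0.
have E1 t : chi t -> al t <= 1 / 2 -> md (t q - 1) <= d / 2 + y * sn q.
  move=> ct h; have := eq t ct; have a1 := an_small n ct h.
  have := ler_pM (md_ge0 _) (md_ge0 _) a1 (sn_ge ba q (chi_sh n au ct)).
  rewrite -mdM -/y.
  have := md_dist (t q - 1) (t (wk n) * sh U n t q); rewrite mdC.
  have -> : t (wk n) * sh U n t q - (t q - 1) = t (wk n) * sh U n t q - t q + 1 by ring.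
  lra.
have E2 t : chi t -> 1 / 2 < al t -> md (t q) <= y * (sn q + 1 + d / 2).
  move=> ct h; have cs := chi_sh n av ct; have := eq _ cs; have a1 := an_big n ct h.
  rewrite (shK _ _ au); set s := sh V n t in cs *.
  have := md_dist (s (wk n) * t q) (s q - 1); rewrite mdM.
  have -> : s (wk n) * t q - (s q - 1) = s (wk n) * t q - s q + 1 by ring.
  have := mdB (s q) 1; rewrite md1; have := sn_ge ba q cs.
  have := ler_wpM2r (md_ge0 (t q)) a1; rewrite /y exprVn -/(an n s) => h2 h3 h4 h5 h6.
  rewrite ler_pdivlMl ?exprn_gt0//; rewrite /an in h2; lra.
have q4 : sn q <= 4.
  have : sn q <= 2 + sn q / 2.
    apply: (sn_le ba ss) => t ct; have [h|h] := leP (al t) (1 / 2).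
      have := E1 t ct h; have := md_dist (t q) 1; rewrite md1; have := ler_wpM2r q0 yh; lra.
    have p : 0 <= sn q + 1 + d / 2 by lra.
    have := E2 t ct h; have := ler_wpM2r p yh; lra.
  lra.
exists q, n; split=> // [||t ct h|t ct h].
- by rewrite -/y; lra.
- by move=> t ct; have := eq t ct; lra.
- have := E1 t ct h; have := ler_wpM2l y0 q4; lra.
- have := E2 t ct h; have p : sn q + 1 + d / 2 <= 6 by lra.
  by have := ler_wpM2l y0 p; lra.
Qed.

(** A weight strictly between 1/2 and 2 would make [q(t)] small and, the forward orbit contracting,
    [w_n(t)] small too; then [w_n(t) q(phi^n t) - q(t) + 1] could not be near 0. *)
Lemma weight_gap t : chi t -> al t <= 1 / 2 \/ 2 <= al t.
Proof.
move=> ct; have [h|h] := leP (al t) (1 / 2); first by left.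
right; rewrite leNgt; apply/negP => h2.
have [|//|q [n [n1 y1 eq E1 E2]]] := @key (1 / 100); [lra|lra|].
have c1 := chi_sh 1 au ct.
have f1 := fwd 0 ct h2.
have n0 : (n = 1 + n.-1)%N by clear -n1; lia.
have an1 : an n t <= 4 * 2^-1 ^+ n.
  rewrite /an {1}n0 /wk (ch_wnD _ _ _ au ct) mdM.
  have a1 := an_small n.-1 c1 f1.
  have -> : t (wn mul one w U 1) = t w by rewrite (ch_wn _ _ _ ct) big_ord1.
  have := ler_pM (md_ge0 _) (md_ge0 _) (ltW h2) a1 => h3; apply: le_trans h3 _.
  by rewrite {2}n0 exprD expr1; have : 0 <= 2^-1 ^+ n.-1 :> R; [rewrite exprn_ge0// invr_ge0|lra].
have an2 : an n t <= 4 / 100 by lra.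
have f2 := fwd n.-1 ct h2; rewrite prednK ?(ltnW n1)// in f2.
have q1 := E1 _ (chi_sh n au ct) f2; have := md_dist (sh U n t q) 1; rewrite md1 => q2.
have q3 : md (sh U n t q) <= 2 by lra.
have q4 := ler_pM (md_ge0 _) (md_ge0 _) an2 q3; rewrite -mdM in q4.
have q5 := E2 t ct h; have q6 := eq t ct.
have := mdD (t (wk n) * sh U n t q - t q + 1) (t q - t (wk n) * sh U n t q).
have -> : t (wk n) * sh U n t q - t q + 1 + (t q - t (wk n) * sh U n t q) = 1 by ring.
rewrite md1; have := mdB (t q) (t (wk n) * sh U n t q).
move=> a b; have : (0 : R) < 0 by lra.
by rewrite ltxx.
Qed.

(** Suppose expanding points [x] and [s = phi x] precede [t = phi s]. Then [q] is near 0 at [x] and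
    [s], and near 1 at [phi^n x] and [phi^n s], so [|w_n|] is near 1 at [x] and [s]. But
    [w(x) w_n(s) = w_n(x) w(phi^n x)], with [|w(x)| >= 2] and [|w(phi^n x)| <= 1/2]. *)
Lemma weight_inv t : chi t -> al t <= 1 / 2 -> al (sh U 1 t) <= 1 / 2 /\ al (sh V 1 t) <= 1 / 2.
Proof.
move=> ct h; split; first by apply: fwd => //; lra.
have cs := chi_sh 1 av ct; set s := sh V 1 t in cs *.
have st : sh U 1 s = t by rewrite /s (shK _ _ au).
rewrite leNgt; apply/negP => hs.
have s2 : 2 <= al s by case: (weight_gap cs) => // h2; have := lt_le_trans hs h2; rewrite ltxx.
have cx := chi_sh 1 av cs; set x := sh V 1 s in cx *.
have xs : sh U 1 x = s by rewrite /x (shK _ _ au).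
have x2 : 2 <= al x by exact: (bwd 0).
have [|//|q [n [n1 y1 eq E1 E2]]] := @key (1 / 100); [lra|lra|].
have t2 : al t < 2 by lra.
have fs k : al (sh U k.+1 s) <= 1 / 2.
  rewrite -(addn1 k) -shD st; case: k => [|k]; first by [].
  exact: fwd.
(* [n >= 2] places [phi^n x = phi^(n - 2) t] on the forward orbit of [t]. *)
have n0 : (n = n.-2.+2)%N by clear -n1; lia.
have fx : sh U n x = sh U n.-2.+1 s by rewrite {1}n0 -addn1 -shD xs.
have sE : md (sh U n s q - 1) <= 1 / 100.
  by apply: (E1 _ (chi_sh n au cs)); rewrite n0.
have xE : md (sh U n x q - 1) <= 1 / 100.
  by apply: (E1 _ (chi_sh n au cx)); rewrite fx.
have s0 := E2 s cs hs; have x0 : md (x q) <= 1 / 100 by apply: E2 => //; lra.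
have rel : al x * an n s = an n x * al (sh U n x).
  have := ch_wnD w 1 n au cx; rewrite addnC (ch_wnD w n 1 au cx).
  have -> : x (wn mul one w U 1) = x w by rewrite (ch_wn _ _ _ cx) big_ord1.
  have -> : sh U n x (wn mul one w U 1) = sh U n x w.
    by rewrite (ch_wn _ _ _ (chi_sh n au cx)) big_ord1.
  by rewrite xs /al /an => r; rewrite -!mdM -r.
have sl : 98 / 100 <= an n s * (101 / 100).
  have q1 : md (sh U n s q) <= 101 / 100 by have := md_dist (sh U n s q) 1; rewrite md1; lra.
  have q2 := ler_wpM2l (md_ge0 (s (wk n))) q1; rewrite -mdM in q2.
  have q6 := eq s cs.
  have := mdD (s (wk n) * sh U n s q - s q + 1) (s q - s (wk n) * sh U n s q).
  have -> : s (wk n) * sh U n s q - s q + 1 + (s q - s (wk n) * sh U n s q) = 1 by ring.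
  have := mdB (s q) (s (wk n) * sh U n s q); rewrite md1 /an; lra.
have xl : an n x * (99 / 100) <= 102 / 100.
  have q1 : 99 / 100 <= md (sh U n x q).
    by have := md_dist 1 (sh U n x q); rewrite mdC md1; lra.
  have q2 := ler_wpM2l (md_ge0 (x (wk n))) q1; rewrite -mdM in q2.
  have q6 := eq x cx.
  have := mdD (x (wk n) * sh U n x q - x q + 1) (x q - 1).
  have -> : x (wk n) * sh U n x q - x q + 1 + (x q - 1) = x (wk n) * sh U n x q by ring.
  have := mdB (x q) 1; rewrite md1 /an; lra.
have fxh : al (sh U n x) <= 1 / 2 by rewrite fx.
have a0 : 0 <= an n s by exact: md_ge0.
have b0 : 0 <= an n x by exact: md_ge0.
have r1 := ler_wpM2r a0 x2; have r2 := ler_wpM2l b0 fxh.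
have : (0 : R) < 0 by lra.
by rewrite ltxx.
Qed.

Lemma indicator_approx (e : R) : 0 < e -> exists f, forall t, chi t ->
  (al t <= 1 / 2 /\ md (t f - 1) <= e) \/ (2 <= al t /\ md (t f) <= e).
Proof.
move=> e0; pose d : R := Num.min e 1.
have d0 : 0 < d by rewrite lt_min e0 ltr01.
have d1 : d <= 1 by rewrite ge_min lexx orbT.
have [q [n [_ _ _ E1 E2]]] := key d0 d1.
have de : d <= e by rewrite ge_min lexx.
exists q => t ct; case: (weight_gap ct) => h; [left|right]; split=> //.
  by apply: le_trans de; exact: E1.
apply: le_trans de; apply: E2 => //; lra.
Qed.

End Partition.

(** * Bernstein sums and the product inequality *)

Section Bernstein.
Variables (R : realType) (A : completeNormedModType (Cx R)).
Variables (mul : A -> A -> A) (one : A).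
Hypothesis ba : is_comm_banach_alg mul one.
Hypothesis ss : semisimple mul one.
Local Notation chi := (is_character mul one).

Lemma char_ext f g : (forall x, chi x -> x f = x g) -> f = g.
Proof.
move=> h; apply/eqP; rewrite -subr_eq0; apply/eqP/ss => x cx.
by rewrite (chB _ _ cx) h// subrr.
Qed.

Definition pw (f : A) k := \big[mul/one]_(i < k) f.

Lemma ch_pw x f k : chi x -> x (pw f k) = x f ^+ k.
Proof. by move=> cx; rewrite /pw (ch_big _ _ _ cx) prodr_const card_ord. Qed.

(* Upper half of the binomial expansion of [(f + (1 - f))^(2n+1)]: it is exponentially
   close to [1] (resp. [0]) where [f] is close to [1] (resp. [0]). *)
Definition bern (n : nat) (f : A) : A :=
  \sum_(k < n.*2.+2 | (n < k)%N)
    'C(n.*2.+1, k)%:R *: mul (pw f k) (pw (one - f) (n.*2.+1 - k)).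

Lemma ch_bern x n f : chi x -> x (bern n f) =
  \sum_(k < n.*2.+2 | (n < k)%N) 'C(n.*2.+1, k)%:R * (x f ^+ k * (1 - x f) ^+ (n.*2.+1 - k)).
Proof.
move=> cx; rewrite /bern (ch_sum _ _ _ cx); apply: eq_bigr => k _.
by rewrite (chZ _ _ cx) (chM _ _ cx) !ch_pw// (chB _ _ cx) (ch1 cx).
Qed.

Lemma bern_aut U V k n f : aut mul one U V -> iter k U (bern n f) = bern n (iter k U f).
Proof.
move=> au; apply: char_ext => x cx.
rewrite (ch_bern _ _ cx); have := ch_bern n f (chi_sh k au cx).
by rewrite /sh.
Qed.

(** The upper half for [1 - f] is the lower half for [f] read backwards; the degree [2 n + 1] is
    odd, so there is no middle term. *)
Lemma bern_compl n f : bern n f + bern n (one - f) = one.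
Proof.
apply: char_ext => x cx; rewrite (chD _ _ cx) !ch_bern// (chB _ _ cx) (ch1 cx).
set N := n.*2.+1; set a := x f.
have -> : 1 - (1 - a) = a by ring.
rewrite [X in _ + X](reindex_inj rev_ord_inj) /=.
have E : (1 : Cx R) = \sum_(k < N.+1) 'C(N, k)%:R * (a ^+ k * (1 - a) ^+ (N - k)).
  transitivity (((1 - a) + a) ^+ N); first by rewrite subrK expr1n.
  by rewrite exprDn; apply: eq_bigr => k _; rewrite -mulr_natl mulrC; ring.
rewrite [RHS]E [RHS](bigID (fun k : 'I_N.+1 => (n < k)%N)) /=; congr (_ + _).
apply: eq_big => [k|k _].
  have kN : (k < N.+1)%N by [].
  by rewrite subSS -leqNgt; clear -kN; move: kN; rewrite /N; lia.
have kN : (k <= N)%N by rewrite -ltnS.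
by rewrite subSS bin_sub// subKn// [X in _ * X = _]mulrC.
Qed.

Variable C : R.
Hypotheses (C0 : 0 < C)
  (prodI : forall (p : nat) (f : nat -> A) (S : R), (0 < p)%N ->
     (forall x, chi x -> forall j : 'I_p, \prod_(i < p | i != j) md (x (f i)) <= S) ->
     nrm (\big[mul/one]_(i < p) f i) <= C * (S * \sum_(i < p) nrm (f i))).

(** Majorants bounded below by [e] allow the omitted factor to be restored at the price [1 / e], so
    one bound on full products suffices. *)
Lemma nrm_prod_maj (s : seq nat) (F : nat -> A) (e S : R) : (0 < size s)%N -> 0 < e ->
  (forall x, chi x -> exists b : nat -> R,
     (forall i, i \in s -> md (x (F i)) <= b i /\ e <= b i) /\ \prod_(i <- s) b i <= S) ->
  nrm (\big[mul/one]_(i <- s) F i) <= C * (S / e * \sum_(i <- s) nrm (F i)).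
Proof.
move=> s0 e0 h; rewrite (big_nth 0%N) big_mkord.
rewrite [X in _ <= _ * (_ * X)](big_nth 0%N) [X in _ <= _ * (_ * X)]big_mkord.
apply: (prodI (f := fun i => F (nth 0%N s i)) s0) => x cx j; have [b [hb bS]] := h x cx.
rewrite (big_nth 0%N) big_mkord (bigD1 j)//= in bS.
have mem (i : 'I_(size s)) : nth 0%N s i \in s by rewrite mem_nth.
have p1 : \prod_(i < size s | i != j) md (x (F (nth 0%N s i))) <=
   \prod_(i < size s | i != j) b (nth 0%N s i).
  by apply: ler_prod => i _; rewrite md_ge0; case: (hb _ (mem i)).
have p0 : 0 <= \prod_(i < size s | i != j) md (x (F (nth 0%N s i))).
  by apply: prodr_ge0 => i _; exact: md_ge0.
rewrite ler_pdivlMr// mulrC; apply: le_trans bS.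
by apply: ler_pM => //; [exact: ltW|case: (hb _ (mem j))].
Qed.

Section Estimate.
Variables (U V : A -> A) (w : A) (n : nat) (f : A) (e B N : R).
Hypotheses (au : aut mul one U V) (e0 : 0 < e) (e1 : e <= 1 / 2) (B1 : 1 <= B)
  (hw : forall t, chi t -> md (t w) <= B)
  (hf : forall t, chi t -> (md (t f - 1) <= e /\ forall i, (i < n)%N -> md (t (iter i U w)) <= 1 / 2)
     \/ md (t f) <= e)
  (N1 : nrm f <= N) (N2 : nrm (one - f) <= N) (N3 : forall i, (i < n)%N -> nrm (iter i U w) <= N).

Let K := n.*2.+1.

Let term k : (k <= K)%N -> (n < k)%N ->
  nrm (mul (mul (pw f k) (pw (one - f) (K - k))) (wn mul one w U n)) <=
  C * (((1 + e) ^+ k * e ^+ (K - k) * 2^-1 ^+ n + e ^+ k * (1 + e) ^+ (K - k) * B ^+ n) / e *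
    ((K + n)%:R * N)).
Proof.
move=> kK nk.
have eB : e <= B by have := e1; have := B1; lra.
(* Code 0 stands for [f], 1 for [1 - f], and [i + 2] for the [i]-th factor of [w_n]. *)
pose F i := if i is i'.+1 then (if i' is i''.+1 then iter i'' U w else one - f) else f.
pose s := nseq k 0%N ++ nseq (K - k) 1%N ++ map (addn 2) (iota 0 n).
have prodE (T : comPzRingType) (b : nat -> T) : \prod_(i <- s) b i =
    b 0%N ^+ k * b 1%N ^+ (K - k) * \prod_(i < n) b i.+2.
  rewrite /s !big_cat /= big_map !big_nseq !iter_mulr !mulr1 mulrA; congr (_ * _).
  by rewrite -[n in iota 0 n]subn0 -/(index_iota 0 n) big_mkord.
have -> : mul (mul (pw f k) (pw (one - f) (K - k))) (wn mul one w U n) = \big[mul/one]_(i <- s) F i.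
  apply: char_ext => x cx; rewrite (ch_big _ _ _ cx) !(chM _ _ cx) !ch_pw// (ch_wn _ _ _ cx).
  by rewrite (prodE _ (fun i => x (F i))).
have sz : size s = (K + n)%N by rewrite /s !size_cat size_map !size_nseq size_iota addnA subnKC.
have s0 : (0 < size s)%N by rewrite sz.
have mem i : i \in s -> i = 0%N \/ i = 1%N \/ exists2 j, (j < n)%N & i = j.+2.
  rewrite /s !mem_cat => /or3P[/nseqP[-> _]|/nseqP[-> _]|/mapP[j]]; [by left|by right; left|].
  by rewrite mem_iota add0n /= => jn ->; right; right; exists j.
have ge0 : 0 <= e by exact: ltW.
have ge1 : 0 <= 1 + e by rewrite addr_ge0.
have BB : 0 <= B by rewrite (le_trans ler01).
set S := (1 + e) ^+ k * e ^+ (K - k) * 2^-1 ^+ n + e ^+ k * (1 + e) ^+ (K - k) * B ^+ n.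
have S1 : 0 <= (1 + e) ^+ k * e ^+ (K - k) * 2^-1 ^+ n.
  by rewrite mulr_ge0 ?exprn_ge0 ?invr_ge0// mulr_ge0 ?exprn_ge0.
have S2 : 0 <= e ^+ k * (1 + e) ^+ (K - k) * B ^+ n.
  by rewrite mulr_ge0 ?exprn_ge0// mulr_ge0 ?exprn_ge0.
apply: le_trans (nrm_prod_maj (e := e) (S := S) s0 e0 _) _.
  move=> x cx; case: (hf cx) => [[h1 h2]|h].
    exists (fun i => if i is i'.+1 then (if i' is i''.+1 then 2^-1 else e) else 1 + e); split.
      move=> i /mem[->|[->|[j jn ->]]] /=.
      - have := mdD (x f - 1) 1; rewrite subrK md1; split; lra.
      - by rewrite (chB _ _ cx) (ch1 cx) mdC.
      - by have h3 := h2 j jn; rewrite -[2^-1]mul1r.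
    rewrite prodE prodr_const card_ord /S; lra.
  exists (fun i => if i is i'.+1 then (if i' is i''.+1 then B else 1 + e) else e); split.
    move=> i /mem[->|[->|[j jn ->]]] /=.
    - by [].
    - rewrite (chB _ _ cx) (ch1 cx); have := mdB 1 (x f); rewrite md1; split; lra.
    - by split=> //; exact: (hw (chi_sh j au cx)).
  rewrite prodE prodr_const card_ord /S; lra.
rewrite ler_wpM2l ?(ltW C0)// ler_wpM2l ?divr_ge0 ?addr_ge0//.
apply: (@le_trans _ _ (\sum_(i <- s) N)).
  rewrite big_seq [leRHS]big_seq; apply: ler_sum => i /mem[->|[->|[j jn ->]]] //=.
  exact: N3.
by rewrite big_const_seq iter_addr_0 -sz count_predT mulr_natl.
Qed.

(** Where [f] is near 1 the monomials sum to at most [(e + (1 + e))^K]; where it is near 0, [k > n]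
    leaves at least [n + 1] small factors against at most [n] of size [1 + e]. *)
Lemma nrm_bern_weight : nrm (mul (bern n f) (wn mul one w U n)) <=
  C * (((1 + 2 * e) ^+ K * 2^-1 ^+ n + 2 ^+ K * (e ^+ n.+1 * (1 + e) ^+ n * B ^+ n)) / e *
    ((K + n)%:R * N)).
Proof.
have ge0 : 0 <= e by exact: ltW.
have ge1 : 0 <= 1 + e by rewrite addr_ge0.
have BB : 0 <= B by rewrite (le_trans ler01).
have N0 : 0 <= N by rewrite (le_trans (nrm_ge0 f)).
have mulC := ba_mulC ba.
rewrite mulC /bern (lin_sum (lin_mul ba _)); apply: le_trans (nrm_sum _ _ _) _.
pose Y : R := C * ((K + n)%:R * N) / e.
have Y0 : 0 <= Y by rewrite divr_ge0// mulr_ge0 ?(ltW C0)// mulr_ge0.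
pose a k : R := (1 + e) ^+ k * e ^+ (K - k) * 2^-1 ^+ n.
pose a' : R := e ^+ n.+1 * (1 + e) ^+ n * B ^+ n.
have a0 k : 0 <= a k by rewrite mulr_ge0 ?exprn_ge0 ?invr_ge0// mulr_ge0 ?exprn_ge0.
have a'0 : 0 <= a' by rewrite mulr_ge0 ?exprn_ge0// mulr_ge0 ?exprn_ge0.
apply: (@le_trans _ _ (\sum_(k < K.+1) 'C(K, k)%:R * (a k + a') * Y)).
  rewrite big_mkcond /=; apply: ler_sum => k _.
  case: ifP => [nk|_]; last by rewrite mulr_ge0// mulr_ge0// addr_ge0.
  have kK : (k <= K)%N by rewrite -ltnS.
  rewrite (lin_scale (lin_mul ba _)) nrmZ -[X in md X](rmorph_nat (real_complex R)) md_real ger0_norm//.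
  rewrite -mulrA ler_wpM2l// mulC; apply: le_trans (term kK nk) _.
  have -> : C * (((1 + e) ^+ k * e ^+ (K - k) * 2^-1 ^+ n + e ^+ k * (1 + e) ^+ (K - k) * B ^+ n) / e *
    ((K + n)%:R * N)) = ((1 + e) ^+ k * e ^+ (K - k) * 2^-1 ^+ n + e ^+ k * (1 + e) ^+ (K - k) * B ^+ n) * Y.
    by rewrite /Y; move: ((K + n)%:R) (_ + _) => y1 y2; field; rewrite gt_eqF.
  rewrite ler_wpM2r// lerD2l ler_wpM2r ?exprn_ge0// ler_pM ?exprn_ge0//.
    by rewrite ler_wiXn2l// (le_trans e1)//; lra.
  rewrite ler_weXn2l ?lerDl//; clear -nk; rewrite /K; lia.
rewrite -mulr_suml [leRHS](_ : _ = ((1 + 2 * e) ^+ K * 2^-1 ^+ n + 2 ^+ K * a') * Y); last first.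
  by rewrite /Y /a'; move: ((K + n)%:R) (e ^+ _ * _ * _) => y1 y2; field; rewrite gt_eqF.
rewrite ler_wpM2r//.
under eq_bigr do rewrite mulrDr.
rewrite big_split /= lerD//.
  rewrite (_ : 1 + 2 * e = e + (1 + e)); last by ring.
  rewrite exprDn mulr_suml; apply: ler_sum => k _.
  by rewrite /a -mulr_natl; rewrite le_eqVlt; apply/orP; left; apply/eqP; ring.
rewrite -mulr_suml ler_wpM2r ?a'0// (_ : 2 = 1 + 1)// exprDn; apply: ler_sum => k _.
by rewrite !expr1n mulr1.
Qed.

End Estimate.

Section Decay.
Variables (U V : A -> A) (w f : A) (e B G : R).
Hypotheses (au : aut mul one U V) (B1 : 1 <= B) (G1 : 1 <= G)
  (hw : forall t, chi t -> md (t w) <= B)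
  (gU : forall k g, nrm (iter k U g) <= G * (1 + 1 / 100) ^+ k * nrm g)
  (e0 : 0 < e) (eB : 64 * (e * B) = 1)
  (part : forall t, chi t -> (md (t w) <= 1 / 2 /\ md (t f - 1) <= e) \/ md (t f) <= e)
  (inv : forall t, chi t -> (md (sh U 1 t w) <= 1 / 2 <-> md (t w) <= 1 / 2)).

Let inv_iter k t : chi t -> (md (sh U k t w) <= 1 / 2 <-> md (t w) <= 1 / 2).
Proof.
move=> ct; elim: k => [|k IH] //; rewrite -(shD U 1 k t) inv//.
exact: chi_sh au ct.
Qed.

Let e64 : e <= 1 / 64.
Proof. by have := ler_wpM2l (ltW e0) B1; have := eB; lra. Qed.

Let q : R := 1 + 1 / 100.

(** Stated for [f'] to serve both [f] and its translate [U^n f]. *)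
Let base n (f' : A) (N : R) : nrm f' <= N -> nrm (one - f') <= N ->
  (forall i, (i < n)%N -> nrm (iter i U w) <= N) ->
  (forall t, chi t -> (md (t f' - 1) <= e /\ md (t w) <= 1 / 2) \/ md (t f') <= e) ->
  nrm (mul (bern n f') (wn mul one w U n)) <=
  C * (4 * (3 / 4) ^+ n / e * (301 * q ^+ n * N)).
Proof.
move=> N1 N2 N3 hf'.
have e12 : e <= 1 / 2 by have := e64; have := e0; lra.
have N0 : 0 <= N by rewrite (le_trans (nrm_ge0 f')).
have := @nrm_bern_weight U V w n f' e B N au e0 e12 B1 hw _ N1 N2 N3.
move=> /(_ _)/le_trans; apply.
  move=> t ct; case: (hf' t ct) => [[h1 h2]|]; [left|by right]; split=> // i _.
  by apply: (proj2 (inv_iter i ct)).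
rewrite ler_wpM2l ?(ltW C0)//.
have h1 : (1 + 2 * e) ^+ n.*2.+1 * 2^-1 ^+ n <= 2 * (3 / 4) ^+ n.
  rewrite exprS -muln2 mulnC exprM -mulrA -exprMn; apply: ler_pM.
  - by have := e64; have := e0; lra.
  - by rewrite exprn_ge0// divr_ge0// exprn_ge0//; have := e0; lra.
  - by have := e64; have := e0; lra.
  - rewrite lerXn2r ?nnegrE//; first by rewrite divr_ge0// exprn_ge0//; have := e0; lra.
    have := e64; have := e0; nra.
have h2 : 2 ^+ n.*2.+1 * (e ^+ n.+1 * (1 + e) ^+ n * B ^+ n) <= 2 * (3 / 4) ^+ n.
  have -> : 2 ^+ n.*2.+1 * (e ^+ n.+1 * (1 + e) ^+ n * B ^+ n) =
     2 * (e * (4 * (e * (1 + e) * B)) ^+ n).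
    rewrite (_ : 2 ^+ n.*2.+1 = 2 * 4 ^+ n :> R); last by rewrite exprS -muln2 mulnC exprM -natrX.
    rewrite [e ^+ n.+1]exprS !exprMn.
    ring.
  rewrite ler_pM2l// -[leRHS]mul1r; apply: ler_pM.
  - exact: ltW.
  - by rewrite exprn_ge0// !mulr_ge0 ?(ltW e0)//; have := e0; have := B1; lra.
  - by have := e64; have := e0; lra.
  - have h : 4 * (e * (1 + e) * B) <= 3 / 4.
      have -> : 4 * (e * (1 + e) * B) = (1 + e) / 16.
        have -> : 4 * (e * (1 + e) * B) = (1 + e) * (64 * (e * B)) / 16 by field.
        by rewrite eB mulr1.
      by have := e64; have := e0; lra.
    rewrite lerXn2r ?nnegrE//.
    by rewrite !mulr_ge0 ?(ltW e0)//; have := e0; have := B1; lra.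
(* The number of factors is [3 n + 1], and [q^n >= 1 + n / 100]. *)
have h3 : (n.*2.+1 + n)%:R <= 301 * q ^+ n.
  have b : 1 + n%:R * (1 / 100) <= q ^+ n.
    elim: (n) => [|k IH]; first by rewrite mul0r addr0 expr0.
    rewrite exprS; have k0 : 0 <= k%:R :> R by [].
    have q0 : 0 <= q by rewrite /q; lra.
    apply: le_trans (ler_wpM2l q0 IH); rewrite /q -natr1; move: (k%:R) k0 => y2 k0; lra.
  have -> : (n.*2.+1 + n)%:R = 3 * n%:R + 1 :> R.
    by rewrite -addnn -addn1 !natrD; ring.
  have n0 : 0 <= n%:R :> R by [].
  by move: b n0; move: (q ^+ n) (n%:R) => y1 y2; lra.
have p0 : 0 <= (3 / 4 : R) ^+ n by rewrite exprn_ge0//; lra.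
have h4 : ((1 + 2 * e) ^+ n.*2.+1 * 2^-1 ^+ n + 2 ^+ n.*2.+1 * (e ^+ n.+1 * (1 + e) ^+ n * B ^+ n)) / e
   <= 4 * (3 / 4) ^+ n / e.
  by rewrite ler_wpM2r ?invr_ge0 ?(ltW e0)//; lra.
apply: ler_pM => //.
- rewrite divr_ge0 ?(ltW e0)// addr_ge0// mulr_ge0 ?exprn_ge0 ?invr_ge0//.
  + by have := e0; lra.
  + rewrite !mulr_ge0 ?exprn_ge0 ?(ltW e0)//; have := e0; have := B1; lra.
- by rewrite mulr_ge0.
- by rewrite ler_wpM2r.
Qed.

(** Three factors [q^n] arise, from the number of factors, from the norms of translates of [w] and
    [f], and from [U^n h]; and [(3/4) q^3 < 4/5]. In the second estimate [T^n] acts on [bern n f],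
    which replaces [f] by [U^n f]. *)
Lemma bern_decay : exists2 Y : R, 0 <= Y & forall n h,
  nrm (mul (bern n f) (iter n (wop mul w U) h)) <= Y * (4 / 5) ^+ n * nrm h /\
  nrm (iter n (wop mul w U) (mul (bern n f) h)) <= Y * (4 / 5) ^+ n * nrm h.
Proof.
pose N0 : R := nrm f + nrm (one - f) + nrm w.
have N00 : 0 <= N0 by rewrite !addr_ge0 ?nrm_ge0.
pose Y : R := C * (4 / e * (301 * (G * N0))) * G.
have G0 : 0 <= G by rewrite (le_trans ler01).
have C0' := ltW C0; have e0' := ltW e0.
have q1 : 1 <= q by rewrite /q; lra.
have q0 : 0 <= q by rewrite (le_trans ler01).
have Y0 : 0 <= Y.
  by rewrite /Y mulr_ge0// mulr_ge0// mulr_ge0 ?divr_ge0// mulr_ge0// mulr_ge0.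
exists Y => // n h.
pose N : R := G * q ^+ n * N0.
have gN k g : (k <= n)%N -> nrm g <= N0 -> nrm (iter k U g) <= N.
  move=> kn gN; apply: le_trans (gU k g) _; rewrite /N -/q.
  apply: ler_pM => //; rewrite ?mulr_ge0 ?exprn_ge0 ?nrm_ge0//.
  by rewrite ler_wpM2l// ler_weXn2l.
have fN : nrm f <= N0 by rewrite /N0; have := nrm_ge0 (one - f); have := nrm_ge0 w; lra.
have f1N : nrm (one - f) <= N0 by rewrite /N0; have := nrm_ge0 f; have := nrm_ge0 w; lra.
have wN : nrm w <= N0 by rewrite /N0; have := nrm_ge0 f; have := nrm_ge0 (one - f); lra.
have mulA := ba_mulA ba; have mulC := ba_mulC ba.
have fin f' : nrm f' <= N -> nrm (one - f') <= N ->
  (forall t, chi t -> (md (t f' - 1) <= e /\ md (t w) <= 1 / 2) \/ md (t f') <= e) ->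
  nrm (mul (mul (bern n f') (wn mul one w U n)) (iter n U h)) <= Y * (4 / 5) ^+ n * nrm h.
  move=> n1 n2 hf'; apply: le_trans (nrm_mul ba _ _) _.
  have b1 := base n1 n2 (fun i (hi : (i < n)%N) => gN i w (ltnW hi) wN) hf'.
  apply: le_trans (ler_pM (nrm_ge0 _) (nrm_ge0 _) b1 (gU n h)) _; rewrite -/q.
  have q3 : (3 / 4) ^+ n * q ^+ n * q ^+ n * q ^+ n <= (4 / 5) ^+ n.
    rewrite -!exprMn lerXn2r ?nnegrE//; rewrite /q; lra.
  have -> : C * (4 * (3 / 4) ^+ n / e * (301 * q ^+ n * N)) * (G * q ^+ n * nrm h) =
    Y * ((3 / 4) ^+ n * q ^+ n * q ^+ n * q ^+ n) * nrm h.
    by rewrite /Y /N; ring.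
  by rewrite ler_wpM2r ?nrm_ge0// ler_wpM2l.
split.
  rewrite (iter_wop ba _ _ _ au) mulA; apply: fin.
  - exact: (gN 0%N).
  - exact: (gN 0%N).
  - by move=> t ct; case: (part ct) => [[]|]; [left|right].
rewrite (iter_wop ba _ _ _ au) (aut_mul (aut_iter n au)) mulA (mulC (wn _ _ _ _ _)).
rewrite (bern_aut _ _ _ au); apply: fin.
- exact: (gN n).
- have -> : one - iter n U f = iter n U (one - f).
    by rewrite (lin_sub (aut_lin (aut_iter n au))) (aut_one (aut_iter n au)).
  exact: (gN n).
- move=> t ct; case: (part (chi_sh n au ct)) => [[h1 h2]|]; [left|by right].
  by split=> //; apply/(inv_iter n ct).
Qed.

End Decay.
End Bernstein.

(** * From powers back to the operator *)

Section Resolvents.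
Variables (R : realType) (A : completeNormedModType (Cx R)) (T : A -> A).
Hypothesis lT : lin T.

Lemma not_op_spectrum_intro l (c : R) : (forall f, exists u, T u - l *: u = f) -> 0 < c ->
  (forall g, c * nrm g <= nrm (T g - l *: g)) -> ~ op_spectrum T l.
Proof.
move=> onto c0 low; apply; have [S hS] := choice onto.
have ls := lin_sub (lin_shift l lT).
exists S; split; [|split=> //].
  apply: (@lipschitz_continuous_nrm _ _ _ c^-1) => f g.
  by rewrite ler_pdivlMl//; have := low (S f - S g); rewrite ls !hS.
move=> f; apply/eqP; rewrite -subr_eq0 -nrm_eq0 eq_le nrm_ge0 andbT -(pmulr_rle0 _ c0).
by have := low (S (T f - l *: f) - f); rewrite ls hS subrr nrm0.
Qed.

(** [T^n - 1] is the product of [T - 1] and [1 + T + ... + T^(n - 1)] in either order. *)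
Lemma invertible_root n (b : R) : 0 <= b -> bdd b T ->
  (forall y, exists x, x - iter n T x = y) ->
  (exists2 c : R, 0 < c & forall g, c * nrm g <= nrm (g - iter n T g)) ->
  (forall y, exists x, T x - x = y) /\ exists2 c : R, 0 < c & forall g, c * nrm g <= nrm (T g - g).
Proof.
move=> b0 bT onto [c c0 low]; split.
  move=> y; have [x hx] := onto (- y); exists (\sum_(i < n) iter i T x).
  rewrite -[RHS]opprK -hx opprB (iter_sub_tele lT) (lin_sum lT) -sumrB; apply: eq_bigr => i _.
  by rewrite (lin_sub (lin_iter lT i)) -iterS -iterSr.
pose L : R := \sum_(i < n) b ^+ i.
have L0 : 0 <= L by apply: sumr_ge0 => i _; exact: exprn_ge0.
have L1 : 0 < L + 1 by rewrite ltr_wpDl.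
exists (c / (L + 1)); first by rewrite divr_gt0.
move=> g; rewrite mulrAC ler_pdivrMr//; apply: le_trans (low g) _.
rewrite nrmC (iter_sub_tele lT); apply: le_trans (nrm_sum _ _ _) _.
apply: (@le_trans _ _ (L * nrm (T g - g))).
  by rewrite mulr_suml; apply: ler_sum => i _; exact: bdd_iter.
by rewrite mulrC ler_wpM2l ?nrm_ge0// lerDl.
Qed.

End Resolvents.

(** * Approximate inverse of [1 - T^n] *)

Section Invert.
Variables (R : realType) (A : completeNormedModType (Cx R)).
Variables (mul : A -> A -> A) (one : A).
Hypothesis ba : is_comm_banach_alg mul one.
Hypothesis ss : semisimple mul one.
Local Notation chi := (is_character mul one).
Variable C : R.
Hypotheses (C0 : 0 < C)
  (prodI : forall (p : nat) (f : nat -> A) (S : R), (0 < p)%N ->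
     (forall x, chi x -> forall j : 'I_p, \prod_(i < p | i != j) md (x (f i)) <= S) ->
     nrm (\big[mul/one]_(i < p) f i) <= C * (S * \sum_(i < p) nrm (f i))).

Lemma bdd_wop U w (b : R) : bdd b U -> bdd (nrm w * b) (wop mul w U).
Proof.
move=> bU g; apply: le_trans (nrm_mul ba _ _) _.
by rewrite -mulrA ler_wpM2l ?nrm_ge0.
Qed.

Variables (U V : A -> A) (w v : A) (G : R).
Hypotheses (au : aut mul one U V) (wv : mul w v = one) (G1 : 1 <= G)
  (gU : forall k g, nrm (iter k U g) <= G * (1 + 1 / 100) ^+ k * nrm g)
  (gV : forall k g, nrm (iter k V g) <= G * (1 + 1 / 100) ^+ k * nrm g).
Let av := aut_sym au.
Let al (t : A -> Cx R) : R := md (t w).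
Hypotheses (gap : forall t, chi t -> al t <= 1 / 2 \/ 2 <= al t)
  (inv : forall t, chi t -> al t <= 1 / 2 -> al (sh U 1 t) <= 1 / 2 /\ al (sh V 1 t) <= 1 / 2)
  (ind : forall e : R, 0 < e -> exists f, forall t, chi t ->
    (al t <= 1 / 2 /\ md (t f - 1) <= e) \/ (2 <= al t /\ md (t f) <= e)).
(** The inverse of [w U] is again a weighted automorphism, [w' V]. *)
Let w' := V v.
Let T := wop mul w U.
Let Y := wop mul w' V.

Let TY h : T (Y h) = h.
Proof.
rewrite /T /Y /wop /w' (aut_mul au) !(aut_VK au) (ba_mulA ba) wv.
exact: (ba_mul1 ba).
Qed.

Let YT h : Y (T h) = h.
Proof.
rewrite /T /Y /wop /w' (aut_mul av) (aut_K au) (ba_mulA ba) -(aut_mul av).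
by rewrite (ba_mulC ba v) wv (aut_one av) (ba_mul1 ba).
Qed.

Let iterK (S S' : A -> A) n : cancel S' S -> cancel (iter n S') (iter n S).
Proof. by move=> k h; elim: n h => [|n IH] h //; rewrite [iter _ S' _]iterSr iterS IH k. Qed.

Let al' t : chi t -> md (t w') = (al (sh V 1 t))^-1.
Proof.
move=> ct; have c1 := chi_sh 1 av ct.
have E : sh V 1 t w * sh V 1 t v = 1 by rewrite -(chM _ _ c1) wv (ch1 c1).
have n0 : sh V 1 t w != 0.
  by apply/eqP => h; move: E; rewrite h mul0r => /eqP; rewrite eq_sym oner_eq0.
rewrite /al -mdV; congr md; by apply: (mulfI n0); rewrite mulfV// -E.
Qed.

Let not_both t : al t <= 1 / 2 -> 2 <= al t -> False.
Proof. move=> h1 h2; have : (0 : R) < 0 by lra. by rewrite ltxx. Qed.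

Let big_V t : chi t -> (2 <= al (sh V 1 t) <-> 2 <= al t).
Proof.
move=> ct; have c1 := chi_sh 1 av ct; split=> h.
  case: (gap ct) => // h2; have [_ h3] := inv ct h2; by have := not_both h3 h.
case: (gap c1) => // h2; have [h3 _] := inv c1 h2.
by rewrite (shK _ _ au) in h3; have := not_both h3 h.
Qed.

(** Inversion exchanges the two parts of the partition, so [bern_decay] applies to [Y] with
    [1 - f]. *)
Let small_w' t : chi t -> (md (t w') <= 1 / 2 <-> 2 <= al t).
Proof.
move=> ct; rewrite -(big_V ct) (al' ct) -[1 / 2]/(1 * 2^-1) mul1r.
have a0 : 0 < al (sh V 1 t).
  rewrite lt_neqAle md_ge0 andbT; apply/eqP => h.
  have := chM w v (chi_sh 1 av ct); rewrite wv (ch1 (chi_sh 1 av ct)) => /(congr1 (@md R)).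
  by rewrite md1 mdM -[md (sh V 1 t w)]/(al _) -h mul0r => /eqP; rewrite oner_eq0.
by rewrite lef_pV2 ?posrE.
Qed.

(** With [X = T^n] and [Z] its inverse, [(1 - X)(P - Z P') = 1 - X P - Z P'] and
    [(P - P' Z)(1 - X) = 1 - P X - P' Z], where [P + P' = 1]. Both remainders have norm at most 1/2;
    the first identity gives surjectivity, the second the lower bound. *)
Lemma power_invertible : exists n,
  (forall y, exists x, x - iter n T x = y) /\
  exists2 c : R, 0 < c & forall g, c * nrm g <= nrm (g - iter n T g).
Proof.
have [beta hB] := weight_bound ba wv.
pose B : R := 2 ^+ beta; rewrite -/B in hB.
have B0 : 0 < B by rewrite exprn_gt0.
have B1 : 1 <= B by rewrite exprn_ege1// ler1n.
(* With this [e], [(4 e (1 + e) B)^n] decays: smallness of [f] off the contracting part outweighs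
   both the weight [B^n] and the binomial factor [4^n]. *)
pose e : R := (64 * B)^-1.
have e0 : 0 < e by rewrite invr_gt0 mulr_gt0.
have eB : 64 * (e * B) = 1 by rewrite mulrCA mulVf// gt_eqF// mulr_gt0.
have [f hf] := ind e0.
have [Y1 Y10 d1] : exists2 Y1 : R, 0 <= Y1 & forall n h,
  nrm (mul (bern mul one n f) (iter n T h)) <= Y1 * (4 / 5) ^+ n * nrm h /\
  nrm (iter n T (mul (bern mul one n f) h)) <= Y1 * (4 / 5) ^+ n * nrm h.
  apply: (bern_decay ba ss C0 prodI au B1 G1 _ gU e0 eB).
  - by move=> t /hB/andP[].
  - by move=> t /hf[|[_ h]]; [left|right].
  - move=> t ct; split=> h; last by have [] := inv ct h.
    by have [_] := inv (chi_sh 1 au ct) h; rewrite (shK _ _ av).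
have [Y2 Y20 d2] : exists2 Y2 : R, 0 <= Y2 & forall n h,
  nrm (mul (bern mul one n (one - f)) (iter n Y h)) <= Y2 * (4 / 5) ^+ n * nrm h /\
  nrm (iter n Y (mul (bern mul one n (one - f)) h)) <= Y2 * (4 / 5) ^+ n * nrm h.
  apply: (bern_decay ba ss C0 prodI av B1 G1 _ gV e0 eB).
  - move=> t ct; rewrite (al' ct); have /andP[h _] := hB _ (chi_sh 1 av ct).
    by rewrite -[leRHS]invrK lef_pV2 ?posrE ?invr_gt0// (lt_le_trans _ h)// invr_gt0.
  - move=> t ct; rewrite (chB _ _ ct) (ch1 ct); case: (hf t ct) => [[h1 h2]|[h1 h2]].
      by right; rewrite mdC.
    left; split; first exact/(small_w' ct).
    by rewrite addrAC subrr add0r mdN.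
  - move=> t ct; rewrite (small_w' ct) (small_w' (chi_sh 1 av ct)).
    exact: big_V.
have q0 : 0 <= 4 / 5 :> R by lra.
have q1 : 4 / 5 < 1 :> R by lra.
have q4 : 0 < 1 / 4 :> R by lra.
have [N1 hN1] := geometric_small Y1 q0 q1 q4.
have [N2 hN2] := geometric_small Y2 q0 q1 q4.
pose n := maxn N1 N2; exists n.
have m1 := hN1 n (leq_maxl _ _); have m2 := hN2 n (leq_maxr _ _).
set p := bern mul one n f in d1; set p' := bern mul one n (one - f) in d2.
set bp := bern mul one n f; set bp' := bern mul one n (one - f).
pose X := iter n T; pose Z := iter n Y.
have XZ h : X (Z h) = h by exact: iterK.
have ZX h : Z (X h) = h by exact: iterK.
have pp h : mul bp h + mul bp' h = h.
  by rewrite -(ba_mulDl ba) /bp /bp' bern_compl// (ba_mul1 ba).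
have lX : lin X by exact: lin_iter (wop_lin ba _ (aut_lin au)) _.
have lZ : lin Z by exact: lin_iter (wop_lin ba _ (aut_lin av)) _.
have sm1 h : nrm (mul bp (X h)) <= 1 / 4 * nrm h /\ nrm (X (mul bp h)) <= 1 / 4 * nrm h.
  have [h1 h2] := d1 n h; have m := ler_wpM2r (nrm_ge0 h) m1.
  by split; [exact: le_trans h1 m|exact: le_trans h2 m].
have sm2 h : nrm (mul bp' (Z h)) <= 1 / 4 * nrm h /\ nrm (Z (mul bp' h)) <= 1 / 4 * nrm h.
  have [h1 h2] := d2 n h; have m := ler_wpM2r (nrm_ge0 h) m2.
  by split; [exact: le_trans h1 m|exact: le_trans h2 m].
have q10 : 0 <= G * (1 + 1 / 100) by rewrite mulr_ge0 ?(le_trans ler01 G1)//; lra.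
have [bX bX0 hX] : exists2 b : R, 0 <= b & bdd b X.
  exists ((nrm w * (G * (1 + 1 / 100))) ^+ n); first by rewrite exprn_ge0// mulr_ge0 ?nrm_ge0.
  apply: bdd_iter; first by rewrite mulr_ge0 ?nrm_ge0.
  by apply: bdd_wop => g; exact: (gU 1).
have [bZ bZ0 hZ] : exists2 b : R, 0 <= b & bdd b Z.
  exists ((nrm w' * (G * (1 + 1 / 100))) ^+ n); first by rewrite exprn_ge0// mulr_ge0 ?nrm_ge0.
  apply: bdd_iter; first by rewrite mulr_ge0 ?nrm_ge0.
  by apply: bdd_wop => g; exact: (gV 1).
change ((forall y, exists x, x - X x = y) /\
  exists2 c : R, 0 < c & forall g, c * nrm g <= nrm (g - X g)).
clearbody X Z bp bp'.
pose K : R := nrm bp + bZ * nrm bp' + nrm bp' * bZ.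
have K0 : 0 <= K by rewrite !addr_ge0 ?mulr_ge0 ?nrm_ge0.
split.
  pose S h := h - X h.
  have lS : lin S by move=> a x y; rewrite /S lX scalerBr opprD addrACA.
  have bS : bdd (1 + bX) S.
    by move=> h; rewrite mulrDl mul1r (le_trans (nrmB _ _))// lerD2l.
  have h0 : 0 <= 1 / 2 :> R by lra.
  have h1 : 1 / 2 < 1 :> R by lra.
  have b1 : 0 <= 1 + bX by rewrite addr_ge0.
  move=> y; have [|x [hx _]] := approx_surj lS b1 bS h0 h1 K0 _ y; last by exists x.
  move=> z; exists (mul bp z - Z (mul bp' z)); split.
    have -> : z - S (mul bp z - Z (mul bp' z)) = X (mul bp z) + Z (mul bp' z).
      rewrite /S (lin_sub lX) XZ -{1}(pp z).
      move: (mul bp z) (mul bp' z) (Z _) (X _) => a b c d.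
      have -> : a - c - (d - b) = (a + b) - (d + c) by rewrite opprB addrACA -opprD (addrC c).
      by rewrite opprB addrC subrK.
    have [_ s1] := sm1 z; have [_ s2] := sm2 z; have := nrmD (X (mul bp z)) (Z (mul bp' z)); lra.
  apply: le_trans (nrmB _ _) _.
  have n1 := nrm_mul ba bp z; have n2 := le_trans (hZ _) (ler_wpM2l bZ0 (nrm_mul ba bp' z)).
  have n3 : 0 <= nrm bp' * bZ * nrm z by rewrite !mulr_ge0 ?nrm_ge0.
  rewrite /K; lra.
have K1 : 0 < 2 * K + 1 by lra.
exists (2 * K + 1)^-1; first by rewrite invr_gt0.
move=> h; rewrite ler_pdivrMl//.
have E : h = (mul bp (h - X h) - mul bp' (Z (h - X h))) + (mul bp (X h) + mul bp' (Z h)).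
  rewrite (lin_sub (lin_mul ba bp)) (lin_sub lZ) ZX (lin_sub (lin_mul ba bp')) -{1}(pp h).
  move: (mul bp h) (mul bp' h) (mul bp' (Z h)) (mul bp (X h)) => a b c d.
  have -> : a - d - (c - b) = (a + b) - (d + c) by rewrite opprB addrACA -opprD.
  by rewrite subrK.
have n1 := nrm_mul ba bp (h - X h).
have n2 := le_trans (nrm_mul ba bp' _) (ler_wpM2l (nrm_ge0 bp') (hZ (h - X h))).
have n3 : 0 <= bZ * nrm bp' * nrm (h - X h) by rewrite !mulr_ge0 ?nrm_ge0.
have [s1 _] := sm1 h; have [s2 _] := sm2 h.
have := nrmD (mul bp (h - X h) - mul bp' (Z (h - X h))) (mul bp (X h) + mul bp' (Z h)).
rewrite -E; have := nrmB (mul bp (h - X h)) (mul bp' (Z (h - X h))).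
have := nrmD (mul bp (X h)) (mul bp' (Z h)); have := nrm_ge0 (h - X h); rewrite /K; lra.
Qed.

End Invert.

(** * Transfer between the two norms *)

Section Transfer.
Variables (R : realType) (A : completeNormedModType (Cx R)).
Variables (mul : A -> A -> A) (one : A).
Hypothesis ba : is_comm_banach_alg mul one.
Hypothesis ss : semisimple mul one.
Hypothesis reg : regular mul one.
Local Notation chi := (is_character mul one).
Local Notation sn := (sn mul one).
Variable C : R.
Hypotheses (C0 : 0 < C)
  (prodI : forall (p : nat) (f : nat -> A) (S : R), (0 < p)%N ->
     (forall x, chi x -> forall j : 'I_p, \prod_(i < p | i != j) md (x (f i)) <= S) ->
     nrm (\big[mul/one]_(i < p) f i) <= C * (S * \sum_(i < p) nrm (f i))).
Hypothesis pk : all_peak_points mul one.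
Variables (U V : A -> A).
Hypothesis au : aut mul one U V.
Hypothesis dens : forall t (fs : seq A) (e : R), chi t -> 0 < e ->
  exists s, [/\ chi s, forall k, (0 < k)%N -> sh U k s <> s & forall f, f \in fs -> md (s f - t f) < e].
Hypothesis growth : forall e : R, 0 < e -> exists2 G : R, 1 <= G &
  (forall k f, nrm (iter k U f) <= G * (1 + e) ^+ k * nrm f) /\
  (forall k f, nrm (iter k V f) <= G * (1 + e) ^+ k * nrm f).

Let amax f : exists2 x, chi x & forall y, chi y -> md (y f) <= md (x f).
Proof. exact: (max_attained ba f (max_ideal_space_neq0 ba ss)). Qed.

Let exchi : exists x, chi x. Proof. exact: (max_ideal_space_neq0 ba ss). Qed.

Lemma dichotomy_nrm w v (c : R) : mul w v = one -> 0 < c ->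
  (forall g, c * nrm g <= nrm (wop mul w U g - g)) -> exists i, dichotomy_at mul one U V w (2 ^ i).
Proof.
move=> wv c0 low; have [beta hB] := weight_bound ba wv.
exact: (dichotomy_exists ba au hB (@nrm_ge0 _ _) (@nrmD _ _) (@nrmZ _ _)
  (fun x f cx => char_le_nrm ba f cx) (ltW C0) prodI c0 low amax
  (peak_functions ba ss reg pk) dens growth exchi).
Qed.

Lemma dichotomy_sup w v (c : R) : mul w v = one -> 0 < c ->
  (forall g, c * sn g <= sn (wop mul w U g - g)) -> exists i, dichotomy_at mul one U V w (2 ^ i).
Proof.
move=> wv c0 low; have [beta hB] := weight_bound ba wv.
(* Translation along orbits does not increase the sup norm, so [G = 1] works. *)
have gs (e : R) : 0 < e -> exists2 G : R, 1 <= G &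
  (forall k f, sn (iter k U f) <= G * (1 + e) ^+ k * sn f) /\
  (forall k f, sn (iter k V f) <= G * (1 + e) ^+ k * sn f).
  move=> e0; exists 1 => //.
  have le k f : sn f <= 1 * (1 + e) ^+ k * sn f.
    by rewrite mul1r ler_peMl ?sn_ge0// exprn_ege1// lerDl ltW.
  split=> k f; apply: le_trans (le k f); first exact: (sn_aut ba ss k f au).
  exact: (sn_aut ba ss k f (aut_sym au)).
exact: (dichotomy_exists ba au hB (sn_ge0 ba ss) (snD ba ss) (snZ ba ss)
  (fun x f cx => sn_ge ba f cx) ler01 (sn_prod ba ss) c0 low amax
  (peak_functions ba ss reg pk) dens gs exchi).
Qed.

Lemma sup_low_circle w v N : mul w v = one -> dichotomy_at mul one U V w N ->
  exists2 c : R, 0 < c & forall z, md z = 1 -> forall g, c * sn g <= sn (wop mul w U g - z *: g).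
Proof.
move=> wv dN; have [beta hB] := weight_bound ba wv.
pose L : R := 2 * \sum_(i < N) (2 ^+ beta) ^+ i.
have L0 : 0 <= L by rewrite mulr_ge0// sumr_ge0// => i _; rewrite !exprn_ge0.
have L1 : 0 < L + 1 by rewrite ltr_wpDl.
exists (L + 1)^-1; first by rewrite invr_gt0.
move=> z z1 g; have z0 : z != 0 by rewrite -md_gt0 z1.
have zi : md z^-1 = 1 by rewrite mdV z1 invr1.
pose w1 := z^-1 *: w.
have w1E x f : chi x -> md (x (iter f U w1)) = md (x (iter f U w)).
  move=> cx; rewrite /w1 (lin_scale (lin_iter (aut_lin au) f)) (chZ _ _ cx) mdM zi mul1r//.
have wnE x : chi x -> md (x (wn mul one w1 U N)) = md (x (wn mul one w U N)).
  move=> cx; rewrite !(ch_wn _ _ _ cx) !md_prod; apply: eq_bigr => i _; exact: w1E.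
have hB1 x : chi x -> (2 ^+ beta)^-1 <= md (x w1) <= 2 ^+ beta.
  by move=> cx; rewrite (w1E x 0%N cx); exact: hB.
have dN1 : dichotomy_at mul one U V w1 N.
  move=> t ct; rewrite (wnE _ ct) (wnE _ (chi_sh N (aut_sym au) ct)); exact: dN.
have := dichotomy_low ba ss au hB1 dN1 g; rewrite -/L => h.
have E : wop mul w1 U g - g = z^-1 *: (wop mul w U g - z *: g).
  by rewrite scalerBr scalerA mulVf// scale1r /wop /w1 (ba_mulZl ba).
rewrite E snZ// zi mul1r in h.
rewrite ler_pdivrMl//; apply: le_trans h _; rewrite ler_wpM2r ?sn_ge0// lerDl//.
Qed.

(** Passing to [w_N] and [U^N] turns the dichotomy at [N] into one at step 1. As [N] is a power of
    two, the operators [(W^N)^(2^j) - 1] are among those known to have dense range. *)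
Lemma sup_to_norm w v (c : R) : mul w v = one -> 0 < c ->
  (forall g, c * sn g <= sn (wop mul w U g - g)) -> approx_onto mul one (wop mul w U) 1 ->
  (forall f, exists u, wop mul w U u - u = f) /\
  exists2 c : R, 0 < c & forall g, c * nrm g <= nrm (wop mul w U g - g).
Proof.
move=> wv c0 low on1; set W := wop mul w U in low on1 *.
have [i dN] := dichotomy_sup wv c0 low.
have [beta hB] := weight_bound ba wv.
have [c1 c10 low1] := sup_low_circle wv dN.
have onp := approx_onto_pow ba ss au hB c10 low1 on1.
pose N := (2 ^ i)%N; rewrite -/N in dN.
pose a := wn mul one w U N; pose U' := iter N U; pose V' := iter N V.
have au' : aut mul one U' V' by exact: aut_iter.
have WE : wop mul a U' = iter N W by apply/funext => g; rewrite /W (iter_wop ba _ _ _ au).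
have it S k : iter k (iter N S) = iter (k * N) S :> (A -> A).
  by apply/funext => g; elim: k => [|k IH] //; rewrite iterS IH mulSn iterD.
have on2 j : approx_onto mul one (iter (2 ^ j) (wop mul a U')) 1.
  by rewrite WE it -expnD; apply: onp; rewrite md1.
have dich t : chi t -> md (t a) <= 1 / 2 \/ 2 <= md (sh V' 1 t a) by exact: dN.
have gap := weight_gap ba ss au' dich on2.
have inv := weight_inv ba ss au' dich on2.
have ind := indicator_approx ba ss au' dich on2.
pose b := wn mul one v U N.
have ab : mul a b = one.
  apply: (char_ext ss) => x cx; rewrite (chM _ _ cx) !(ch_wn _ _ _ cx) -big_split /= (ch1 cx).
  apply: big1 => k _; have := chM w v (chi_sh k au cx); rewrite wv (ch1 (chi_sh k au cx)).
  by rewrite /sh => <-.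
(* The powers of [U^N] then grow at most like [(1 + 1/100)^k], the rate that [bern_decay]
   absorbs. *)
pose e : R := 1 / 100 / 2 ^+ N.
have N2 : 1 <= 2 ^+ N :> R by rewrite exprn_ege1// ler1n.
have N0 : 0 < 2 ^+ N :> R by rewrite exprn_gt0.
have e0 : 0 < e by rewrite !divr_gt0.
have eN : (1 + e) ^+ N <= 1 + 1 / 100.
  have h1 : 0 <= e <= 1.
    apply/andP; split; first exact: ltW.
    by rewrite /e ler_pdivrMr// [leRHS]mul1r (le_trans _ N2)//; lra.
  apply: le_trans (expr1D_le N h1) _; rewrite lerD2l mulrBr /e mulfVK ?gt_eqF//.
  by rewrite mulr1 gerBl ltW.
have [G G1 [gU gV]] := growth e0.
have gg (S : A -> A) : (forall k f, nrm (iter k S f) <= G * (1 + e) ^+ k * nrm f) ->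
  forall k g, nrm (iter k (iter N S) g) <= G * (1 + 1 / 100) ^+ k * nrm g.
  move=> gS k g; rewrite it; apply: le_trans (gS _ _) _; rewrite ler_wpM2r ?nrm_ge0//.
  rewrite ler_wpM2l ?(le_trans ler01)// mulnC exprM lerXn2r ?nnegrE ?exprn_ge0//.
  by rewrite addr_ge0// ltW.
have [n [onto lown]] := power_invertible ba ss C0 prodI au' ab G1 (gg _ gU) (gg _ gV) gap inv ind.
rewrite WE it in onto lown.
have lW : lin W by exact: (wop_lin ba w (aut_lin au)).
have b0 : 0 <= nrm w * (G * (1 + e)).
  by rewrite mulr_ge0 ?nrm_ge0// mulr_ge0 ?(le_trans ler01 G1)// addr_ge0// ltW.
have bW : bdd (nrm w * (G * (1 + e))) W.
  by apply: (bdd_wop ba) => g; exact: (gU 1%N).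
exact: (@invertible_root _ _ W lW (n * N)%N _ b0 bW onto lown).
Qed.

End Transfer.

(** * Exclusion of 0 and normalisation to the spectral value 1 *)

Theorem theorem6 (R : realType) (A : completeNormedModType (Cx R))
    (mul : A -> A -> A) (one : A) (U : A -> A) (w : A) :
  is_comm_banach_alg mul one ->
  regular mul one ->
  semisimple mul one ->
  (exists c : R, 0 < c /\
     forall (p : nat) (f : 'I_p -> A), (0 < p)%N ->
       `|aprod mul one f| <=
         (c * \sum_(j < p) complex.Re `|f j| *
            supnorm (shilov_boundary mul one)
              (fun t : {ptws A -> (Cx R)} => \prod_(k < p | k != j) t (f k)))%:C%C) ->
  all_peak_points mul one ->
  is_automorphism mul one U ->
  first_category_in (shilov_boundary mul one)
    [set t | shilov_boundary mul one t /\ periodic_point (induced_map U) t] ->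
  op_spectrum U = [set z : (Cx R) | `|z| = 1] ->
  (exists v : A, mul w v = one) ->
  op_spectrum (fun f : A => mul w (U f)) =
  fun_op_spectrum (shilov_boundary mul one) (check_alg mul one)
    (check_op mul one w U).
Proof.
move=> ba reg ss [C [C0 prodH]] pk aU cat sp [v wv].
have prodI := nrm_prod_ineq ba ss reg prodH C0.
have [V [au [bU bU0 hU] [bV bV0 hV] growth]] := aut_growth aU sp.
have dens := nonperiodic_dense ba ss reg cat.
have av := aut_sym au.
have [beta hB] := weight_bound ba wv.
pose T := wop mul w U; rewrite -[fun f => mul w (U f)]/T.
have lT : lin T by exact: (wop_lin ba w (aut_lin au)).
pose B : R := 2 ^+ beta; rewrite -/B in hB.
have B0 : 0 < B by rewrite exprn_gt0.
have T0 f : T (V (mul v f)) = f.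
  by rewrite /T /wop (aut_VK au) (ba_mulA ba) wv (ba_mul1 ba).
(* 0 lies in neither spectrum, so for the remaining values [w] can be divided by [l]. *)
have nT0 : ~ op_spectrum T 0.
  have K0 : 0 < bV * nrm v + 1 by rewrite ltr_wpDl// mulr_ge0 ?nrm_ge0.
  apply: (@not_op_spectrum_intro _ _ _ lT _ (bV * nrm v + 1)^-1).
  - by move=> f; exists (V (mul v f)); rewrite T0 scale0r subr0.
  - by rewrite invr_gt0.
  - move=> g; rewrite scale0r subr0 ler_pdivrMl//.
    have E : V (mul v (T g)) = g.
      by rewrite /T /wop (ba_mulA ba) (ba_mulC ba v) wv (ba_mul1 ba) (aut_K au).
    have h1 := hV (mul v (T g)); rewrite E in h1; apply: le_trans h1 _.
    have h2 := ler_wpM2l bV0 (nrm_mul ba v (T g)); apply: le_trans h2 _.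
    by rewrite mulrA ler_wpM2r ?nrm_ge0// lerDl.
have sn0 : sn mul one 0 <= 0 by apply: (sn_le ba ss) => t ct; rewrite (ch0 ct) md0.
have nS0 : ~ fun_op_spectrum (shilov_boundary mul one) (check_alg mul one) (check_op mul one w U) 0.
  apply: (@check_resolvent _ _ _ _ ba ss reg U V w beta au hB 0 B^-1).
  - by rewrite invr_gt0.
  - move=> g; rewrite scale0r subr0 ler_pdivrMl//; apply: (sn_le ba ss) => t ct.
    have ct' := chi_sh 1 av ct; have /andP[h _] := hB _ ct'.
    have := sn_ge ba (T g) ct'; rewrite (chM _ _ ct') mdM.
    have -> : sh V 1 t (U g) = t g by rewrite /sh /= (aut_K au).
    move=> h1; rewrite -ler_pdivrMl//; apply: le_trans h1.
    by rewrite ler_wpM2r ?md_ge0.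
  - move=> f e e0; exists (V (mul v f)).
    by rewrite -/T T0 scale0r subr0 subrr (le_trans sn0 (ltW e0)).
apply/seteqP; suff H l : l != 0 -> ~ op_spectrum T l <->
    ~ fun_op_spectrum (shilov_boundary mul one) (check_alg mul one) (check_op mul one w U) l.
  split=> l; apply: contraPP => nl; (have [->//|l0] := eqVneq l 0); exact/(H l l0).
move=> l0; pose w1 := l^-1 *: w; pose W := wop mul w1 U.
have TlE g : T g - l *: g = l *: (W g - g).
  by rewrite scalerBr /T /W /wop /w1 (ba_mulZl ba) scalerA mulfV// scale1r.
have wv1 : mul w1 (l *: v) = one.
  by rewrite /w1 (ba_mulZl ba) (lin_scale (lin_mul ba w)) wv scalerA mulVf// scale1r.
have ml : 0 < md l by rewrite md_gt0.
split=> nl.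
  have [onto [c c0 low]] := not_op_spectrum_low lT nl.
  have [||i dN] := @dichotomy_nrm _ _ _ _ ba ss reg C C0 prodI pk U V au dens growth
      w1 (l *: v) (c / md l) wv1.
  - by rewrite divr_gt0.
  - by move=> g; have := low g; rewrite TlE nrmZ mulrAC ler_pdivrMr// [leRHS]mulrC.
  have [c1 c10 low1] := sup_low_circle ba ss au wv1 dN.
  apply: (@check_resolvent _ _ _ _ ba ss reg U V w beta au hB l (c1 * md l)).
  - by rewrite mulr_gt0.
  - move=> g; have := low1 1 (md1 R) g; rewrite scale1r => h.
    by rewrite -/T TlE snZ// [leLHS]mulrAC mulrC ler_pM2l.
  - move=> f e e0; have [u hu] := onto f; exists u.
    by rewrite -/T hu subrr (le_trans sn0 (ltW e0)).
have [[c c0 low] onto] := check_resolvent_low ba ss reg au hB nl.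
have [|||onW [c2 c20 lowW]] := @sup_to_norm _ _ _ _ ba ss reg C C0 prodI pk U V au dens growth
    w1 (l *: v) (c / md l) wv1.
- by rewrite divr_gt0.
- by move=> g; have := low g; rewrite -/T TlE snZ// mulrAC ler_pdivrMr// [leRHS]mulrC.
- move=> f e e0; have [q hq] := onto (l *: f) _ (mulr_gt0 ml e0); exists q.
  by move: hq; rewrite scale1r -/T TlE -scalerBr snZ// ler_pM2l.
apply: (@not_op_spectrum_intro _ _ _ lT _ (c2 * md l)).
- move=> f; have [u hu] := onW (l^-1 *: f); exists u.
  by rewrite TlE hu scalerA mulfV// scale1r.
- by rewrite mulr_gt0.
- by move=> g; rewrite TlE nrmZ [leLHS]mulrAC mulrC ler_pM2l.
Qed.
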